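(* The greedy algorithm described below, implemented with disjoint-set (union-find) data structures, finds an optimal solution of the local heating problem in time $\mathcal{O}(T\,\alpha(T))$, where $\alpha$ is the inverse Ackermann function.
   Context: Time is discretized into intervals $\mathcal{T}=\{1,\dots,T\}$. The local heating problem (in reformulated form) is: minimize $\sum_{t\in\mathcal{T}} P_t x_t$ subject to $A_t \le \sum_{i=1}^t x_i \le B_t$ for all $t\in\mathcal{T}$ and $x_t\in\{0,1\}$, where $P_t$ is the (possibly negative) price of running the converter in interval $t$. The integer sequences $(A_t)_t$ and $(B_t)_t$ (with $t=0,\dots,T$) each satisfy $Z_0=0$ and $Z_{t-1}\le Z_t\le Z_{t-1}+1$ for all $t\in\mathcal{T}$, and $A_t\le B_t$ for all $t\in\mathcal{T}$. The greedy algorithm starts with $x_t:=0$ for all $t$ and processes the intervals $t^*\in\mathcal{T}$ in order of increasing price $P_{t^*}$. If $A_{t^*-1}<B_{t^*}$ and ($A_{t^*-1}<A_T$ or $P_{t^*}<0$), it sets $x_{t^*}:=1$ and updates the bounds: with $t_A=\max\{t\in\mathcal{T}: A_t=A_{t^*-1}\}+1$ and $t_B=\min\{t\in\mathcal{T}: B_t=B_{t^*}\}$, replace $A_t$ by $A_t-1$ for all $t\ge t_A$ and $B_t$ by $B_t-1$ for all $t\ge t_B$. In this version, the queries (finding $t_A,t_B$, testing $A_{t^*-1}<A_T$ and $A_{t^*-1}<B_{t^*}$) and the updates are maintained with three disjoint-set data structures: one partitioning $\mathcal{T}$ by the value $t_B$, one by the value $t_A$, and one partitioning $\mathcal{T}$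 into maximal classes of intervals with equal $A_{t-1}$ and equal $B_t$, storing the difference $B_t-A_{t-1}$ only for classes that are local minima of this difference.
   Formalization: The order of the intervals by increasing price is taken as part of the input, so sorting the prices is not counted in the running time; with comparison sorting of arbitrary real prices included, O(T α(T)) would be impossible. *)

(* Defs.v *)
From HB Require Import structures.
From mathcomp Require Import all_boot all_order all_algebra.

Set Implicit Arguments.
Unset Strict Implicit.
Unset Printing Implicit Defensive.

Import Order.TTheory GRing.Theory Num.Theory.

Local Open Scope ring_scope.

(* Intervals are the naturals 1, ..., T.  The prices, bounds
   and solutions are functions on nat of which only the indices 1..T (0..T for
   the bounds) matter. *)

(** * The local heating problem *)

Definition bound_seq (T : nat) (Z : nat -> int) : Prop :=
  Z 0%N = 0 /\
  forall t : nat, (1 <= t <= T)%N -> Z t.-1 <= Z t /\ Z t <= Z t.-1 + 1.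

Definition feasible (T : nat) (A B : nat -> int) (x : nat -> bool) : Prop :=
  forall t : nat, (1 <= t <= T)%N ->
    A t <= \sum_(1 <= i < t.+1) (x i)%:Z /\
    \sum_(1 <= i < t.+1) (x i)%:Z <= B t.

Definition cost (R : realDomainType) (T : nat) (P : nat -> R)
    (x : nat -> bool) : R :=
  \sum_(1 <= t < T.+1) P t * (x t)%:R.

Definition optimal (R : realDomainType) (T : nat) (P : nat -> R)
    (A B : nat -> int) (x : nat -> bool) : Prop :=
  feasible T A B x /\
  forall y : nat -> bool, feasible T A B y -> cost T P x <= cost T P y.

(** * The greedy algorithm *)

Record greedy_state := GreedyState {
  gx : nat -> bool;
  gA : nat -> int;
  gB : nat -> int
}.

(* The maximum over the empty set is 0.  The set is empty only if t = 1 and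
   A 1 <> A 0, and the value is then 1, as if u ranged over 0, ..., T. *)
Definition idx_A (T : nat) (A : nat -> int) (t : nat) : nat :=
  (\max_(1 <= u < T.+1 | A u == A t.-1) u).+1.

(* The default value t belongs to the set when 1 <= t <= T. *)
Definition idx_B (T : nat) (B : nat -> int) (t : nat) : nat :=
  \big[minn/t]_(1 <= u < T.+1 | B u == B t) u.

Definition greedy_step (R : realDomainType) (T : nat) (P : nat -> R)
    (s : greedy_state) (t : nat) : greedy_state :=
  let: GreedyState x A B := s in
  if (A t.-1 < B t) && ((A t.-1 < A T) || (P t < 0)) then
    GreedyState
      (fun u => if u == t then true else x u)
      (fun u => if (idx_A T A t <= u)%N then A u - 1 else A u)
      (fun u => if (idx_B T B t <= u)%N then B u - 1 else B u)
  else s.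

Definition greedy (R : realDomainType) (T : nat) (P : nat -> R)
    (A B : nat -> int) (ord : seq nat) : nat -> bool :=
  gx (foldl (greedy_step T P) (GreedyState (fun=> false) A B) ord).

Definition price_order (R : realDomainType) (T : nat) (P : nat -> R)
    (ord : seq nat) : Prop :=
  perm_eq ord (iota 1 T) /\ sorted (fun i j => P i <= P j) ord.

(** * The inverse Ackermann function *)

Fixpoint ack (m : nat) : nat -> nat :=
  match m with
  | 0%N => S
  | m'.+1 => fix ackm (n : nat) : nat :=
      match n with
      | 0%N => ack m' 1
      | n'.+1 => ack m' (ackm n')
      end
  end.

Lemma ltn_ack (m n : nat) : (n < ack m n)%N.
Proof.
elim: m n => [|m IHm] n //; elim: n => [|n IHn] /=.
  exact: leq_trans (IHm 1%N).
exact: leq_ltn_trans IHn (IHm _).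
Qed.

Lemma ack_unbounded (n : nat) : exists k : nat, (0 < k)%N && (n <= ack k k)%N.
Proof.
exists n.+1; rewrite /= ltnW //.
exact: leq_ltn_trans (leqnSn n) (ltn_ack n.+1 n.+1).
Qed.

Definition alpha (n : nat) : nat := ex_minn (ack_unbounded n).

(** * A random access machine with unit costs *)

(* The names are a fixed finite set, so that the programs below have constant
   size.  [DA], [DB] and [DD] name the three disjoint-set structures. *)
Inductive ds := DA | DB | DD.

Inductive var :=
  vT | vi | vt | vcur | vnxt | vrx | vry | vroot | vtA | vtB
| va | vc | ve | vf | vg | vv.

Inductive arr :=
  inA | inB | inOrd | outX
| par of ds | rank of ds | valA | valB | lo | hi | dif.

Lemma ds_dec (d1 d2 : ds) : {d1 = d2} + {d1 <> d2}.
Proof. by decide equality. Defined.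

Lemma var_dec (v1 v2 : var) : {v1 = v2} + {v1 <> v2}.
Proof. by decide equality. Defined.

Lemma arr_dec (a1 a2 : arr) : {a1 = a2} + {a1 <> a2}.
Proof. by decide equality; apply: ds_dec. Defined.

HB.instance Definition _ := hasDecEq.Build ds (compareP ds_dec).
HB.instance Definition _ := hasDecEq.Build var (compareP var_dec).
HB.instance Definition _ := hasDecEq.Build arr (compareP arr_dec).

Record state := State {
  vars : var -> int;
  cells : arr -> int -> int
}.

Definition set_var (s : state) (v : var) (z : int) : state :=
  State (fun w => if w == v then z else vars s w) (cells s).

Definition set_cell (s : state) (a : arr) (i z : int) : state :=
  State (vars s)
    (fun b j => if (b == a) && (j == i) then z else cells s b j).

(* The only arithmetic is addition and subtraction, so the unit cost of an
   operation is realistic: all integers stay O(T).  The prices can only be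
   tested for their sign. *)
Inductive expr :=
| Lit of int
| Var of var
| Get of arr & expr
| Plus of expr & expr
| Minus of expr & expr.

Inductive test :=
| EqT of expr & expr
| LtT of expr & expr
| PriceNeg of expr
| Not of test
| And of test & test
| Or of test & test.

Inductive cmd :=
| Skip
| Assign of var & expr
| Put of arr & expr & expr
| Seq of cmd & cmd
| If of test & cmd & cmd
| While of test & cmd.

Fixpoint eval (s : state) (e : expr) : int :=
  match e with
  | Lit z => z
  | Var v => vars s v
  | Get a e1 => cells s a (eval s e1)
  | Plus e1 e2 => eval s e1 + eval s e2
  | Minus e1 e2 => eval s e1 - eval s e2
  end.

Fixpoint eval_cost (e : expr) : nat :=
  match e with
  | Lit _ => 1
  | Var _ => 1
  | Get _ e1 => (eval_cost e1).+1
  | Plus e1 e2 => (eval_cost e1 + eval_cost e2).+1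
  | Minus e1 e2 => (eval_cost e1 + eval_cost e2).+1
  end.

Fixpoint holds (R : realDomainType) (P : nat -> R) (s : state) (b : test) :
    bool :=
  match b with
  | EqT e1 e2 => eval s e1 == eval s e2
  | LtT e1 e2 => eval s e1 < eval s e2
  | PriceNeg e => P `|eval s e|%N < 0
  | Not b1 => ~~ holds P s b1
  | And b1 b2 => holds P s b1 && holds P s b2
  | Or b1 b2 => holds P s b1 || holds P s b2
  end.

Fixpoint holds_cost (b : test) : nat :=
  match b with
  | EqT e1 e2 => (eval_cost e1 + eval_cost e2).+1
  | LtT e1 e2 => (eval_cost e1 + eval_cost e2).+1
  | PriceNeg e => (eval_cost e).+1
  | Not b1 => (holds_cost b1).+1
  | And b1 b2 => (holds_cost b1 + holds_cost b2).+1
  | Or b1 b2 => (holds_cost b1 + holds_cost b2).+1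
  end.

(* [exec P c s s' n]: started in s, the command c terminates in s' after n
   elementary steps. *)
Inductive exec (R : realDomainType) (P : nat -> R) :
    cmd -> state -> state -> nat -> Prop :=
| exec_skip s : exec P Skip s s 1
| exec_set s v e :
    exec P (Assign v e) s (set_var s v (eval s e)) (eval_cost e).+1
| exec_put s a e1 e2 :
    exec P (Put a e1 e2) s (set_cell s a (eval s e1) (eval s e2))
      (eval_cost e1 + eval_cost e2).+1
| exec_seq c1 c2 s1 s2 s3 n1 n2 :
    exec P c1 s1 s2 n1 -> exec P c2 s2 s3 n2 ->
    exec P (Seq c1 c2) s1 s3 (n1 + n2)
| exec_if_true b c1 c2 s s' n :
    holds P s b -> exec P c1 s s' n ->
    exec P (If b c1 c2) s s' (holds_cost b + n).+1
| exec_if_false b c1 c2 s s' n :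
    ~~ holds P s b -> exec P c2 s s' n ->
    exec P (If b c1 c2) s s' (holds_cost b + n).+1
| exec_while_true b c s1 s2 s3 n1 n2 :
    holds P s1 b -> exec P c s1 s2 n1 -> exec P (While b c) s2 s3 n2 ->
    exec P (While b c) s1 s3 (holds_cost b + n1 + n2).+1
| exec_while_false b c s :
    ~~ holds P s b -> exec P (While b c) s s (holds_cost b).+1.

Declare Scope imp_scope.
Delimit Scope imp_scope with imp.
Bind Scope imp_scope with expr.
Bind Scope imp_scope with test.
Bind Scope imp_scope with cmd.
Coercion Var : var >-> expr.
Coercion Lit : int >-> expr.
Notation "a .[ i ]" := (Get a i%imp) : imp_scope.
Notation "e1 + e2" := (Plus e1 e2) : imp_scope.
Notation "e1 - e2" := (Minus e1 e2) : imp_scope.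
Notation "e1 == e2" := (EqT e1 e2) : imp_scope.
Notation "e1 != e2" := (Not (EqT e1 e2)) : imp_scope.
Notation "e1 < e2" := (LtT e1 e2) : imp_scope.
Notation "e1 <= e2" := (Not (LtT e2 e1)) : imp_scope.
Notation "b1 && b2" := (And b1 b2) : imp_scope.
Notation "b1 || b2" := (Or b1 b2) : imp_scope.
Notation "v ::= e" := (Assign v e%imp) (at level 75) : imp_scope.
Notation "c1 ;; c2" := (Seq c1 c2)
  (at level 80, right associativity, format "c1  ;; '/' c2") : imp_scope.
Notation "0" := (Lit 0) : imp_scope.
Notation "1" := (Lit 1) : imp_scope.
Notation "2" := (Lit 2) : imp_scope.
Notation "-1" := (Lit (- 1)) : imp_scope.

(** * Union-find: linking by rank and two-pass path compression *)

Local Open Scope imp_scope.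

(* r becomes the root of the tree of e in the structure d. *)
Definition find_ds (d : ds) (e : expr) (r : var) : cmd :=
  vcur ::= e ;;
  r ::= vcur ;;
  While ((par d).[r] != r) (r ::= (par d).[r]) ;;
  While (vcur != r)
    (vnxt ::= (par d).[vcur] ;;
     Put (par d) vcur r ;;
     vcur ::= vnxt).

(* Used only for e1 and e2 in distinct classes.  vrx and vry become the roots
   of the two classes, vroot the root of their union. *)
Definition union_ds (d : ds) (e1 e2 : expr) : cmd :=
  find_ds d e1 vrx ;;
  find_ds d e2 vry ;;
  If ((rank d).[vrx] < (rank d).[vry])
    (Put (par d) vrx vry ;;
     vroot ::= vry)
    (Put (par d) vry vrx ;;
     vroot ::= vrx ;;
     If ((rank d).[vrx] == (rank d).[vry])
       (Put (rank d) vrx ((rank d).[vrx] + 1))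
       Skip).

(* g becomes 0 if e1 and e2 are in the same class of d, and 1 otherwise. *)
Definition differ_ds (d : ds) (e1 e2 : expr) (g : var) : cmd :=
  find_ds d e1 vrx ;;
  find_ds d e2 vry ;;
  If (vrx == vry) (g ::= 0) (g ::= 1).

(** * The greedy algorithm on three disjoint-set structures

   All three structures partition {1, ..., T} into sets of consecutive
   elements, with the following data at the roots.
   - DA: the classes of equal A_{t-1}; valA is the common value t_A.
   - DB: the classes of equal B_t; valB is the common value t_B.
   - DD: the classes of equal A_{t-1} and equal B_t; the class is lo, ..., hi,
     and dif is its difference B_t - A_{t-1} if this is a local minimum among
     the classes, and -1 otherwise.
   The difference changes by at most 1 between neighbouring classes and is
   never negative.  Hence it is positive on a class that is not a local
   minimum, and A_{t-1} < B_t holds exactly when dif is not 0.  A class is a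
   local minimum if and only if A_{t-1} increases on entering it (or lo = 1)
   and B_t increases on leaving it (or hi = T).  The arrays A and B themselves
   are only read during the initialisation. *)

Definition union_A (e1 e2 : expr) : cmd :=
  union_ds DA e1 e2 ;; Put valA vroot (valA.[vry]).

Definition union_B (e1 e2 : expr) : cmd :=
  union_ds DB e1 e2 ;; Put valB vroot (valB.[vrx]).

Definition union_D (e1 e2 : expr) : cmd :=
  union_ds DD e1 e2 ;; Put lo vroot (lo.[vrx]) ;; Put hi vroot (hi.[vry]).

Definition left_high (v g : var) : cmd :=
  If (v == 1) (g ::= 1) (differ_ds DA (v - 1) v g).

Definition right_high (v g : var) : cmd :=
  If (v == vT) (g ::= 1) (differ_ds DB v (v + 1) g).

Definition init_singletons : cmd :=
  vi ::= 1 ;;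
  While (vi <= vT)
    (Put (par DA) vi vi ;; Put (rank DA) vi 0 ;; Put valA vi vi ;;
     Put (par DB) vi vi ;; Put (rank DB) vi 0 ;; Put valB vi vi ;;
     Put (par DD) vi vi ;; Put (rank DD) vi 0 ;;
     Put lo vi vi ;; Put hi vi vi ;; Put dif vi (-1) ;;
     Put outX vi 0 ;;
     vi ::= vi + 1).

Definition init_classes : cmd :=
  vi ::= 2 ;;
  While (vi <= vT)
    (If (inA.[vi - 2] == inA.[vi - 1]) (union_A (vi - 1) vi) Skip ;;
     If (inB.[vi - 1] == inB.[vi]) (union_B (vi - 1) vi) Skip ;;
     If ((inA.[vi - 2] == inA.[vi - 1]) && (inB.[vi - 1] == inB.[vi]))
       (union_D (vi - 1) vi) Skip ;;
     vi ::= vi + 1) ;;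
  If (inA.[vT - 1] == inA.[vT])
    (find_ds DA vT va ;; Put valA va (vT + 1)) Skip.

Definition init_minima : cmd :=
  vi ::= 1 ;;
  While (vi <= vT)
    (find_ds DD vi vc ;;
     ve ::= lo.[vc] ;; left_high ve vf ;;
     ve ::= hi.[vc] ;; right_high ve vg ;;
     If ((vf == 1) && (vg == 1))
       (Put dif vc (inB.[vi] - inA.[vi - 1])) Skip ;;
     vi ::= vi + 1).

(* B no longer increases between t_B - 1 and t_B. *)
Definition update_left : cmd :=
  differ_ds DA (vtB - 1) vtB vf ;;
  If (vf == 0)
    (find_ds DD vtB vc ;;
     ve ::= hi.[vc] ;; right_high ve vg ;;
     find_ds DD (vtB - 1) vc ;;
     If (vg == 1) (vv ::= dif.[vc]) (vv ::= -1) ;;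
     union_D (vtB - 1) vtB ;;
     Put dif vroot vv)
    (find_ds DD (vtB - 1) vc ;;
     Put dif vc (-1)).

(* A_{t-1} no longer increases between t = t_A and t = t_A + 1. *)
Definition update_right : cmd :=
  differ_ds DB vtA (vtA + 1) vf ;;
  If (vf == 0)
    (find_ds DD vtA vc ;;
     ve ::= lo.[vc] ;; left_high ve vg ;;
     find_ds DD (vtA + 1) vc ;;
     If (vg == 1) (vv ::= dif.[vc]) (vv ::= -1) ;;
     union_D vtA (vtA + 1) ;;
     Put dif vroot vv)
    (find_ds DD (vtA + 1) vc ;;
     Put dif vc (-1)).

(* On entry vc is the root of vt in DD and vtA the value t_A.  The difference
   decreases by 1 on t_B, ..., t_A, where no other class than the one of vt can
   be a local minimum. *)
Definition update : cmd :=
  Put outX vt 1 ;;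
  find_ds DB vt va ;;
  vtB ::= valB.[va] ;;
  If (dif.[vc] != -1) (Put dif vc (dif.[vc] - 1)) Skip ;;
  If (1 < vtB) (union_B (vtB - 1) vt) Skip ;;
  If (vtA < vT) (union_A vt (vtA + 1))
    (If (vtA == vT) (find_ds DA vt va ;; Put valA va (vT + 1)) Skip) ;;
  If (1 < vtB) update_left Skip ;;
  If (vtA < vT) update_right Skip.

(* vtA <= vT is the test A_{t-1} < A_T. *)
Definition main_loop : cmd :=
  vi ::= 0 ;;
  While (vi < vT)
    (vt ::= inOrd.[vi] ;;
     find_ds DD vt vc ;;
     find_ds DA vt va ;;
     vtA ::= valA.[va] ;;
     If ((dif.[vc] != 0) && ((vtA <= vT) || PriceNeg vt)) update Skip ;;
     vi ::= vi + 1).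

Definition heating_prog : cmd :=
  init_singletons ;; init_classes ;; init_minima ;; main_loop.

Local Close Scope imp_scope.

(* The order by price is part of the input: sorting the prices is not counted.
   Everything not mentioned here is arbitrary in the initial state. *)
Definition initial_state (T : nat) (A B : nat -> int) (ord : seq nat)
    (s : state) : Prop :=
  [/\ vars s vT = T%:Z,
      forall t : nat, (t <= T)%N -> cells s inA t%:Z = A t,
      forall t : nat, (t <= T)%N -> cells s inB t%:Z = B t
    & forall i : nat, (i < T)%N -> cells s inOrd i%:Z = (nth 0%N ord i)%:Z].

(* Main.v *)
(* Greedy: processing [t] keeps every feasible solution that agrees with the
   earlier decisions replaceable by one, of no larger cost, that also agrees
   with the decision on [t].  If [t] is taken, let [w] be the last index before
   [t] at which the partial sums of the solution meet the lower bound.  If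
   [w < t - 1], the solution takes [w + 1], which is traded for [t]; otherwise
   the first interval taken after [t] is traded, and if there is none, then
   [P t < 0] and [t] is added.

   Time: every operation costs a bounded number of elementary steps and finds.
   A find whose path has [l] edges lowers Tarjan's potential by at least
   [l - (K + 1)] when [K = alpha T + 2], because a node lowers its potential if
   some proper ancestor on the path has the same level; a union raises it by at
   most [K].

   Correctness of the program: the three partitions are the level sets of the
   nondecreasing functions [A_{t-1}], [B_t] and [A_{t-1} + B_t], so that lowering
   a bound by 1 from some index on merges two neighbouring classes. *)
Require Import Defs.
From mathcomp Require Import all_boot all_order all_algebra zify.
From Stdlib Require Import FunctionalExtensionality.

Set Implicit Arguments.
Unset Strict Implicit.
Unset Printing Implicit Defensive.

Import Order.TTheory GRing.Theory Num.Theory.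

(** Earlier decisions are absorbed into the lowered bounds: by [feasible_step] these describe
    exactly the problem that is left once [t] is taken, so the exchange argument only compares
    solutions on the intervals still to come. The sum of two nondecreasing functions takes equal
    values only where both do; hence the third partition is given by a single monotone function,
    too, and one union lemma serves all three structures. Two obstacles shape the rest. Every query
    compresses paths, so facts about a structure are stated through a root function that finds leave
    unchanged. During an update the bounds, the classes and the stored differences change at
    different moments; the invariant [minima] therefore takes both bounds and the difference
    function as independent arguments, so that each intermediate state can be described. *)

Definition upd (S : Type) (p : nat -> S) (x : nat) (r : S) : nat -> S :=
  fun y => if y == x then r else p y.

(** * The amortised cost of union-find *)

Section Ackermann.

(* The variant of ack in Tarjan's analysis: the iteration starts at j, not at 1. *)
Fixpoint tower (k j : nat) : nat :=
  if k is k'.+1 then iter j.+1 (tower k') j else j.+1.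

Lemma iter_gt (f : nat -> nat) n j : (forall i, i < f i) -> j + n <= iter n f j.
Proof.
move=> hf; elim: n => [|n IH] /=; first by rewrite addn0.
by rewrite addnS; apply: leq_ltn_trans (hf _).
Qed.

Lemma iter_leq (f : nat -> nat) m n j : (forall i, i < f i) ->
  m <= n -> iter m f j <= iter n f j.
Proof.
move=> hf hmn; rewrite -(subnK hmn) iterD.
by apply: leq_trans (iter_gt _ _ hf); apply: leq_addr.
Qed.

Lemma iter_homo (f : nat -> nat) n i j : {homo f : a b / a <= b} ->
  i <= j -> iter n f i <= iter n f j.
Proof. by move=> hf hij; elim: n => //= n IH; apply: hf. Qed.

Lemma tower_gt k j : j < tower k j.
Proof.
elim: k j => [|k IH] j //=.
by apply: leq_ltn_trans (IH _); apply: leq_trans (iter_gt _ _ IH); rewrite leq_addr.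
Qed.

Lemma tower_homo k : {homo tower k : i j / i <= j}.
Proof.
elim: k => [|k IH] i j hij //=.
apply: (IH); apply: (@leq_trans (iter i (tower k) j)); first exact: iter_homo IH hij.
exact: iter_leq (tower_gt k) hij.
Qed.

Lemma ack_iter m n : ack m.+1 n = iter n.+1 (ack m) 1.
Proof. by elim: n => //= n ->. Qed.

(** Both sides iterate the level below [n.+1] times, but [ack] starts from 1 and [tower] from
    [n >= 1]. Positivity of the iterates is carried along because the induction hypothesis needs
    it. *)
Lemma ack_le_tower m n : 0 < n -> ack m n <= tower m n.
Proof.
elim: m n => [|m IH] n n0 //; rewrite ack_iter [tower _ _]/=.
suff h i : iter i (ack m) 1 <= iter i (tower m) n /\ 0 < iter i (ack m) 1.
  by case: (h n.+1).
elim: i => [|i [IHi hi]] //=; split.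
  by apply: leq_trans (IH _ hi) _; apply: tower_homo.
exact: leq_ltn_trans (ltn_ack _ _).
Qed.

Lemma tower_levels k : k < tower k 1.
Proof.
elim: k => [|k IH] //=.
exact: leq_ltn_trans IH (tower_gt _ _).
Qed.

(** The origin of [K = alpha T + 2]. With [k = alpha n], [n <= ack k k <= tower k k <= tower k.+1
    k], and as [k <= tower k.+1 1], the last value is at most
    [tower k.+1 (tower k.+1 1) = tower k.+2 1]. *)
Lemma tower_alpha n : n <= tower (alpha n).+2 1.
Proof.
rewrite /alpha; case: ex_minnP => k /andP[k0 hk] _.
apply: (leq_trans hk); apply: (leq_trans (ack_le_tower k k0)).
have h1 : k <= tower k.+1 1 by apply: leq_trans (ltnW (tower_levels k.+1)).
have h2 : tower k k <= tower k.+1 k.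
  by apply: tower_homo; apply: leq_trans (iter_gt _ _ (tower_gt k)); apply: leq_addr.
by apply: (leq_trans h2); rewrite [tower k.+2 1]/=; apply: (@tower_homo k.+1).
Qed.

Lemma alpha_gt0 n : 0 < alpha n.
Proof. by rewrite /alpha; case: ex_minnP => k /andP[]. Qed.

End Ackermann.

(** * The potential of a node *)

Section Potential.
Variable K : nat.

(* Tarjan's potential (K - level) r - iter of a node of rank r whose parent has
   rank q, in a form that needs neither the level nor the iteration count. *)
Definition node_pot (r q : nat) : nat :=
  \sum_(k < K) \sum_(i < r) (q < iter i.+1 (tower k) r).

Lemma node_pot_max r q : node_pot r q <= K * r.
Proof.
apply: (@leq_trans (\sum_(k < K) r)); last by rewrite sum_nat_const card_ord.
apply: leq_sum => k _; apply: (@leq_trans (\sum_(i < r) 1)).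
  by apply: leq_sum => i _; apply: leq_b1.
by rewrite sum1_card card_ord.
Qed.

Lemma node_pot_homo r q q' : q <= q' -> node_pot r q' <= node_pot r q.
Proof.
move=> h; apply: leq_sum => k _; apply: leq_sum => i _.
by case: (ltnP q') => // /(leq_ltn_trans h) ->.
Qed.

(** An iterate of [tower k] above the old parent rank [q] but not above the new one [q'] is a term
    of the double sum that falls from 1 to 0; no other term can grow. *)
Lemma node_pot_drop r q q' k i : q <= q' -> k < K -> 0 < i <= r ->
  q < iter i (tower k) r <= q' -> node_pot r q' < node_pot r q.
Proof.
move=> h hk hi /andP[h1 h2]; case: i hi h1 h2 => // i hi h1 h2.
have mono (k' : 'I_K) (i' : 'I_r) :
  ((q' < iter i'.+1 (tower k') r) <= (q < iter i'.+1 (tower k') r))%N.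
  by case: (ltnP q') => // /(leq_ltn_trans h) ->.
rewrite /node_pot (bigD1 (Ordinal hk)) //= [X in _ < X](bigD1 (Ordinal hk)) //=.
rewrite -addSn leq_add //; last first.
  by apply: leq_sum => k' _; apply: leq_sum => i' _; apply: mono.
rewrite (bigD1 (Ordinal hi)) //= [X in _ < X](bigD1 (Ordinal hi)) //=.
have h1' : q < tower k (iter i (tower k) r) by [].
have h2' : tower k (iter i (tower k) r) <= q' by [].
have h3 : (q' < tower k (iter i (tower k) r)) = false by rewrite ltnNge h2'.
rewrite h3 h1' add0n add1n ltnS.
by apply: leq_sum => i' _; apply: (mono (Ordinal hk)).
Qed.

(* Tarjan's level, except that a node of rank 0 has the label K: as ranks
   increase along a path, this label occurs only once on it. *)
Definition label (r q : nat) : nat :=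
  if r == 0 then K else \max_(k < K | tower k r <= q) k.

Lemma label_max r q : label r q <= K.
Proof.
rewrite /label; case: eqP => // _; apply/bigmax_leqP => k _; exact: ltnW.
Qed.

Lemma labelP r q : 0 < r < q -> q < tower K 1 ->
  let k := label r q in [/\ k < K, tower k r <= q & q < tower k.+1 r].
Proof.
move=> /andP[r0 rq] qK; rewrite /label eqn0Ngt r0 /=.
have K0 : 0 < K by case: K qK => //=; lia.
have [k hk ek] : exists2 k : 'I_K, tower k r <= q &
    \max_(k < K | tower k r <= q) k = k.
  (* Level 0 always qualifies, because [tower 0 r = r.+1 <= q]. *)
  have c0 : 0 < #|[pred k : 'I_K | tower k r <= q]| by apply/card_gt0P; exists (Ordinal K0).
  have [k hk ek] := eq_bigmax_cond (fun k : 'I_K => k : nat) c0.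
  by exists k => //; rewrite -ek; apply: eq_bigl.
rewrite ek; split=> //; rewrite ltnNge; apply/negP => hk1.
have [kK|kK] := ltnP k.+1 K.
  have := @leq_bigmax_cond _ (fun k : 'I_K => tower k r <= q) (fun k => k : nat)
    (Ordinal kK) hk1; rewrite ek /=; lia.
(* At the top level the upper bound comes from [q < tower K 1 <= tower K r]. *)
have eK : K = k.+1 by have := ltn_ord k; lia.
have h1 : tower K 1 <= tower K r by apply: tower_homo.
have h2 : tower K r <= q by rewrite eK.
lia.
Qed.

(* r and q are the ranks of a node and its parent, r1 and q1 those of a proper
   ancestor and its parent, and q' is the rank of the root. *)
Lemma node_pot_path r q r1 q1 q' :
  r < q -> q <= r1 -> r1 < q1 -> q1 <= q' -> q' < tower K 1 ->
  label r q = label r1 q1 -> node_pot r q' < node_pot r q.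
Proof.
move=> rq qr1 rq1 qq' qK; have r10 : 0 < r1 < q1 by lia.
have [k1K h1 _] := labelP r10 (leq_ltn_trans qq' qK).
(* A node of rank 0 has label [K], but its ancestor, of positive rank, has a smaller one. *)
have [->|r0] := posnP r; first by rewrite {1}/label eqxx => e; move: k1K; rewrite -e ltnn.
have r0q : 0 < r < q by lia.
have [kK h2 h3] := labelP r0q (ltac:(lia)) => e; rewrite -e in h1.
move: (label r q) => k in kK h1 h2 h3 {e k1K}.
(* The ancestor has the same level, so [tower k q <= tower k r1 <= q1 <= q']: the new parent rank is
   at least one application of [tower k] beyond the old one. *)
have h4 : tower k q <= q' by apply: leq_trans qq'; apply: leq_trans h1; apply: tower_homo.
have ex : exists i, (0 < i) && (q < iter i (tower k) r) by exists r.+1.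
(* [i] counts the iterations until [q] is exceeded. The iterate before is at most [q], so the [i]-th
   one is at most [tower k q <= q'] and lies in the gap. *)
case: (ex_minnP ex) => i /andP[i0 hi] mini.
have ir : i <= r.+1 by apply: mini.
have hi' : iter i (tower k) r <= q'.
  case: i i0 hi mini {ir} => // i _ _ mini; rewrite iterS.
  apply: leq_trans h4; apply: tower_homo; rewrite leqNgt; apply/negP => hi.
  have [i0|i0] := posnP i; first by move: hi; rewrite i0 /=; lia.
  by have := mini i; rewrite i0 hi => /(_ isT); rewrite ltnn.
have [ir'|ir'] := leqP i r; first by apply: (node_pot_drop (k := k) (i := i)); rewrite ?hi ?i0 //; lia.
(* The index [r.+1] is outside the sum for level [k], but [iter r.+1 (tower k) r] is [tower k.+1 r],
   the first term of the next level. That the next level is [K] is excluded by [q' < tower K 1]. *)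
have ei : i = r.+1 by lia.
have [kK'|kK'] := ltnP k.+1 K.
  apply: (node_pot_drop (k := k.+1) (i := 1)); rewrite ?r0 //; first lia.
  by apply/andP; split=> //; move: hi'; rewrite ei.
have eK : K = k.+1 by lia.
have h5 : tower K 1 <= tower K r by apply: tower_homo.
have h6 : tower K r <= q' by move: hi'; rewrite eK ei.
lia.
Qed.
End Potential.

(** * Rooted forests with ranks, compression and linking *)

Section Forest.
Variables T K : nat.
Implicit Types (p rk rt : nat -> nat) (x y z r : nat) (l : seq nat).

Notation dom x := (1 <= x <= T).

Definition roots p : nat := \sum_(1 <= x < T.+1) (p x == x).

(** [rt] is the root of each node, which compression leaves fixed. [forest_count] takes the place of
    the usual bound of the class size by a power of 2: a link removes one root and raises a rank by
    at most 1, so ranks stay below [T], and the potential needs no more. *)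
Record forest p rk rt : Prop := Forest {
  forest_dom x : dom x -> dom (p x);
  forest_rank x : dom x -> p x != x -> rk x < rk (p x);
  forest_parent x : dom x -> rt (p x) = rt x;
  forest_root x : dom x -> p x = x -> rt x = x;
  forest_count x : dom x -> rk x + roots p <= T }.

(** Induction from the root downwards: ranks are at most [T] and grow strictly along parents, so
    [T - rk x] decreases. *)
Lemma forest_ind p rk rt (Q : nat -> Prop) : forest p rk rt ->
  (forall x, dom x -> p x = x -> Q x) ->
  (forall x, dom x -> p x != x -> Q (p x) -> Q x) ->
  forall x, dom x -> Q x.
Proof.
move=> hf h0 h1 x; move: {2}(T - rk x) (leqnn (T - rk x)) => n.
elim: n x => [|n IH] x hn hx; have := forest_count hf hx.
  have [e _|ne] := eqVneq (p x) x; first exact: h0.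
  by have := forest_rank hf hx ne; have := forest_count hf (forest_dom hf hx); lia.
have [e _|ne _] := eqVneq (p x) x; first exact: h0.
apply: h1 => //; apply: IH; last exact: (forest_dom hf hx).
by have := forest_rank hf hx ne; have := forest_count hf (forest_dom hf hx); lia.
Qed.

Lemma forest_rt p rk rt x : forest p rk rt -> dom x ->
  [/\ dom (rt x), p (rt x) = rt x & rk x + (p x != x) <= rk (rt x)].
Proof.
move=> hf; move: x; apply: (forest_ind hf) => x hx px.
  by rewrite (forest_root hf hx px) px eqxx addn0.
rewrite (forest_parent hf hx) px => -[-> -> h]; split=> //.
have := forest_rank hf hx px; lia.
Qed.

(** The root of [x] is itself counted in [roots p], which makes the bound of [forest_count]
    strict. *)
Lemma rank_lt p rk rt x : forest p rk rt -> dom x -> rk x < T.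
Proof.
move=> hf hx; have := forest_count hf hx; have [hd hr _] := forest_rt hf hx.
rewrite /roots (bigD1_seq (rt x)) ?iota_uniq //=; last by rewrite mem_index_iota.
rewrite hr eqxx; lia.
Qed.

Fixpoint is_path p x l r : Prop :=
  if l is y :: l' then [/\ y = x, p x != x & is_path p (p x) l' r]
  else x = r.

Lemma path_exists p rk rt x : forest p rk rt -> dom x ->
  exists l, is_path p x l (rt x).
Proof.
move=> hf; move: x; apply: (forest_ind hf) => x hx px.
  by exists [::]; rewrite /= (forest_root hf).
by rewrite (forest_parent hf hx) => -[l hl]; exists (x :: l).
Qed.

Lemma path_mem p rk rt x l r y : forest p rk rt -> dom x -> is_path p x l r ->
  y \in l -> [/\ dom y, p y != y, rk x <= rk y & rt y = rt x].
Proof.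
move=> hf; elim: l x => // a l IH x hx /= [-> px hl]; rewrite inE.
case/orP=> [/eqP -> //|hy]; have [h1 h2 h3 h4] := IH _ (forest_dom hf hx) hl hy.
split=> //; last by rewrite h4 (forest_parent hf hx).
have := forest_rank hf hx px; lia.
Qed.

Lemma is_path_upd p x y l r s : is_path p x l r -> y \notin l ->
  is_path (upd p y s) x l r.
Proof.
elim: l x => // a l IH x /= [-> px hl]; rewrite inE negb_or => /andP[h1 h2].
have e : (x == y) = false by rewrite eq_sym (negbTE h1).
by rewrite /= /upd e; split=> //; apply: IH.
Qed.

Lemma roots_upd p x r : dom x -> roots (upd p x r) + (p x == x) = roots p + (r == x).
Proof.
move=> hx; have hin : x \in index_iota 1 T.+1 by rewrite mem_index_iota.
rewrite /roots !(bigD1_seq x hin (iota_uniq _ _)) /= /upd eqxx.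
set a := \sum_(_ <- _ | _) _; set b := \sum_(_ <- _ | _) _.
suff -> : a = b by lia.
by apply: eq_bigr => i /negbTE ->.
Qed.

Lemma forest_compress p rk rt x : forest p rk rt -> dom x -> p x != x ->
  forest (upd p x (rt x)) rk rt.
Proof.
move=> hf hx px; have [h1 h2 h3] := forest_rt hf hx.
have ne : rt x != x by apply: contraNneq px => <-; rewrite h2.
split=> y hy; rewrite /upd.
- by case: (y =P x) => // _; apply: (forest_dom hf hy).
- case: (y =P x) => [->|_ py]; last exact: (forest_rank hf hy py).
  by move=> _; move: h3; rewrite px; lia.
- case: (y =P x) => [->|_]; last exact: (forest_parent hf).
  exact: (forest_root hf h1 h2).
- case: (y =P x) => [-> e|_]; first by rewrite e eqxx in ne.
  exact: (forest_root hf hy).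
have := roots_upd p (rt x) hx; rewrite (negbTE ne) (negbTE px).
have := forest_count hf hy; rewrite -/(upd p x (rt x)); lia.
Qed.

Definition pot1 p rk x : nat :=
  if p x == x then K * rk x else node_pot K (rk x) (rk (p x)).

Definition potential p rk : nat := \sum_(1 <= x < T.+1) pot1 p rk x.

Definition labels p rk l : seq nat := [seq label K (rk y) (rk (p y)) | y <- l].

Lemma potential_upd p rk x r : dom x ->
  potential (upd p x r) rk + pot1 p rk x =
  potential p rk + (if r == x then K * rk x else node_pot K (rk x) (rk r)).
Proof.
move=> hx; have hin : x \in index_iota 1 T.+1 by rewrite mem_index_iota.
rewrite /potential !(bigD1_seq x hin (iota_uniq _ _)) /=.
rewrite [in X in X + _]/pot1 {1 2}/upd eqxx.
set a := \sum_(_ <- _ | _) _; set b := \sum_(_ <- _ | _) _.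
suff -> : a = b by lia.
by apply: eq_bigr => i /negbTE h; rewrite /pot1 /upd h.
Qed.

(** Only the term of [x] changes. If a later node of the path has the label of [x], [node_pot_path]
    makes it drop; otherwise the higher rank of the new parent cannot increase it. *)
Lemma potential_compress p rk rt x l : T <= tower K 1 ->
  forest p rk rt -> dom x -> p x != x -> is_path p (p x) l (rt x) ->
  potential (upd p x (rt x)) rk
    + (label K (rk x) (rk (p x)) \in labels p rk l) <= potential p rk.
Proof.
move=> hK hf hx px hl; have [h1 h2 h3] := forest_rt hf hx.
have ne : rt x != x by apply: contraNneq px => <-; rewrite h2.
have := potential_upd p rk (rt x) hx; rewrite /pot1 (negbTE ne) (negbTE px).
have [hd hr hk] := forest_rt hf (forest_dom hf hx); rewrite (forest_parent hf hx) in hk hd hr.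
have := @node_pot_homo K (rk x) (rk (p x)) (rk (rt x)).
case: (boolP (_ \in _)) => [/mapP[y hy e]|_] /=; last by lia.
have [y1 y2 y3 y4] := path_mem hf (forest_dom hf hx) hl hy.
have [_ _ y5] := forest_rt hf (forest_dom hf y1).
rewrite (forest_parent hf y1) y4 (forest_parent hf hx) in y5.
have hT := rank_lt hf h1.
have := @node_pot_path K _ _ _ _ _ (forest_rank hf hx px) y3 (forest_rank hf y1 y2).
by move=> /(_ (rk (rt x)) ltac:(lia) ltac:(lia) e); lia.
Qed.

(** [undup] keeps one node per label, the last on the path, for which no drop is guaranteed. These
    at most [K + 1] nodes are the amortised price of a find. *)
Lemma size_labels p rk l : size (undup (labels p rk l)) <= K.+1.
Proof.
rewrite -(size_iota 0 K.+1); apply: uniq_leq_size; first exact: undup_uniq.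
move=> k; rewrite mem_undup => /mapP[y _ ->]; rewrite mem_iota.
have := label_max K (rk y) (rk (p y)); lia.
Qed.

Lemma labels_upd p rk x r l : x \notin l -> labels (upd p x r) rk l = labels p rk l.
Proof.
move=> hx; apply/eq_in_map => y hy; rewrite /upd.
by case: eqP => // e; rewrite -e hy in hx.
Qed.

Definition link_root rt c r : nat -> nat :=
  fun z => if (rt z == c) || (rt z == r) then r else rt z.

(** The increment [e] covers linking by rank both with a tie and without. The node [c] stops being a
    root, and [K * rk c] was the largest possible term for its rank; the terms of the children of
    [r] do not grow. Only the term of [r] rises, by [K * e]. *)
Lemma forest_link p rk rt c r e : forest p rk rt ->
  dom c -> dom r -> p c = c -> p r = r -> c != r -> rk c < rk r + e -> e <= 1 ->
  forest (upd p c r) (upd rk r (rk r + e)) (link_root rt c r) /\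
  potential (upd p c r) (upd rk r (rk r + e)) <= potential p rk + K.
Proof.
move=> hf hc hr pc pr ne lt e1.
have nes : (r == c) = false by rewrite eq_sym (negbTE ne).
split.
  have rtr := forest_root hf hr pr; have rtc := forest_root hf hc pc.
  split=> y hy; rewrite /upd.
  - by case: (y =P c) => // _; apply: (forest_dom hf hy).
  - case: (y =P c) => [->|_ py].
      by rewrite eqxx (negbTE ne).
    have := forest_rank hf hy py; have [->|yr] := eqVneq y r; first by rewrite pr; lia.
    by case: (p y =P r) => [->|]; lia.
  - rewrite /link_root; case: (y =P c) => [->|_]; first by rewrite rtr rtc !eqxx orbT.
    by rewrite (forest_parent hf hy).
  - rewrite /link_root; case: (y =P c) => [->|/eqP/negbTE yc py].
      by move/eqP; rewrite nes.
    by rewrite (forest_root hf hy py) yc; case: eqP.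
  have := roots_upd p r hc; rewrite pc eqxx nes.
  have := forest_count hf hy; have := forest_count hf hr.
  change (roots (fun y => if y == c then r else p y)) with (roots (upd p c r)).
  by case: (y =P r) => [->|]; lia.
have hin : r \in index_iota 1 T.+1 by rewrite mem_index_iota.
rewrite /potential !(bigD1_seq r hin (iota_uniq _ _)) /=.
have -> : pot1 (upd p c r) (upd rk r (rk r + e)) r = K * (rk r + e).
  by rewrite /pot1 /upd nes pr !eqxx.
rewrite /pot1 pr eqxx.
set a := \sum_(_ <- _ | _) _; set b := \sum_(_ <- _ | _) _.
suff : a <= b by nia.
apply: leq_sum => i /negbTE ir; rewrite /upd ir; have [->|ic] := eqVneq i c.
  by rewrite pc !eqxx nes; apply: node_pot_max.
case: (p i =P i) => // _; case: (p i =P r) => [->|//].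
by apply: node_pot_homo; apply: leq_addr.
Qed.

End Forest.

Local Open Scope ring_scope.

(** * Optimality of the greedy algorithm *)

Section BoundSequences.
Variable T : nat.
Implicit Types A B Z : nat -> int.

Lemma bound_seq_mono Z u v :
  bound_seq T Z -> (u <= v <= T)%N -> Z u <= Z v.
Proof.
move=> [_ hZ]; elim: v => [|v IH] huv; first by have -> : u = 0%N by lia.
have [->//|neq] := eqVneq u v.+1.
have := hZ v.+1; rewrite /= => h; have := IH; lia.
Qed.

Lemma bound_seq_ge0 Z u : bound_seq T Z -> (u <= T)%N -> 0 <= Z u.
Proof.
by move=> hZ hu; case: (hZ) => <- _; apply: (bound_seq_mono hZ); rewrite leq0n.
Qed.

(** A description of t_A without the maximum. The value [T.+1] means that the bound does not
    increase any more between [t.-1] and [T]. *)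
Definition is_idx_A A (t v : nat) : Prop :=
  [/\ (t <= v <= T.+1)%N, A v.-1 = A t.-1 & (v <= T)%N -> A v != A v.-1].

Definition is_first (f : nat -> int) (t l : nat) : Prop :=
  [/\ (1 <= l <= t)%N, f l = f t & l = 1%N \/ f l.-1 != f l].

Definition is_last (f : nat -> int) (t h : nat) : Prop :=
  [/\ (t <= h <= T)%N, f h = f t & h = T \/ f h != f h.+1].

Lemma idx_AP A t :
  bound_seq T A -> (1 <= t <= T)%N -> is_idx_A A t (idx_A T A t).
Proof.
move=> hA ht; rewrite /is_idx_A /idx_A /=.
set m := \max_(_ <= _ < _ | _) _.
have ub u : (1 <= u <= T)%N -> A u = A t.-1 -> (u <= m)%N.
  move=> hu Au; apply: (@leq_bigmax_seq _ _ (fun u => A u == A t.-1) id u).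
    by rewrite mem_index_iota.
  by rewrite Au.
have hm : m = 0%N \/ (1 <= m <= T)%N /\ A m = A t.-1.
  rewrite /m big_nat_cond.
  apply: (big_ind (fun m => m = 0%N \/ (1 <= m <= T)%N /\ A m = A t.-1)); first by left.
    by move=> x y; rewrite /maxn; case: ifP.
  by move=> u /andP[hu /eqP Au]; right; split=> //; lia.
(* For [t = 1] the index [t.-1 = 0] is outside the range of the maximum, and the default value 0
   takes its place. *)
have hm2 : (t.-1 <= m <= T)%N /\ A m = A t.-1.
  have : (1 <= t.-1)%N -> (t.-1 <= m)%N by move=> h; apply: ub => //; lia.
  by case: hm => [-> h|[? ->] h]; split=> //; try lia; congr A; lia.
split; [lia|by case: hm2|move=> hmT; apply/eqP=> e].
suff : (m.+1 <= m)%N by lia.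
by apply: ub; [lia|rewrite e; case: hm2].
Qed.

Lemma idx_A_uniq A t v w : bound_seq T A ->
  is_idx_A A t v -> is_idx_A A t w -> v = w.
Proof.
move=> hA [v1 v2 v3] [w1 w2 w3].
have hv : (v <= T)%N -> A v.-1 < A v.
  by move=> h; have := v3 h; have := bound_seq_mono (u := v.-1) (v := v) hA; lia.
have hw : (w <= T)%N -> A w.-1 < A w.
  by move=> h; have := w3 h; have := bound_seq_mono (u := w.-1) (v := w) hA; lia.
have [lt|lt|//] := ltngtP v w.
- have := bound_seq_mono (u := v) (v := w.-1) hA; lia.
- have := bound_seq_mono (u := w) (v := v.-1) hA; lia.
Qed.

Lemma idx_BP B t : bound_seq T B -> (1 <= t <= T)%N ->
  is_first B t (idx_B T B t).
Proof.
move=> hB ht; rewrite /is_first /idx_B.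
set m := \big[_/_]_(_ <= _ < _ | _) _.
have lb u : (1 <= u <= T)%N -> B u = B t -> (m <= u)%N.
  move=> hu Bu; rewrite /m.
  have : u \in index_iota 1 T.+1 by rewrite mem_index_iota.
  elim: (index_iota _ _) => // a s IH; rewrite inE big_cons.
  case/orP=> [/eqP <-|/IH h]; first by rewrite Bu eqxx geq_minl.
  by case: ifP => // _; rewrite geq_min h orbT.
have [hm Bm] : (1 <= m <= T)%N /\ B m = B t.
  rewrite /m big_nat_cond.
  apply: (big_ind (fun m => (1 <= m <= T)%N /\ B m = B t)); first by split.
    by move=> x y; rewrite /minn; case: ifP.
  by move=> u /andP[hu /eqP Bu]; split=> //; lia.
have mt : (m <= t)%N by apply: lb.
split=> //; first lia.
have [->|m1] := eqVneq m 1%N; [by left|right].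
by apply/eqP => e; have := lb m.-1; rewrite e Bm; lia.
Qed.
End BoundSequences.

(** * The residual problem and the exchange of intervals *)

Section Greedy.
Variables (R : realDomainType) (T : nat) (P : nat -> R).
Implicit Types (A B : nat -> int) (x y z : nat -> bool).

Definition bounds A B : Prop :=
  [/\ bound_seq T A, bound_seq T B & forall t, (t <= T)%N -> A t <= B t].

Definition lower (Z : nat -> int) (v : nat) : nat -> int :=
  fun u => if (v <= u)%N then Z u - 1 else Z u.

Lemma lower_bound_seq Z v : bound_seq T Z -> (0 < v)%N ->
  ((v <= T)%N -> Z v = Z v.-1 + 1) -> bound_seq T (lower Z v).
Proof.
move=> [Z0 hZ] v0 hv; split; first by rewrite /lower leqn0 ifN //; lia.
move=> t ht; have := hZ t ht; rewrite /lower.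
have [e|ne] := eqVneq t v; first by rewrite e leqnn ifN; [move: (hv); rewrite -e; lia|lia].
by case: ifP; case: ifP; lia.
Qed.

Lemma bounds_step A B t : bounds A B -> (1 <= t <= T)%N -> A t.-1 < B t ->
  bounds (lower A (idx_A T A t)) (lower B (idx_B T B t)).
Proof.
move=> [hA hB hAB] ht lt; have [a1 a2 a3] := idx_AP hA ht.
have [b1 b2 b3] := idx_BP hB ht.
move: (idx_A T A t) (idx_B T B t) => v l in a1 a2 a3 b1 b2 b3 *.
split.
- apply: lower_bound_seq => //; first lia.
  move=> hv; have := a3 hv; case: hA => _ /(_ v); lia.
- apply: lower_bound_seq => //; first lia.
  move=> hl; have [A0 _] := hA; have [B0 hB'] := hB.
  (* If [l = 1], the step of [B] at [l] follows from [B 1 = B t > A t.-1 >= 0 = B 0]. *)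
  have := bound_seq_ge0 (u := t.-1) hA; have := hB' l.
  by case: b3 => [e|]; [rewrite e /= B0 -e|]; lia.
move=> u hu; have := hAB u hu; rewrite /lower.
case: ifP => h1; case: ifP => h2; rewrite ?lerD2r //; try lia.
(* The danger is where [B] is lowered and [A] is not, for [l <= u < v]. There [A u <= A v.-1 = A
   t.-1 < B t = B l <= B u]. *)
have := bound_seq_mono (u := u) (v := v.-1) hA.
have := bound_seq_mono (u := l) (v := u) hB; lia.
Qed.

Definition psum y (u : nat) : int := \sum_(1 <= i < u.+1) (y i)%:Z.

Lemma psum0 y : psum y 0 = 0.
Proof. by rewrite /psum big_geq. Qed.

Lemma psumS y u : psum y u.+1 = psum y u + (y u.+1)%:Z.
Proof. by rewrite /psum big_nat_recr. Qed.

Lemma psum_mono y u v : (u <= v)%N -> psum y u <= psum y v.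
Proof.
elim: v => [|v IH] huv; first by have -> : u = 0%N by lia.
have [->//|ne] := eqVneq u v.+1.
by rewrite psumS; have := IH; lia.
Qed.

Lemma psum_const y u v : (u <= v)%N -> (forall i, (u < i <= v)%N -> ~~ y i) ->
  psum y v = psum y u.
Proof.
elim: v => [|v IH] huv h; first by have -> : u = 0%N by lia.
have [->//|ne] := eqVneq u v.+1.
rewrite psumS IH //; [|lia|by move=> i hi; apply: h; lia].
by rewrite (negbTE (h _ _)) ?addr0 //; lia.
Qed.

Lemma psum_upd y t b u : (0 < t)%N ->
  psum (upd y t b) u =
  psum y u + (if (t <= u)%N then b%:Z - (y t)%:Z else 0).
Proof.
move=> t0; elim: u => [|u IH]; first by rewrite !psum0 ifN //; lia.
rewrite !psumS IH /upd; case: (eqVneq u.+1 t) => [e|ne].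
  by rewrite -e leqnn ltnn; lia.
by have -> : (t <= u.+1)%N = (t <= u)%N; lia.
Qed.

Lemma cost_upd y t b : (1 <= t <= T)%N ->
  cost T P (upd y t b) = cost T P y + P t * (b%:R - (y t)%:R).
Proof.
move=> ht; have hin : t \in index_iota 1 T.+1 by rewrite mem_index_iota; lia.
rewrite /cost !(bigD1_seq t hin (iota_uniq _ _)) /= /upd eqxx.
rewrite mulrBr [RHS]addrC addrA subrK; congr (_ + _).
by apply: eq_bigr => i /negbTE ->.
Qed.

Lemma feasibleE A B y : A 0%N = 0 -> B 0%N = 0 ->
  feasible T A B y <-> forall u, (u <= T)%N -> A u <= psum y u <= B u.
Proof.
move=> A0 B0; split=> h u hu.
  by case: u hu => [|u] hu; [rewrite psum0 A0 B0|apply/andP; apply: h].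
by apply/andP; apply: h; lia.
Qed.

Lemma cost_swap y t v : (1 <= t <= T)%N -> (1 <= v <= T)%N -> P t <= P v ->
  ~~ y t -> y v -> cost T P (upd (upd y v false) t true) <= cost T P y.
Proof.
move=> ht hv le yt yv; have ne : (t == v) = false.
  by apply/negbTE; apply: contraNneq yt => ->.
rewrite !cost_upd // /upd ne yv (negbTE yt) subr0 sub0r mulr1 mulrN1.
by rewrite -addrA gerDl addrC subr_le0.
Qed.

(** The support of [y] is confined to [t] and the later intervals [s], so whatever is traded for [t]
    lies in [s] and is at least as expensive. *)
Lemma exchange_in A B y (s : seq nat) t :
  bounds A B -> feasible T A B y ->
  (forall u, (1 <= u <= T)%N -> y u -> u \in t :: s) -> (1 <= t <= T)%N ->
  (forall v, v \in s -> P t <= P v) ->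
  A t.-1 < B t -> A t.-1 < A T \/ P t < 0 ->
  exists y', [/\ feasible T A B y',
    forall u, (1 <= u <= T)%N -> y' u -> u \in t :: s, y' t &
    cost T P y' <= cost T P y].
Proof.
move=> [hA hB hAB] fy sy ht hs lt hc.
have [yt|yt] := boolP (y t); first by exists y.
have [A0 _] := hA; have [B0 _] := hB.
have /(feasibleE _ A0 B0) fy' := fy.
(* Trading [v] for [t] lowers the sums on [v, ..., t - 1] or raises them on [t, ..., v - 1]; slack
   in that range is all it needs. *)
have swap v : (1 <= v <= T)%N -> y v ->
   (forall u, (v <= u < t)%N -> A u < psum y u) ->
   (forall u, (t <= u < v)%N -> psum y u < B u) ->
   exists y', [/\ feasible T A B y',
    forall u, (1 <= u <= T)%N -> y' u -> u \in t :: s, y' t &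
    cost T P y' <= cost T P y].
  move=> hv yv h1 h2; have ne : (t == v) = false.
    by apply/negbTE; apply: contraNneq yt => ->.
  exists (upd (upd y v false) t true); split.
  - apply/(feasibleE _ A0 B0) => u hu.
    rewrite !psum_upd; [|lia|lia]; rewrite /upd ne yv (negbTE yt).
    by have := h1 u; have := h2 u; have := fy' u hu; case: ifP; case: ifP; lia.
  - move=> u hu; rewrite /upd; case: (u =P t) => [->|_]; first by rewrite mem_head.
    by case: ifP => // _ /(sy _ hu).
  - by rewrite /upd eqxx.
  apply: cost_swap => //; apply: hs.
  by have := sy v hv yv; rewrite inE eq_sym ne.
have [w [hw Aw maxw]] : exists w, [/\ (w < t)%N, psum y w = A w &
    forall u, (w < u < t)%N -> A u < psum y u].
  have ex : exists w, (w < t)%N && (psum y w == A w) by exists 0%N; rewrite psum0 A0; lia.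
  have ub w : (w < t)%N && (psum y w == A w) -> (w <= t)%N by lia.
  case: (ex_maxnP ex ub) => w /andP[hw /eqP Aw] maxw; exists w; split=> // u hu.
  have uT : (u <= T)%N by lia.
  have /andP[h _] := fy' u uT; rewrite lt_neqAle h andbT; apply/eqP => e.
  by have := maxw u; rewrite -e eqxx andbT; lia.
(* If [w < t - 1], the sum at [w + 1] exceeds [A w.+1 >= A w = psum y w], so [w + 1] is taken, and
   the maximality of [w] is the slack needed. *)
have [wt|wt] := eqVneq w t.-1; last first.
  apply: (swap w.+1); [lia| |by move=> u hu; apply: maxw; lia|by move=> u; lia].
  have := maxw w.+1; have := bound_seq_mono (u := w) (v := w.+1) hA.
  by rewrite psumS; case: (y w.+1) => //; lia.
have [/hasP[v0]|/hasPn none] := boolP (has y (index_iota t T.+1)).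
  rewrite mem_index_iota => hv0 yv0.
  have ex : exists v, (t <= v <= T)%N && y v by exists v0; rewrite yv0 andbT; lia.
  case: (ex_minnP ex) => v /andP[hv yv] minv; apply: (swap v) => //; [lia|by move=> u; lia|].
  (* Nothing is taken from [t] to [v - 1], so the sums there are still [A t.-1 < B t <= B u]. *)
  move=> u hu; have := bound_seq_mono (u := t) (v := u) hB.
  suff : psum y u = A t.-1 by lia.
  rewrite -wt -Aw.
  apply: psum_const; first lia; move=> i hi; apply/negP => yi.
  have [e|] := eqVneq i t; first by rewrite e (negbTE yt) in yi.
  by have := minv i; rewrite yi andbT; lia.
have cst u : (t <= u <= T)%N -> psum y u = A t.-1.
  move=> hu; rewrite -wt -Aw; apply: psum_const; first lia.
  by move=> i hi; apply: none; rewrite mem_index_iota; lia.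
(* The sum at [T] is still [A t.-1] and at least [A T], so [t] can only have been selected for its
   negative price. *)
have hP : P t < 0.
  by case: hc => // hAT; have := fy' T; rewrite cst //; lia.
exists (upd y t true); split.
- apply/(feasibleE _ A0 B0) => u hu; rewrite psum_upd; last lia.
  rewrite (negbTE yt); have := fy' u hu; case: ifP => tu; last lia.
  by rewrite cst; [have := bound_seq_mono (u := t) (v := u) hB; lia|lia].
- move=> u hu; rewrite /upd; case: (u =P t) => [->|_]; first by rewrite mem_head.
  by move/(sy _ hu).
- by rewrite /upd eqxx.
by rewrite cost_upd // (negbTE yt) subr0 mulr1 gerDl ltW.
Qed.

(** If [A t.-1 >= B t], no feasible solution takes [t]: its sum would grow from at least [A t.-1] to
    more than [B t]. Otherwise [A T <= A t.-1] and [P t >= 0]; dropping [t] does not raise the cost,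
    and from [t] on the sums remain at least [psum y t.-1 >= A t.-1 >= A T]. *)
Lemma exchange_out A B y (s : seq nat) t :
  bounds A B -> feasible T A B y ->
  (forall u, (1 <= u <= T)%N -> y u -> u \in t :: s) -> (1 <= t <= T)%N ->
  ~~ ((A t.-1 < B t) && ((A t.-1 < A T) || (P t < 0))) ->
  exists y', [/\ feasible T A B y',
    forall u, (1 <= u <= T)%N -> y' u -> u \in s &
    cost T P y' <= cost T P y].
Proof.
move=> [hA hB hAB] fy sy ht hc.
have [A0 _] := hA; have [B0 _] := hB.
have /(feasibleE _ A0 B0) fy' := fy.
exists (upd y t false); have [yt|yt] := boolP (y t); last first.
  have e : upd y t false =1 y.
    by move=> u; rewrite /upd; case: eqP => // ->; rewrite (negbTE yt).
  split.
  - apply/(feasibleE _ A0 B0) => u /fy'.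
    by rewrite psum_upd ?(negbTE yt) ?subrr ?if_same ?addr0 //; lia.
  - move=> u hu; rewrite e => yu; have := sy u hu yu; rewrite inE => /orP[/eqP ut|//].
    by rewrite -ut yu in yt.
  by rewrite cost_upd // (negbTE yt) subrr mulr0 addr0.
have st : psum y t = psum y t.-1 + 1.
  by case: t ht yt {sy hc} => // t _ yt; rewrite psumS yt.
have [/andP[h1 h2] | /andP[h1 h2]] : (A t.-1 >= B t) && true \/ (A T <= A t.-1) && (0 <= P t).
- by move: hc; rewrite negb_and negb_or -!leNgt => /orP[->|]; [left|right].
- by have := fy' t; have := fy' t.-1; lia.
split.
- apply/(feasibleE _ A0 B0) => u hu; rewrite psum_upd; last lia.
  rewrite yt; have := fy' u hu; case: ifP => tu; last lia.
  have := psum_mono y tu; have := bound_seq_mono (u := u) (v := T) hA.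
  by have := fy' t.-1; lia.
- move=> u hu; rewrite /upd; case: eqP => // ut /(sy _ hu); rewrite inE.
  by move/eqP/negbTE: ut => ->.
by rewrite cost_upd // yt sub0r mulrN1 gerDl oppr_le0.
Qed.

(** Adding [t] raises the sums from [t] on, whereas the bounds drop from t_A >= t and t_B <= t on.
    The mismatch is harmless: on [t, ..., t_A - 1] the lower bound is still [A t.-1], which the sum
    has reached at [t - 1]; on [t_B, ..., t - 1] the upper bound is [B t], which the sum including
    [t] must respect at [t]. *)
Lemma feasible_step A B t z : bounds A B -> (1 <= t <= T)%N -> A t.-1 < B t ->
  ~~ z t ->
  feasible T (lower A (idx_A T A t)) (lower B (idx_B T B t)) z <->
  feasible T A B (upd z t true).
Proof.
move=> hb ht lt zt; have [[hA hB hAB] [[A'0 _] [B'0 _] _]] := (hb, bounds_step hb ht lt).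
have [a1 a2 a3] := idx_AP hA ht; have [b1 b2 b3] := idx_BP hB ht.
have [[A0 _] [B0 _]] := (hA, hB).
rewrite (feasibleE _ A0 B0) (feasibleE _ A'0 B'0) /lower.
move: (idx_A T A t) (idx_B T B t) => v l in a1 a2 a3 b1 b2 b3 *.
have e u : psum (upd z t true) u = psum z u + (t <= u)%N%:Z.
  by rewrite psum_upd ?(negbTE zt); [case: ifP; lia|lia].
split=> h u hu; have := h u hu; rewrite e.
  case: ifP => h1; case: ifP => h2; case: leqP => h3 //=; try lia.
move: (e t.-1) (e u) (e t) => et eu ett.
case: ifP => h1; case: ifP => h2; case: leqP => h3 //=; try lia.
- have := bound_seq_mono (u := u) (v := v.-1) hA; have := h t.-1.
  by have := psum_mono z (u := t.-1) (v := u); rewrite et; lia.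
- have := bound_seq_mono (u := l) (v := u) hB.
  by have := h t; have := psum_mono z (u := u) (v := t); rewrite ett leqnn; lia.
Qed.

(** The solution [r] is fixed before the competitor [y], so that one [r] is compared with all of
    them. Its feasibility is claimed only if some [y] is feasible: at the end of the list such a [y]
    vanishes on 1..T, and so does [r]. *)
Lemma greedy_exchange (ord : seq nat) A B x0 :
  bounds A B -> uniq ord -> {in ord, forall t, 1 <= t <= T}%N ->
  sorted (fun i j => P i <= P j) ord ->
  exists r, (forall u, gx (foldl (greedy_step T P) (GreedyState x0 A B) ord) u
               = x0 u || r u) /\
  forall y, feasible T A B y -> (forall u, (1 <= u <= T)%N -> y u -> u \in ord) ->
  [/\ feasible T A B r, forall u, r u -> u \in ord & cost T P r <= cost T P y].
Proof.
elim: ord A B x0 => [|t s IH] A B x0 hb /= us hs ss.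
  exists (fun=> false); split=> [u|y fy sy]; first by rewrite orbF.
  have e u : (1 <= u <= T)%N -> y u = false.
    by move=> hu; apply/negbTE/negP => /(sy _ hu).
  split=> //.
    move=> u hu; have := fy u hu.
    suff -> : \sum_(1 <= i < u.+1) (y i)%:Z = \sum_(1 <= i < u.+1) (false)%:Z by [].
    by apply: eq_big_nat => i hi; rewrite e //; lia.
  by rewrite /cost le_eqVlt; apply/orP; left; apply/eqP/eq_big_nat => i hi; rewrite e.
have ht : (1 <= t <= T)%N by apply: hs; rewrite mem_head.
have hs' : {in s, forall t, 1 <= t <= T}%N by move=> u us'; apply: hs; rewrite inE us' orbT.
have /andP[ts us'] := us.
have ss' := path_sorted ss.
have hPs v : v \in s -> P t <= P v.
  have tr : transitive (fun i j => P i <= P j) by move=> i j k; apply: le_trans.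
  by move/(order_path_min tr): ss => /allP h /h.
case: ifP => hc.
  have /andP[lt hc'] := hc.
  have [r [e hr]] := IH _ _ (fun u => if u == t then true else x0 u)
     (bounds_step hb ht lt) us' hs' ss'.
  exists (upd r t true); split.
    move=> u; rewrite e /upd; by case: eqP; rewrite ?orbT.
  move=> y fy sy.
  have [|y1 [fy1 sy1 y1t cy1]] := exchange_in hb fy sy ht hPs lt; first by case/orP: hc'; auto.
  (* Without [t], the exchanged solution is a competitor in the residual problem. *)
  pose z := upd y1 t false.
  have zt : ~~ z t by rewrite /z /upd eqxx.
  have zy : upd z t true =1 y1.
    by move=> u; rewrite /z /upd; case: eqP => // ->.
  have fz : feasible T (lower A (idx_A T A t)) (lower B (idx_B T B t)) z.
    apply/feasible_step => // u hu.
    suff <- : \sum_(1 <= i < u.+1) (y1 i)%:Z = \sum_(1 <= i < u.+1) (upd z t true i)%:Z.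
      exact: fy1.
    by apply: eq_bigr => i _; rewrite zy.
  have [|fr sr cr] := hr z fz.
    move=> u hu; rewrite /z /upd; case: eqP => // ut /(sy1 _ hu).
    by rewrite inE => /orP[/eqP|].
  have rt : ~~ r t by apply: contra ts => /sr.
  split.
  - by apply/(feasible_step hb ht lt rt).
  - by move=> u; rewrite /upd inE; case: eqP => //= _ /sr.
  apply: le_trans cy1; move: cr; rewrite !cost_upd // y1t (negbTE rt).
  by rewrite subr0 sub0r mulr1 mulrN1 lerBrDr.
have [r [e hr]] := IH _ _ x0 hb us' hs' ss'.
exists r; split=> // y fy sy.
have [y1 [fy1 sy1 cy1]] := exchange_out hb fy sy ht (negbT hc).
have [fr sr cr] := hr y1 fy1 sy1.
split=> //; first by move=> u /sr us''; rewrite inE us'' orbT.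
exact: le_trans cr cy1.
Qed.

(** Taking an interval exactly when [B] increases makes all partial sums equal to [B]. This is the
    competitor from which [greedy_exchange] gives the feasibility of the greedy solution. *)
Lemma feasible_exists A B : bounds A B -> exists y, feasible T A B y.
Proof.
move=> [hA hB hAB]; have [A0 _] := hA; have [B0 hB'] := hB.
exists (fun u => B u.-1 < B u).
suff e u : (u <= T)%N -> psum (fun u => B u.-1 < B u) u = B u.
  by apply/(feasibleE _ A0 B0) => u hu; rewrite e // lexx hAB.
elim: u => [|u IH] hu; first by rewrite psum0 B0.
by rewrite psumS IH /=; [have := hB' u.+1 hu; case: ltP => /=; lia|lia].
Qed.

Lemma greedy_optimal A B ord : bounds A B -> price_order T P ord ->
  optimal T P A B (greedy T P A B ord).
Proof.
move=> hb [hp hs]; have us : uniq ord by rewrite (perm_uniq hp) iota_uniq.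
have mo u : (u \in ord) = (1 <= u <= T)%N by rewrite (perm_mem hp) mem_iota; lia.
have hin : {in ord, forall t, 1 <= t <= T}%N by move=> u; rewrite mo.
have [r [e h]] := greedy_exchange (fun=> false) hb us hin hs.
have sup y u : (1 <= u <= T)%N -> y u -> u \in ord by rewrite mo.
have fg z : (forall u, z u = r u) -> (feasible T A B z <-> feasible T A B r) /\ cost T P z = cost T P r.
  move=> ez; split; last by apply: eq_bigr => i _; rewrite ez.
  have es u : \sum_(1 <= i < u.+1) (z i)%:Z = \sum_(1 <= i < u.+1) (r i)%:Z.
    by apply: eq_bigr => i _; rewrite ez.
  by split=> f u hu; have := f u hu; rewrite es.
have [fgr cgr] := fg (greedy T P A B ord) e.
have [y0 fy0] := feasible_exists hb.
split; first by apply/fgr; case: (h y0 fy0 (sup y0)).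
by move=> y fy; rewrite cgr; case: (h y fy (sup y)).
Qed.
End Greedy.

(** * Running time of the union-find programs *)

Definition ptr (s : state) (d : ds) (x : nat) : nat := `|cells s (par d) x%:Z|%N.
Definition rnk (s : state) (d : ds) (x : nat) : nat := `|cells s (rank d) x%:Z|%N.

Definition is_par (a : arr) : bool := if a is par _ then true else false.

Lemma set_cell_other s a i z b : b != a -> cells (set_cell s a i z) b = cells s b.
Proof. by move=> h; rewrite /set_cell /= (negbTE h). Qed.

Lemma set_cell_same s a (x y : nat) z :
  cells (set_cell s a x%:Z z) a y%:Z = if y == x then z else cells s a y%:Z.
Proof. by rewrite /set_cell /= eqxx. Qed.

Lemma ptr_set_cell s d (x r : nat) :
  ptr (set_cell s (par d) x%:Z r%:Z) d = upd (ptr s d) x r.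
Proof.
apply: functional_extensionality => y; rewrite /ptr set_cell_same /upd.
by case: eqP.
Qed.

Lemma rnk_set_cell s d (x r : nat) :
  rnk (set_cell s (rank d) x%:Z r%:Z) d = upd (rnk s d) x r.
Proof.
apply: functional_extensionality => y; rewrite /rnk set_cell_same /upd.
by case: eqP.
Qed.

Section UnionFind.
Variables (R : realDomainType) (P : nat -> R) (T K : nat).
Notation dom x := (1 <= x <= T)%N.

Definition well_typed (s : state) (d : ds) : Prop :=
  forall x, dom x -> 0 <= cells s (par d) x%:Z /\ 0 <= cells s (rank d) x%:Z.

(** Only the level sets of [f] count, so [f] may be replaced by any function with the same ones;
    which element of a class is its root is left to the linking. *)
Record is_ds (s : state) (d : ds) (f : nat -> int) (rt : nat -> nat) : Prop := IsDs {
  ds_typed : well_typed s d;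
  ds_forest : forest T (ptr s d) (rnk s d) rt;
  ds_class x y : dom x -> dom y -> (rt x == rt y) = (f x == f y) }.

Definition pot (s : state) (d : ds) : nat := potential T K (ptr s d) (rnk s d).

Lemma ptrE s d x : well_typed s d -> dom x -> cells s (par d) x%:Z = (ptr s d x)%:Z.
Proof. by move=> h /h [h1 _]; rewrite /ptr gez0_abs. Qed.

Lemma rnkE s d x : well_typed s d -> dom x -> cells s (rank d) x%:Z = (rnk s d x)%:Z.
Proof. by move=> h /h [_ h1]; rewrite /rnk gez0_abs. Qed.

Definition climb (d : ds) (r : var) : cmd :=
  While (Not (EqT (Get (par d) (Var r)) (Var r))) (Assign r (Get (par d) (Var r))).

Definition compress (d : ds) (r : var) : cmd :=
  While (Not (EqT (Var vcur) (Var r)))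
    (Seq (Assign vnxt (Get (par d) (Var vcur)))
    (Seq (Put (par d) (Var vcur) (Var r))
         (Assign vcur (Var vnxt)))).

Lemma exec_climb s d r x l z rt : well_typed s d -> forest T (ptr s d) (rnk s d) rt ->
  dom x -> is_path (ptr s d) x l z -> ptr s d z = z -> vars s r = x%:Z ->
  exists s', [/\ exec P (climb d r) s s' (9 * size l + 6), cells s' = cells s,
    vars s' r = z%:Z & forall v, v != r -> vars s' v = vars s v].
Proof.
move=> wt hf; elim: l x s wt hf => [|y l IH] x s wt hf hx /=.
  move=> <- pz sr; exists s; split=> //.
  by apply: exec_while_false => /=; rewrite sr ptrE // pz eqxx.
move=> [_ px hl] pz sr; pose s1 := set_var s r (ptr s d x)%:Z.
have [] := IH (ptr s d x) s1 wt hf (forest_dom hf hx) hl pz.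
  by rewrite /s1 /= eqxx.
move=> s' [h1 h2 h3 h4]; exists s'; split=> //.
- have -> : (9 * (size l).+1 + 6 = (5 + 3 + (9 * size l + 6)).+1)%N by lia.
  apply: (exec_while_true (s2 := s1) (n1 := 3) _ _ h1); first by rewrite /= sr ptrE.
  by rewrite /s1 -ptrE // -sr; apply: exec_set.
- by move=> v hv; rewrite h4 // /s1 /= (negbTE hv).
Qed.

Lemma forest_uniq p rk rt rt' : forest T p rk rt -> forest T p rk rt' ->
  forall x, dom x -> rt x = rt' x.
Proof.
move=> hf hf'; apply: (forest_ind hf) => x hx px.
  by rewrite (forest_root hf) // (forest_root hf').
by rewrite (forest_parent hf hx) (forest_parent hf' hx).
Qed.

(** A node whose label occurs again further up pays for its own visit by a drop of the potential.
    Preservation of [forest] is stated for every [rt'] so that any description of the structure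
    survives; by [forest_uniq] all of them agree. *)
Lemma exec_compress s d r x l rt : (T <= tower K 1)%N ->
  well_typed s d -> forest T (ptr s d) (rnk s d) rt ->
  dom x -> is_path (ptr s d) x l (rt x) -> r \notin [:: vcur; vnxt] ->
  vars s vcur = x%:Z -> vars s r = (rt x)%:Z ->
  exists s', [/\ exec P (compress d r) s s' (13 * size l + 5),
    (pot s' d + size l <= pot s d + size (undup (labels K (ptr s d) (rnk s d) l)))%N,
    forall v, v \notin [:: vcur; vnxt] -> vars s' v = vars s v,
    forall a, a != par d -> cells s' a = cells s a &
    well_typed s' d /\ forall rt', forest T (ptr s d) (rnk s d) rt' ->
      forest T (ptr s' d) (rnk s' d) rt'].
Proof.
move=> hK; elim: l x s => [|y l IH] x s wt hf hx /= hl hr sx sr.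
  exists s; split=> //; apply: exec_while_false => /=.
  by rewrite sx sr -hl eqxx.
case: hl => -> px hl.
have hrv : (r == vcur) = false /\ (r == vnxt) = false.
  by move: hr; rewrite !inE negb_or => /andP[/negbTE -> /negbTE ->].
pose s0 := set_cell (set_var s vnxt (ptr s d x)%:Z) (par d) x%:Z (rt x)%:Z.
pose s1 := set_var s0 vcur (ptr s d x)%:Z.
have [h1 h2 h3] := forest_rt hf hx.
have ne : rt x != x by apply: contraNneq px => <-; rewrite h2.
have xl : x \notin l.
  apply/negP => /(path_mem hf (forest_dom hf hx) hl) [_ _].
  have := forest_rank hf hx px; lia.
have p1 : ptr s1 d = upd (ptr s d) x (rt x) := ptr_set_cell _ d x (rt x).
have r1 : rnk s1 d = rnk s d by [].
have wt1 : well_typed s1 d.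
  move=> w hw; split; last by have [] := wt w hw.
  by rewrite set_cell_same; case: eqP => // _; have [] := wt w hw.
have f1 : forest T (ptr s1 d) (rnk s1 d) rt by rewrite p1 r1; apply: forest_compress.
have [] := IH (ptr s d x) s1 wt1 f1 (forest_dom hf hx) _ hr.
- by rewrite p1 (forest_parent hf hx); apply: is_path_upd.
- by [].
- by rewrite /s1 /= !(hrv.1, hrv.2) (forest_parent hf hx).
move=> s' [e1 e2 e3 e4 [e5 e6]]; exists s'; split.
- have -> : (13 * (size l).+1 + 5 = (4 + (3 + (3 + 2)) + (13 * size l + 5)).+1)%N by lia.
  apply: (exec_while_true (s2 := s1) (n1 := 3 + (3 + 2)) _ _ e1).
    by rewrite /= sx sr; by apply: contraNneq ne => -[{2}->].
  apply: (@exec_seq _ _ _ _ _ (set_var s vnxt (ptr s d x)%:Z)).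
    by rewrite -ptrE // -sx; apply: exec_set.
  apply: (@exec_seq _ _ _ _ _ s0); last exact: exec_set.
  have -> : s0 = set_cell (set_var s vnxt (ptr s d x)%:Z) (par d)
    (eval (set_var s vnxt (ptr s d x)%:Z) (Var vcur))
    (eval (set_var s vnxt (ptr s d x)%:Z) (Var r)).
    by rewrite /= hrv.2 sx sr.
  exact: exec_put.
- have := potential_compress hK hf hx px hl.
  move: e2; rewrite /pot p1 r1 labels_upd //.
  by case: (boolP (_ \in _)) => hin /=; lia.
- move=> v hv; rewrite e3 //; move: hv; rewrite !inE negb_or => /andP[/negbTE v1 /negbTE v2].
  by rewrite /s1 /s0 /= v1 v2.
- by move=> a ha; rewrite e4 // /s1 /= (negbTE ha).
split=> // rt' hf'; apply: e6; rewrite p1 r1 (forest_uniq hf hf' hx).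
exact: forest_compress.
Qed.

Lemma exec_find s d e r x f rt : (T <= tower K 1)%N ->
  is_ds s d f rt -> dom x -> eval s e = x%:Z -> r \notin [:: vcur; vnxt] ->
  exists s' k, [/\ exec P (find_ds d e r) s s' k,
    (k + 22 * pot s' d <= 22 * pot s d + 22 * K.+1 + eval_cost e + 14)%N,
    (forall v, v \notin [:: vcur; vnxt; r] -> vars s' v = vars s v) /\
      vars s' r = (rt x)%:Z,
    forall a, a != par d -> cells s' a = cells s a &
    forall f' rt', is_ds s d f' rt' -> is_ds s' d f' rt'].
Proof.
move=> hK [wt hf hcl] hx ex hr; have [l hl] := path_exists hf hx.
have [h1 h2 _] := forest_rt hf hx.
have hrv : (r == vcur) = false /\ (r == vnxt) = false.
  by move: hr; rewrite !inE negb_or => /andP[/negbTE -> /negbTE ->].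
pose s1 := set_var s vcur (eval s e); pose s2 := set_var s1 r (eval s1 (Var vcur)).
have s2r : vars s2 r = x%:Z by rewrite /s2 /s1 /= eqxx ex.
have [s3 [e3 c3 r3 v3]] := @exec_climb s2 d r x l _ rt wt hf hx hl h2 s2r.
have p3 : ptr s3 d = ptr s d by rewrite /ptr c3.
have k3 : rnk s3 d = rnk s d by rewrite /rnk c3.
have w3 : well_typed s3 d by move=> y hy; rewrite c3; apply: wt.
have f3 : forest T (ptr s3 d) (rnk s3 d) rt by rewrite p3 k3.
have l3 : is_path (ptr s3 d) x l (rt x) by rewrite p3.
have x3 : vars s3 vcur = x%:Z.
  by rewrite v3 ?[vcur == r]eq_sym ?hrv.1 // /s2 /= [vcur == r]eq_sym hrv.1 /s1 /= ex.
have [s4 [e4 u4 v4 c4 [w4 f4]]] := exec_compress hK w3 f3 hx l3 hr x3 r3.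
(* Apart from the evaluation of [e] and the edges, the two assignments and the failing tests that
   end the loops cost 1 + 2 + 6 + 5 = 14. *)
exists s4, ((eval_cost e).+1 + (2 + (9 * size l + 6 + (13 * size l + 5))))%N; split.
- apply: exec_seq (exec_set P s vcur e) _; apply: exec_seq (exec_set P s1 r (Var vcur)) _.
  exact: exec_seq e3 e4.
- have -> : pot s d = pot s3 d by rewrite /pot p3 k3.
  by have := size_labels K (ptr s3 d) (rnk s3 d) l; lia.
- split=> [v|]; last by rewrite v4.
  rewrite !inE !negb_or => /and3P[a1 a2 a3]; rewrite v4 ?inE ?negb_or ?a1 // v3 //.
  by rewrite /s2 /= (negbTE a3) /s1 /= (negbTE a1).
- by move=> a ha; rewrite c4 // c3.
by move=> f' rt' [_ hf' hcl']; split=> //; apply: f4; rewrite p3 k3.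
Qed.

(** One unit pays for a find, at most 22 (K + 1) + 19 amortised steps, for the link in a union, at
    most 22 K + 30, or for a single test or assignment of cost below 60. *)
Definition unit_cost : nat := 64 * K.+1.
Definition tpot (s : state) : nat := pot s DA + pot s DB + pot s DD.

(* Time is measured in units of unit_cost and amortised by 22 = 9 + 13 times
   the potential, 9 and 13 being the costs of an edge in climb and in compress.
   The postcondition receives the number of units that are left over from n. *)
Definition wp (c : cmd) (s : state) (n : nat) (Q : state -> nat -> Prop) : Prop :=
  exists s' k m, [/\ exec P c s s' k,
    (k + 22 * tpot s' + m * unit_cost <= n * unit_cost + 22 * tpot s)%N & Q s' m].

(* The parent arrays are exempt because of path compression; the classes of
   the structure d may change only if rank d is in cs. *)
Record eqv (vs : seq var) (cs : seq arr) (s s' : state) : Prop := Eqv {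
  eqv_var v : v \notin vs -> vars s' v = vars s v;
  eqv_cell a : ~~ is_par a -> a \notin cs -> cells s' a = cells s a;
  eqv_ds d f rt : rank d \notin cs -> is_ds s d f rt -> is_ds s' d f rt }.

Lemma eqv_trans vs vs' cs cs' s1 s2 s3 :
  eqv vs cs s1 s2 -> eqv vs' cs' s2 s3 -> eqv (vs ++ vs') (cs ++ cs') s1 s3.
Proof.
move=> [a1 a2 a3] [b1 b2 b3]; split=> [v|a ha|d f rt];
  rewrite mem_cat negb_or => /andP[h1 h2].
- by rewrite b1 // a1.
- by rewrite b2 // a2.
by move=> h; apply: b3 => //; apply: a3.
Qed.

Lemma eqv_weak vs vs' cs cs' s1 s2 : eqv vs cs s1 s2 ->
  all (mem vs') vs -> all (mem cs') cs -> eqv vs' cs' s1 s2.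
Proof.
move=> [a1 a2 a3] /allP h1 /allP h2; split=> [v hv|a ha hc|d f rt hd].
- by apply: a1; apply: contra hv => /h1.
- by apply: a2 => //; apply: contra hc => /h2.
by apply: a3; apply: contra hd => /h2.
Qed.

Lemma eqv_refl s : eqv [::] [::] s s.
Proof. by split. Qed.

Lemma pot_cells s s' d : cells s' (par d) = cells s (par d) ->
  cells s' (rank d) = cells s (rank d) -> pot s' d = pot s d.
Proof. by move=> h1 h2; rewrite /pot /ptr /rnk h1 h2. Qed.

Lemma is_ds_cells s s' d f rt : cells s' (par d) = cells s (par d) ->
  cells s' (rank d) = cells s (rank d) -> is_ds s d f rt -> is_ds s' d f rt.
Proof.
move=> h1 h2 [wt hf hcl]; split=> //; last by rewrite /ptr /rnk h1 h2.
by move=> x hx; rewrite h1 h2; apply: wt.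
Qed.

Lemma wp_seq c1 c2 s n Q : wp c1 s n (fun s' m => wp c2 s' m Q) -> wp (Seq c1 c2) s n Q.
Proof.
move=> [s1 [k1 [m1 [e1 h1 [s2 [k2 [m2 [e2 h2 hQ]]]]]]]].
by exists s2, (k1 + k2)%N, m2; split=> //; [apply: exec_seq e1 e2|lia].
Qed.

Lemma wp_mono c s n (Q Q' : state -> nat -> Prop) :
  wp c s n Q -> (forall s' m, Q s' m -> Q' s' m) -> wp c s n Q'.
Proof. by move=> [s1 [k1 [m1 [e1 h1 hQ]]]] h; exists s1, k1, m1; split=> //; apply: h. Qed.

Lemma wp_leq c s n n' Q : (n <= n')%N -> wp c s n Q -> wp c s n' Q.
Proof.
move=> h [s1 [k1 [m1 [e1 h1 hQ]]]]; exists s1, k1, m1; split=> //.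
by have := leq_mul h (leqnn unit_cost); lia.
Qed.

Lemma wp_skip s n (Q : state -> nat -> Prop) : Q s n -> wp Skip s n.+1 Q.
Proof.
move=> h; exists s, 1%N, n; split=> //; first exact: exec_skip.
by rewrite mulSn /unit_cost; lia.
Qed.

Lemma wp_assign v e s n (Q : state -> nat -> Prop) : (eval_cost e < 60)%N ->
  (forall s', eqv [:: v] [::] s s' -> vars s' v = eval s e -> Q s' n) ->
  wp (Assign v e) s n.+1 Q.
Proof.
move=> he h; exists (set_var s v (eval s e)), (eval_cost e).+1, n; split.
- exact: exec_set.
- by rewrite mulSn /unit_cost (_ : tpot (set_var _ _ _) = tpot s) //; lia.
apply: h; last by rewrite /= eqxx.
split=> [w|//|d f rt _]; first by rewrite inE /= => /negbTE ->.
exact: is_ds_cells.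
Qed.

Definition is_rank (a : arr) : bool := if a is rank _ then true else false.

Lemma wp_put a e1 e2 x z s n (Q : state -> nat -> Prop) :
  ~~ is_par a -> ~~ is_rank a -> (eval_cost e1 + eval_cost e2 < 60)%N ->
  eval s e1 = x%:Z -> eval s e2 = z ->
  (forall s', eqv [::] [:: a] s s' ->
    (forall y : nat, cells s' a y%:Z = if y == x then z else cells s a y%:Z) -> Q s' n) ->
  wp (Put a e1 e2) s n.+1 Q.
Proof.
move=> pa ra he h1 h2 h.
have hp d : par d != a by apply: contraNneq pa => <-.
have hr d : rank d != a by apply: contraNneq ra => <-.
exists (set_cell s a (eval s e1) (eval s e2)), (eval_cost e1 + eval_cost e2).+1, n; split.
- exact: exec_put.
- rewrite mulSn /unit_cost (_ : tpot (set_cell _ _ _ _) = tpot s); first by lia.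
  by rewrite /tpot !(@pot_cells s) ?set_cell_other.
apply: h; last by move=> y; rewrite h1 h2 set_cell_same.
split=> // [b _|d f rt _]; first by rewrite inE; apply: set_cell_other.
by apply: is_ds_cells; rewrite set_cell_other.
Qed.

Lemma wp_if b c1 c2 s n Q : (holds_cost b < 60)%N ->
  (holds P s b -> wp c1 s n Q) -> (~~ holds P s b -> wp c2 s n Q) ->
  wp (If b c1 c2) s n.+1 Q.
Proof.
move=> hb h1 h2; have [hc|hc] := boolP (holds P s b).
  have [s1 [k1 [m1 [e1 u1 hQ]]]] := h1 hc.
  exists s1, (holds_cost b + k1).+1, m1; split=> //; first exact: exec_if_true.
  by rewrite mulSn /unit_cost; move: u1; rewrite /unit_cost; lia.
have [s1 [k1 [m1 [e1 u1 hQ]]]] := h2 hc.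
exists s1, (holds_cost b + k1).+1, m1; split=> //; first exact: exec_if_false.
by rewrite mulSn /unit_cost; move: u1; rewrite /unit_cost; lia.
Qed.

Lemma wp_for b c s (I : nat -> state -> Prop) lo hi n m :
  (holds_cost b < 60)%N -> (lo <= hi)%N -> I lo s ->
  (forall i s, (lo <= i < hi)%N -> I i s ->
     holds P s b /\ wp c s n (fun s' _ => I i.+1 s')) ->
  (forall s, I hi s -> ~~ holds P s b) ->
  wp (While b c) s ((hi - lo) * n.+1 + 1 + m) (fun s' m' => I hi s' /\ m' = m).
Proof.
move=> hb; move e: (hi - lo)%N => j; elim: j lo s e => [|j IH] i s e hlh hI h0 h1.
  have eh : i = hi by lia.
  exists s, (holds_cost b).+1, m; split; [|by rewrite /unit_cost; lia|by rewrite -eh].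
  by apply: exec_while_false; apply: h1; rewrite -eh.
have [|hb1 [s1 [k1 [m1 [e1 u1 hI1]]]]] := h0 i s _ hI; first lia.
have ej : (hi - i.+1)%N = j by lia.
have hle : (i.+1 <= hi)%N by lia.
have [|s2 [k2 [m2 [e2 u2 hQ]]]] := IH i.+1 s1 ej hle hI1 _ h1.
  by move=> i' s' hi'; apply: h0; lia.
exists s2, (holds_cost b + k1 + k2).+1, m2; split=> //.
  exact: exec_while_true hb1 e1 e2.
by move: u1 u2; rewrite !mulnDl !mulSn !mulnDl /unit_cost; lia.
Qed.

(** * Rules for finds and unions *)

Section Calls.
Hypothesis hK : (T <= tower K 1)%N.

Lemma tpot_frame d s s' : (forall a, a != par d -> a != rank d -> cells s' a = cells s a) ->
  (tpot s' + pot s d = tpot s + pot s' d)%N.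
Proof.
move=> h; have e d' : d' != d -> pot s' d' = pot s d'.
  by move=> hd; rewrite (@pot_cells s s') ?h //; case: d d' hd {h} => [] [].
rewrite /tpot; case: d e {h} => e.
- by rewrite (e DB isT) (e DD isT); lia.
- by rewrite (e DA isT) (e DD isT); lia.
- by rewrite (e DA isT) (e DB isT); lia.
Qed.

Lemma wp_find d e r x f rt s n (Q : state -> nat -> Prop) :
  is_ds s d f rt -> dom x -> eval s e = x%:Z -> (eval_cost e <= 5)%N ->
  r \notin [:: vcur; vnxt] ->
  (forall s', eqv [:: vcur; vnxt; r] [::] s s' -> vars s' r = (rt x)%:Z -> Q s' n) ->
  wp (find_ds d e r) s n.+1 Q.
Proof.
move=> hd hx ex he hr h; have [s' [k [h1 h2 [h3 h4] h5 h6]]] := exec_find hK hd hx ex hr.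
exists s', k, n; split=> //.
  have := @tpot_frame d s s' (fun a p _ => h5 a p).
  by rewrite mulSn /unit_cost; lia.
apply: h => //; split=> // [a pa _|d' f' rt' _].
  by apply: h5; apply: contraNneq pa => ->.
have [->|ne] := eqVneq d' d; first exact: h6.
by apply: is_ds_cells; apply: h5 => //; apply: contraNneq ne => -[->].
Qed.

Definition merge_root rt a b ro : nat -> nat :=
  fun z => if (rt z == a) || (rt z == b) then ro else rt z : nat.

(** Ranks decide which old root becomes [ro]. The function [g] of the merged partition is left to
    the caller, who knows it as a lowered bound or a later truncation. The three units pay for two
    finds and one link. *)
Lemma wp_union d e1 e2 x y f rt s n (Q : state -> nat -> Prop) :
  is_ds s d f rt -> dom x -> dom y -> f x != f y ->
  eval s e1 = x%:Z -> (eval_cost e1 <= 5)%N -> (eval_cost e2 <= 5)%N ->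
  (forall s', eqv [:: vcur; vnxt; vrx] [::] s s' -> eval s' e2 = y%:Z) ->
  (forall s' ro, eqv [:: vcur; vnxt; vrx; vry; vroot] [:: rank d] s s' ->
     vars s' vrx = (rt x)%:Z -> vars s' vry = (rt y)%:Z -> vars s' vroot = ro%:Z ->
     (ro == rt x) || (ro == rt y) ->
     (forall g, (forall u v, dom u -> dom v -> (g u == g v) = (f u == f v) ||
          ((f u == f x) || (f u == f y)) && ((f v == f x) || (f v == f y))) ->
        is_ds s' d g (merge_root rt (rt x) (rt y) ro)) -> Q s' n) ->
  wp (union_ds d e1 e2) s n.+3 Q.
Proof.
move=> hd hx hy ne ex c1 c2 ey h.
apply: wp_seq; apply: (wp_find hd hx ex c1) => // s1 E1 r1.
have hd1 := eqv_ds E1 isT hd.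
apply: wp_seq; apply: (wp_find hd1 hy (ey _ E1) c2) => // s2 E2 r2.
have hd2 := eqv_ds E2 isT hd1; case: (hd2) => wt hf hcl.
have x2 : vars s2 vrx = (rt x)%:Z by rewrite (eqv_var E2).
have [dx px _] := forest_rt hf hx; have [dy py _] := forest_rt hf hy.
have nr : rt x != rt y by rewrite hcl.
have E := eqv_trans E1 E2.
(* The conclusion shared by the outcomes of the link: [x] below [y], or [y] below [x] with or
   without a rank increment. *)
have h' s' (ro : nat) k : exec P (If (LtT (Get (rank d) (Var vrx)) (Get (rank d) (Var vry)))
    (Seq (Put (par d) (Var vrx) (Var vry)) (Assign vroot (Var vry)))
    (Seq (Put (par d) (Var vry) (Var vrx)) (Seq (Assign vroot (Var vrx))
     (If (EqT (Get (rank d) (Var vrx)) (Get (rank d) (Var vry)))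
       (Put (rank d) (Var vrx) (Plus (Get (rank d) (Var vrx)) (Lit 1)))
       Skip)))) s2 s' k -> (k <= 30)%N ->
    (forall v, v != vroot -> vars s' v = vars s2 v) -> vars s' vroot = ro%:Z ->
    (forall a, a != par d -> a != rank d -> cells s' a = cells s2 a) ->
    well_typed s' d -> (pot s' d <= pot s2 d + K)%N ->
    (ro == rt x) || (ro == rt y) ->
    forest T (ptr s' d) (rnk s' d) (merge_root rt (rt x) (rt y) ro) ->
  wp (If (LtT (Get (rank d) (Var vrx)) (Get (rank d) (Var vry)))
    (Seq (Put (par d) (Var vrx) (Var vry)) (Assign vroot (Var vry)))
    (Seq (Put (par d) (Var vry) (Var vrx)) (Seq (Assign vroot (Var vrx))
     (If (EqT (Get (rank d) (Var vrx)) (Get (rank d) (Var vry)))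
       (Put (rank d) (Var vrx) (Plus (Get (rank d) (Var vrx)) (Lit 1)))
       Skip)))) s2 n.+1 Q.
  move=> ek k30 hv hro hc hwt hpot hor hfo; exists s', k, n; split=> //.
    have := tpot_frame hc.
    by rewrite mulSn /unit_cost; lia.
  have E3 : eqv [:: vroot] [:: rank d] s2 s'.
    split=> [v|a pa|d' f' rt']; first by rewrite inE; apply: hv.
      by rewrite inE; apply: hc; apply: contraNneq pa => ->.
    rewrite inE => hd'; apply: is_ds_cells; apply: hc => //.
    by apply: contraNneq hd' => -[->].
  apply: (h s' ro) => //.
  - by apply: (eqv_weak (eqv_trans E E3)).
  - by rewrite hv.
  - by rewrite hv.
  move=> g hg; split=> // u v hu hv'; rewrite hg // -!hcl // /merge_root.
  (* The new root is one of the two old ones, so it cannot be the root of a third class. *)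
  have hrx z : dom z -> (ro == rt z) = false \/ (rt z == rt x) || (rt z == rt y).
    by move=> _; have [e|_] := eqVneq ro (rt z); [right; rewrite -e|left].
  case hu': (_ || _); case hv'': (_ || _) => /=.
  - by rewrite eqxx orbT.
  - rewrite orbF; case: (hrx v hv') => [->|]; last by rewrite hv''.
    by apply/esym/eqP => e; rewrite e hv'' in hu'.
  - rewrite orbF eq_sym; case: (hrx u hu) => [->|]; last by rewrite hu'.
    by apply/esym/eqP => e; rewrite e hv'' in hu'.
  by rewrite orbF.
have ca := rnkE wt dx; have cb := rnkE wt dy.
have ra v : v = vrx -> eval s2 (Get (rank d) (Var v)) = (rnk s2 d (rt x))%:Z.
  by move=> -> /=; rewrite x2.
have rb v : v = vry -> eval s2 (Get (rank d) (Var v)) = (rnk s2 d (rt y))%:Z.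
  by move=> -> /=; rewrite r2.
have [lt|ge] := ltnP (rnk s2 d (rt x)) (rnk s2 d (rt y)).
  pose s3 := set_cell s2 (par d) (rt x)%:Z (rt y)%:Z.
  have [||h1 h2] := @forest_link T K _ _ _ (rt x) (rt y) 0 hf dx dy px py nr.
  - by rewrite addn0.
  - by [].
  have p3 : ptr s3 d = upd (ptr s2 d) (rt x) (rt y) := ptr_set_cell _ _ _ _.
  have k3 : rnk s3 d = upd (rnk s2 d) (rt y) (rnk s2 d (rt y) + 0)%N.
    by apply: functional_extensionality => z; rewrite /upd; case: eqP => [->|//]; rewrite addn0.
  apply: (h' (set_var s3 vroot (rt y)%:Z) (rt y) (5 + (3 + 2)).+1%N) => //.
  - apply: exec_if_true; first by rewrite /= x2 r2 ca cb.
    have e2' := exec_put P s2 (par d) (Var vrx) (Var vry); rewrite /= x2 r2 in e2'.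
    have e3' := exec_set P s3 vroot (Var vry); rewrite /= r2 in e3'.
    exact: exec_seq e2' e3'.
  - by move=> v hv; rewrite /= (negbTE hv).
  - by move=> a' h3 h4; apply: set_cell_other.
  - move=> z hz; split; last by have [] := wt z hz.
    by rewrite set_cell_same; case: eqP => // _; have [] := wt z hz.
  - by rewrite /pot -[ptr _ d]/(ptr s3 d) -[rnk _ d]/(rnk s3 d) p3 k3.
  - by rewrite eqxx orbT.
  by rewrite -[ptr _ d]/(ptr s3 d) -[rnk _ d]/(rnk s3 d) p3 k3.
pose s3 := set_var (set_cell s2 (par d) (rt y)%:Z (rt x)%:Z) vroot (rt x)%:Z.
pose e : nat := rnk s2 d (rt x) == rnk s2 d (rt y).
pose s4 := if rnk s2 d (rt x) == rnk s2 d (rt y)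
  then set_cell s3 (rank d) (rt x)%:Z (rnk s2 d (rt x) + 1)%N%:Z else s3.
have [|||h1 h2] := @forest_link T K _ _ _ (rt y) (rt x) e hf dy dx py px.
- by rewrite eq_sym.
- by rewrite /e; case: eqP => /=; lia.
- by rewrite /e; case: eqP.
have p4 : ptr s4 d = upd (ptr s2 d) (rt y) (rt x).
  by rewrite -(ptr_set_cell s2) /s4; case: ifP.
have k4 : rnk s4 d = upd (rnk s2 d) (rt x) (rnk s2 d (rt x) + e)%N.
  rewrite /s4 /e; case: ifP => _ /=; first exact: (rnk_set_cell s3).
  by apply: functional_extensionality => z; rewrite /upd; case: eqP => [->|//]; rewrite addn0.
have c4 a' : a' != par d -> a' != rank d -> cells s4 a' = cells s2 a'.
  by move=> h3 h4; rewrite /s4; case: ifP => _; rewrite ?(set_cell_other s3) // /s3 /= (negbTE h3).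
have v4 : vars s4 = vars s3 by rewrite /s4; case: ifP.
have [k [k30 ek]] : exists k, (k <= 18)%N /\ exec P
    (If (EqT (Get (rank d) (Var vrx)) (Get (rank d) (Var vry)))
       (Put (rank d) (Var vrx) (Plus (Get (rank d) (Var vrx)) (Lit 1))) Skip) s3 s4 k.
  have hh : holds P s3 (EqT (Get (rank d) (Var vrx)) (Get (rank d) (Var vry))) =
    (rnk s2 d (rt x) == rnk s2 d (rt y)) by rewrite /= x2 r2 ca cb.
  rewrite /s4; case: ifP => he; last first.
    exists 7; split=> //; apply: (@exec_if_false _ _ _ _ _ _ _ 1); first by rewrite hh he.
    exact: exec_skip.
  exists 12; split=> //; apply: (@exec_if_true _ _ _ _ _ _ _ 6); first by rewrite hh he.
  have -> : set_cell s3 (rank d) (rt x)%:Z (rnk s2 d (rt x) + 1)%N%:Z =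
    set_cell s3 (rank d) (eval s3 (Var vrx)) (eval s3 (Plus (Get (rank d) (Var vrx)) (Lit 1))).
    by rewrite /= x2 ca PoszD.
  exact: exec_put.
have em : merge_root rt (rt x) (rt y) (rt x) = link_root rt (rt y) (rt x).
  by apply: functional_extensionality => z; rewrite /merge_root /link_root orbC.
apply: (h' s4 (rt x) (5 + (3 + (2 + k)))%N.+1) => //.
- apply: exec_if_false; first by rewrite /= x2 r2 ca cb -leNgt.
  have e2' := exec_put P s2 (par d) (Var vry) (Var vrx); rewrite /= x2 r2 in e2'.
  have e3' := exec_set P (set_cell s2 (par d) (rt y)%:Z (rt x)%:Z) vroot (Var vrx).
  rewrite /= x2 in e3'; exact: exec_seq e2' (exec_seq e3' ek).
- by lia.
- by move=> v hv; rewrite v4 /= (negbTE hv).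
- by rewrite v4.
- move=> z hz; rewrite /s4; have [w1 w2] := wt z hz.
  case: ifP => _; split=> //.
  + by rewrite set_cell_other // (set_cell_same s2); case: eqP.
  + by rewrite (set_cell_same s3); case: eqP.
  + by rewrite (set_cell_same s2); case: eqP.
- by rewrite /pot p4 k4.
- by rewrite eqxx.
by rewrite p4 k4 em.
Qed.
End Calls.

End UnionFind.

(** * The partitions as level sets *)

Section LevelSets.
Variable T : nat.
Notation dom x := (1 <= x <= T)%N.
Implicit Types f g : nat -> int.

Definition high_left f (l : nat) : bool := (l == 1%N) || (f l.-1 != f l).
Definition high_right f (h : nat) : bool := (h == T) || (f h != f h.+1).

Definition mono_on f : Prop := forall u v, (1 <= u)%N -> (u <= v <= T)%N -> f u <= f v.

Definition merges f g x y : Prop := forall u v, dom u -> dom v ->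
  (g u == g v) = (f u == f v) ||
    ((f u == f x) || (f u == f y)) && ((f v == f x) || (f v == f y)).

Lemma first_class f x z l : mono_on f -> dom x -> dom z -> f z = f x ->
  is_first f x l -> is_first f z l.
Proof.
move=> hf hx hz e [h1 h2 h3]; split=> //; last by rewrite h2.
have := hf z l.-1; have := hf l.-1 l; case: h3 => [|/eqP]; lia.
Qed.

Lemma last_class f x z h : mono_on f -> dom x -> dom z -> f z = f x ->
  is_last T f x h -> is_last T f z h.
Proof.
move=> hf hx hz e [h1 h2 h3]; split=> //; last by rewrite h2.
have := hf h.+1 z; have := hf h h.+1; case: h3 => [|/eqP]; lia.
Qed.

Lemma first_uniq f x l l' : mono_on f -> dom x ->
  is_first f x l -> is_first f x l' -> l = l'.
Proof.
move=> hf hx [h1 h2 h3] [k1 k2 k3]; have := hf l l'.-1; have := hf l' l.-1.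
have := hf l.-1 l; have := hf l'.-1 l'; case: h3 => [|/eqP]; case: k3 => [|/eqP]; lia.
Qed.

Lemma last_uniq f x h h' : mono_on f -> dom x ->
  is_last T f x h -> is_last T f x h' -> h = h'.
Proof.
move=> hf hx [h1 h2 h3] [k1 k2 k3]; have := hf h.+1 h'; have := hf h'.+1 h.
have := hf h h.+1; have := hf h' h'.+1; case: h3 => [|/eqP]; case: k3 => [|/eqP]; lia.
Qed.

Lemma first_ext f g x l : (forall u v, dom u -> dom v -> (g u == g v) = (f u == f v)) ->
  dom x -> is_first f x l -> is_first g x l.
Proof.
move=> hg hx [a b c]; split=> //; first by apply/eqP; rewrite hg ?b //; lia.
have [->|l1] := eqVneq l 1%N; [by left|right].
by rewrite hg; [case: c|lia|lia]; first by move: l1 => /eqP.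
Qed.

Lemma last_ext f g x h : (forall u v, dom u -> dom v -> (g u == g v) = (f u == f v)) ->
  dom x -> is_last T f x h -> is_last T g x h.
Proof.
move=> hg hx [a b c]; split=> //; first by apply/eqP; rewrite hg ?b //; lia.
have [->|l1] := eqVneq h T; [by left|right].
by rewrite hg; [case: c|lia|lia]; first by move: l1 => /eqP.
Qed.

Section Merge.
Variables (f g : nat -> int) (x y : nat).
Hypothesis hm : merges f g x y.

Lemma first_other z l : dom z -> f z <> f x -> f z <> f y -> is_first f z l ->
  is_first g z l.
Proof.
move=> hz e1 e2 [h1 h2 h3]; split=> //.
- by apply/eqP; rewrite hm ?h2 ?eqxx //; lia.
case: h3 => [|h3]; [by left|have [|l1] := eqVneq l 1%N; [by left|right]].
by rewrite hm; [rewrite (negbTE h3) /=; lia|lia|lia].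
Qed.

Lemma last_other z h : dom z -> f z <> f x -> f z <> f y -> is_last T f z h ->
  is_last T g z h.
Proof.
move=> hz e1 e2 [h1 h2 h3]; split=> //.
- by apply/eqP; rewrite hm ?h2 ?eqxx //; lia.
case: h3 => [|h3]; [by left|have [|l1] := eqVneq h T; [by left|right]].
by rewrite hm; [rewrite (negbTE h3) /=; lia|lia|lia].
Qed.

Hypotheses (hf : mono_on f) (hx : dom x) (hy : dom y) (lt : f x < f y).

(** Since [f x < f y], the merged class begins where the class of [x] does: before that, [f] is
    below both values. *)
Lemma first_merge z l : dom z -> f z = f x \/ f z = f y -> is_first f x l ->
  is_first g z l.
Proof.
move=> hz e hl; have [h1 h2 h3] := hl; split.
- case: e => e; first by have [] := first_class hf hx hz e hl.
  by have := hf (u := z) (v := x); lia.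
- by apply/eqP; rewrite hm //; [rewrite h2; case: e => ->; rewrite !eqxx ?orbT|lia].
case: h3 => [|h3]; [by left|have [|l1] := eqVneq l 1%N; [by left|right]].
rewrite hm; [|lia|lia]; rewrite (negbTE h3) /=.
by have := hf (u := l.-1) (v := l); move/eqP: h3; lia.
Qed.

Lemma last_merge z h : dom z -> f z = f x \/ f z = f y -> is_last T f y h ->
  is_last T g z h.
Proof.
move=> hz e hl; have [h1 h2 h3] := hl; split.
- case: e => e; last by have [] := last_class hf hy hz e hl.
  by have := hf (u := y) (v := z); lia.
- by apply/eqP; rewrite hm //; [rewrite h2; case: e => ->; rewrite !eqxx ?orbT|lia].
case: h3 => [|h3]; [by left|have [|l1] := eqVneq h T; [by left|right]].
rewrite hm; [|lia|lia]; rewrite (negbTE h3) /=.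
by have := hf (u := h) (v := h.+1); move/eqP: h3; lia.
Qed.

End Merge.

End LevelSets.

(** * Class operations with data at the roots *)

Section Program.
Variables (R : realDomainType) (P : nat -> R) (T K : nat).
Notation dom x := (1 <= x <= T)%N.
Notation wp := (wp P T K).
Notation eqv := (eqv T).
Notation is_ds := (is_ds T).
Notation mono_on := (mono_on T).
Notation merges := (merges T).
Notation high_right := (high_right T).
Implicit Types (s : state) (f g : nat -> int) (rt : nat -> nat).

(* D relates an element, the ends of its class and its entry in dif. *)
Definition is_DD s f (D : nat -> nat -> nat -> int -> Prop) rt : Prop :=
  is_ds s DD f rt /\ forall x, dom x -> exists l h : nat,
    [/\ cells s lo (rt x)%:Z = l%:Z, cells s hi (rt x)%:Z = h%:Z,
        is_first f x l, is_last T f x h & D x l h (cells s dif (rt x)%:Z)].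

Lemma is_DD_eqv vs cs s s' f D rt : eqv vs cs s s' ->
  rank DD \notin cs -> lo \notin cs -> hi \notin cs -> dif \notin cs ->
  is_DD s f D rt -> is_DD s' f D rt.
Proof.
move=> E c1 c2 c3 c4 [h1 h2]; split; first exact: (eqv_ds E).
by move=> x /h2; rewrite !(eqv_cell E).
Qed.

Lemma is_DD_ext s f g (D D' : nat -> nat -> nat -> int -> Prop) rt :
  (forall u v, dom u -> dom v -> (g u == g v) = (f u == f v)) ->
  (forall x l h c, dom x -> is_first f x l -> is_last T f x h ->
     D x l h c -> D' x l h c) ->
  is_DD s f D rt -> is_DD s g D' rt.
Proof.
move=> hg hD [h1 h2]; split.
  by case: h1 => a b c; split=> // x y hx hy; rewrite c // hg.
move=> x hx; have [l [h [e1 e2 e3 e4 e5]]] := h2 x hx; exists l, h; split=> //.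
- exact: (first_ext hg hx e3).
- exact: (last_ext hg hx e4).
exact: hD e5.
Qed.

Lemma wp_put_dif s e1 e2 f D rt x v n (Q : state -> nat -> Prop) :
  is_DD s f D rt -> dom x -> eval s e1 = (rt x)%:Z -> eval s e2 = v ->
  (eval_cost e1 + eval_cost e2 < 60)%N ->
  (forall s', eqv [::] [:: dif] s s' ->
     is_DD s' f (fun z l h c => if f z == f x then c = v else D z l h c) rt -> Q s' n) ->
  wp (Put dif e1 e2) s n.+1 Q.
Proof.
move=> [h1 h2] hx ee1 ee2 ec hq; apply: (@wp_put R P T K dif _ _ _ _ _ _ _ isT isT ec ee1 ee2) => // s1 E1 c1.
apply: hq => //; split; first exact: (eqv_ds E1).
move=> z hz; have [l [h [k1 k2 k3 k4 k5]]] := h2 z hz; exists l, h.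
split=> //; try by rewrite (eqv_cell E1).
by rewrite c1 (ds_class h1) //; case: (f z == f x).
Qed.

Hypothesis hK : (T <= tower K 1)%N.

Lemma wp_differ d e1 e2 w x y f rt s n (Q : state -> nat -> Prop) :
  is_ds s d f rt -> dom x -> dom y ->
  eval s e1 = x%:Z -> (eval_cost e1 <= 5)%N -> (eval_cost e2 <= 5)%N ->
  (forall s', eqv [:: vcur; vnxt; vrx] [::] s s' -> eval s' e2 = y%:Z) ->
  (forall s', eqv [:: vcur; vnxt; vrx; vry; w] [::] s s' ->
     vars s' w = (f x != f y)%:Z -> Q s' n) ->
  wp (differ_ds d e1 e2 w) s n.+4 Q.
Proof.
move=> hd hx hy ex c1 c2 ey h.
apply: wp_seq; apply: (wp_find P hK hd hx ex c1) => // s1 E1 r1.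
have hd1 := eqv_ds E1 isT hd.
apply: wp_seq; apply: (wp_find P hK hd1 hy (ey _ E1) c2) => // s2 E2 r2.
have x2 : vars s2 vrx = (rt x)%:Z by rewrite (eqv_var E2).
have fin s3 z : eqv [:: w] [::] s2 s3 -> vars s3 w = z -> z = (f x != f y)%:Z -> Q s3 n.
  move=> E3 h3 hz; apply: h; last by rewrite h3 hz.
  apply: (eqv_weak (eqv_trans (eqv_trans E1 E2) E3)); last by [].
  by rewrite /= !inE !eqxx ?orbT.
have e : (vars s2 vrx == vars s2 vry) = (f x == f y) by rewrite x2 r2 -(ds_class hd).
apply: wp_if => //= [hh|hh]; apply: wp_assign => // s3 E3 r3; apply: (fin _ _ E3 r3) => /=.
  by rewrite -e hh.
by rewrite -e hh.
Qed.

Lemma wp_left_high v w l f rt s n (Q : state -> nat -> Prop) :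
  is_ds s DA f rt -> dom l -> vars s v = l%:Z ->
  v \notin [:: vcur; vnxt; vrx] ->
  (forall s', eqv [:: vcur; vnxt; vrx; vry; w] [::] s s' ->
     vars s' w = (high_left f l)%:Z -> Q s' n) ->
  wp (left_high v w) s n.+4.+1 Q.
Proof.
move=> hd hl hv hvn h; have el : (vars s v == 1) = (l == 1%N) by rewrite hv.
apply: wp_if => //=; rewrite el => hh.
  apply: (@wp_leq _ _ _ _ _ _ n.+1); first lia.
  apply: wp_assign => // s1 E1 r1; apply: h; last by rewrite r1 /high_left hh.
  by apply: (eqv_weak E1); rewrite //= !inE eqxx !orbT.
have hl' : dom l.-1 by move/eqP: hh; lia.
apply: (wp_differ hd hl' hl) => //=; first by rewrite hv; move/eqP: hh; lia.
  by move=> s' E; rewrite (eqv_var E).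
by move=> s1 E1 r1; apply: h => //; rewrite r1 /high_left (negbTE hh).
Qed.

Lemma wp_right_high v w h f rt s n (Q : state -> nat -> Prop) :
  is_ds s DB f rt -> dom h -> vars s v = h%:Z -> vars s vT = T%:Z ->
  v \notin [:: vcur; vnxt; vrx] ->
  (forall s', eqv [:: vcur; vnxt; vrx; vry; w] [::] s s' ->
     vars s' w = (high_right f h)%:Z -> Q s' n) ->
  wp (right_high v w) s n.+4.+1 Q.
Proof.
move=> hd hh hv hT hvn hq; have el : (vars s v == vars s vT) = (h == T).
  by rewrite hv hT.
apply: wp_if => //=; rewrite el => hhT.
  apply: (@wp_leq _ _ _ _ _ _ n.+1); first lia.
  apply: wp_assign => // s1 E1 r1; apply: hq; last by rewrite r1 /high_right hhT.
  by apply: (eqv_weak E1); rewrite //= !inE eqxx !orbT.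
have hh' : dom h.+1 by move/eqP: hhT; lia.
apply: (wp_differ hd hh hh') => //=.
  by move=> s' E; rewrite (eqv_var E) // hv; lia.
by move=> s1 E1 r1; apply: hq => //; rewrite r1 /high_right (negbTE hhT).
Qed.

(** [V] is the meaning of the datum that [a] stores at a root, and [w] tells whose datum survives:
    that of the left class for t_B, that of the right class for t_A. *)
Lemma wp_union_data d a w e1 e2 x y xw f g rt (V V' : nat -> int -> Prop) s n
    (Q : state -> nat -> Prop) :
  ~~ is_par a -> ~~ is_rank a -> is_ds s d f rt ->
  (forall z, dom z -> V z (cells s a (rt z)%:Z)) ->
  dom x -> dom y -> f x != f y -> merges f g x y ->
  w = vrx /\ xw = x \/ w = vry /\ xw = y ->
  eval s e1 = x%:Z -> (eval_cost e1 <= 5)%N -> (eval_cost e2 <= 5)%N ->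
  (forall s', eqv [:: vcur; vnxt; vrx] [::] s s' -> eval s' e2 = y%:Z) ->
  (forall z c, dom z -> f z = f x \/ f z = f y -> V xw c -> V' z c) ->
  (forall z c, dom z -> f z <> f x -> f z <> f y -> V z c -> V' z c) ->
  (forall s', eqv [:: vcur; vnxt; vrx; vry; vroot] [:: rank d; a] s s' ->
    (exists rt', is_ds s' d g rt' /\
       forall z, dom z -> V' z (cells s' a (rt' z)%:Z)) -> Q s' n) ->
  wp (Seq (union_ds d e1 e2) (Put a (Var vroot) (Get a (Var w)))) s n.+4 Q.
Proof.
move=> pa ra hd hV hx hy ne hm hw ex c1 c2 ey v1 v2 h.
apply: wp_seq; apply: (wp_union P hK hd hx hy ne ex c1 c2 ey) => s1 ro E1 rx ry rr hro hg.
apply: (@wp_put R P T K a _ _ ro (cells s a (rt xw)%:Z)) => //=.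
  have ca : cells s1 a = cells s a.
    by apply: (eqv_cell E1) => //; rewrite inE; case: (a) ra.
  by rewrite ca; case: hw => -[-> ->]; rewrite ?rx ?ry.
move=> s2 E2 c2'.
have ca : cells s1 a = cells s a.
  by apply: (eqv_cell E1) => //; rewrite inE; case: (a) ra.
apply: h.
  by apply: (eqv_weak (eqv_trans E1 E2)); rewrite //= !inE !eqxx ?orbT.
exists (merge_root rt (rt x) (rt y) ro); split.
  by apply: (eqv_ds E2); [rewrite inE; case: (a) ra|apply: hg].
have dxw : dom xw by case: hw => -[_ ->].
move=> z hz; rewrite c2' /merge_root !(ds_class hd hz) //.
case: (eqVneq (f z) (f x)) => [e|ne1] /=; first by rewrite eqxx; apply: v1; [|left|apply: hV].
case: (eqVneq (f z) (f y)) => [e|ne2]; first by rewrite eqxx; apply: v1; [|right|apply: hV].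
rewrite ifN ?ca; first by apply: v2; [|apply/eqP|apply/eqP|apply: hV].
apply/eqP => e; case/orP: hro; rewrite -e (ds_class hd) //; apply/negP => //.
Qed.

(** The entry of [dif] at the new root is the one of whichever root won the link, so it is only
    known to stem from some old class. In an update it is overwritten at once; during the
    initialisation all entries are -1. *)
Lemma wp_union_D e1 e2 x f g D rt s n (Q : state -> nat -> Prop) :
  is_DD s f D rt -> mono_on f -> dom x -> dom x.+1 -> f x < f x.+1 ->
  merges f g x x.+1 ->
  eval s e1 = x%:Z -> (eval_cost e1 <= 5)%N -> (eval_cost e2 <= 5)%N ->
  (forall s', eqv [:: vcur; vnxt; vrx] [::] s s' -> eval s' e2 = x.+1%:Z) ->
  (forall s' rt', eqv [:: vcur; vnxt; vrx; vry; vroot] [:: rank DD; lo; hi] s s' ->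
    vars s' vroot = (rt' x)%:Z ->
    is_DD s' g (fun z l h c => if g z == g x then exists u lu hu, D u lu hu c
                               else D z l h c) rt' -> Q s' n) ->
  wp (union_D e1 e2) s n.+4.+1 Q.
Proof.
move=> [hd hD] hf hx hy lt hm ex c1 c2 ey hq.
apply: wp_seq; apply: (wp_union P hK hd hx hy _ ex c1 c2 ey) => [|s1 ro E1 rx ry rr hro hg].
  by rewrite lt_eqF.
have [lx [hx' [x1 x2 x3 x4 x5]]] := hD x hx.
have [ly [hy' [y1 y2 y3 y4 y5]]] := hD x.+1 hy.
apply: wp_seq; apply: (@wp_put R P T K lo _ _ ro lx%:Z) => //=.
  by rewrite rx (eqv_cell E1).
move=> s2 E2 l2.
apply: (@wp_put R P T K hi _ _ ro hy'%:Z) => //=; first by rewrite (eqv_var E2).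
  by rewrite (eqv_var E2) // ry (eqv_cell E2) // (eqv_cell E1).
move=> s3 E3 h3; have E := eqv_trans E1 (eqv_trans E2 E3).
pose rt' := merge_root rt (rt x) (rt x.+1) ro.
have rx' : rt' x = ro by rewrite /rt' /merge_root eqxx.
apply: (hq s3 rt') => //.
  by rewrite (eqv_var E3) // (eqv_var E2) // rr rx'.
split; first by apply: (eqv_ds E3) => //; apply: (eqv_ds E2) => //; apply: hg.
have gm z : dom z -> (g z == g x) = (f z == f x) || (f z == f x.+1).
  by move=> hz; rewrite hm // eqxx andbT orbA orbb.
move=> z hz; rewrite gm // /rt' /merge_root !(ds_class hd) //.
have mg : (f z == f x) || (f z == f x.+1) -> f z = f x \/ f z = f x.+1.
  by case/orP => /eqP; [left|right].
case: ifP => hzz.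
  exists lx, hy'; split.
  - by rewrite (eqv_cell E3) // l2 eqxx.
  - by rewrite h3 eqxx.
  - exact: (first_merge hm hf hx hy lt hz (mg hzz) x3).
  - exact: (last_merge hm hf hx hy lt hz (mg hzz) y4).
  rewrite (eqv_cell E) //; case/orP: hro => /eqP ->.
    by exists x, lx, hx'.
  by exists x.+1, ly, hy'.
have [l [h [z1 z2 z3 z4 z5]]] := hD z hz.
have zro : (rt z == ro) = false.
  apply/eqP => e; case/orP: hro; rewrite -e (ds_class hd) // => e'; by rewrite e' ?orbT in hzz.
move/negbT: hzz; rewrite negb_or => /andP[/eqP n1 /eqP n2].
exists l, h; split.
- by rewrite (eqv_cell E3) // l2 zro (eqv_cell E1).
- by rewrite h3 zro (eqv_cell E2) // (eqv_cell E1).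
- exact: (first_other hm hz n1 n2 z3).
- exact: (last_other hm hz n1 n2 z4).
by rewrite (eqv_cell E).
Qed.
End Program.

(** * Selecting an interval *)

Section Update.
Variables (R : realDomainType) (P : nat -> R) (T K : nat).
Notation dom x := (1 <= x <= T)%N.
Notation wp := (wp P T K).
Notation eqv := (eqv T).
Notation is_ds := (is_ds T).
Notation is_DD := (is_DD T).
Implicit Types (s : state) (f g fa fb : nat -> int) (rt : nat -> nat).

Lemma wp_if_assign b v e1 e2 s n (Q : state -> nat -> Prop) :
  (holds_cost b < 60)%N -> (eval_cost e1 < 60)%N -> (eval_cost e2 < 60)%N ->
  (forall s', eqv [:: v] [::] s s' ->
     vars s' v = (if holds P s b then eval s e1 else eval s e2) -> Q s' n) ->
  wp (If b (Assign v e1) (Assign v e2)) s n.+2 Q.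
Proof.
move=> c1 c2 c3 hq; apply: wp_if => // hb; apply: wp_assign => // s1 E1 r1; apply: hq => //.
  by rewrite hb.
by rewrite (negbTE hb).
Qed.

(* In an update, delta is the new difference from the start, whereas fb and fa
   are lowered one after the other. *)
Definition minima (fa fb delta : nat -> int) (x l h : nat) (c : int) : Prop :=
  c = if high_left fa l && high_right T fb h then delta x else - 1.

Lemma lower_mono f x : mono_on T f -> f x < f x.+1 -> mono_on T (lower f x.+1).
Proof.
move=> hf lt u v hu huv; have := hf u v hu huv; rewrite /lower.
case: ltnP => h1; case: ltnP => h2 //; try lia.
by have := hf u x; have := hf x.+1 v; lia.
Qed.

(** As [fa] is constant across the border, the sums on its two sides differ exactly by the step 1 of
    [fb], and lowering the right side makes them equal. *)
Lemma merges_lower fa fb x : mono_on T fa -> mono_on T fb -> dom x -> dom x.+1 ->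
  fa x = fa x.+1 -> fb x.+1 = fb x + 1 ->
  merges T (fun u => fa u + fb u) (fun u => fa u + lower fb x.+1 u) x x.+1.
Proof.
move=> ha hb hx hy ea eb u v hu hv; rewrite /lower.
have le w : dom w -> (w <= x)%N -> fa w <= fa x /\ fb w <= fb x.
  by move=> hw wx; split; [apply: ha|apply: hb]; lia.
have ge w : dom w -> (x < w)%N -> fa x.+1 <= fa w /\ fb x.+1 <= fb w.
  by move=> hw wx; split; [apply: ha|apply: hb]; lia.
case: ltnP => h1; case: ltnP => h2.
- by have := ge u hu h1; have := ge v hv h2; lia.
- by have := ge u hu h1; have := le v hv h2; lia.
- by have := le u hu h1; have := ge v hv h2; lia.
- by have := le u hu h1; have := le v hv h2; lia.
Qed.

(** Here [fa] increases at the border as well, so the sums differ by at least 2 and stay distinct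
    after the decrease. *)
Lemma same_lower fa fb x : mono_on T fa -> mono_on T fb -> dom x -> dom x.+1 ->
  fa x <> fa x.+1 -> fb x.+1 = fb x + 1 -> forall u v, dom u -> dom v ->
  (fa u + lower fb x.+1 u == fa v + lower fb x.+1 v) = (fa u + fb u == fa v + fb v).
Proof.
move=> ha hb hx hy ea eb u v hu hv; rewrite /lower; have := ha x x.+1.
have le w : dom w -> (w <= x)%N -> fa w <= fa x /\ fb w <= fb x.
  by move=> hw wx; split; [apply: ha|apply: hb]; lia.
have ge w : dom w -> (x < w)%N -> fa x.+1 <= fa w /\ fb x.+1 <= fb w.
  by move=> hw wx; split; [apply: ha|apply: hb]; lia.
case: (ltnP x u) => h1; case: (ltnP x v) => h2.
- by have := ge u hu h1; have := ge v hv h2; lia.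
- by have := ge u hu h1; have := le v hv h2; lia.
- by have := le u hu h1; have := ge v hv h2; lia.
- by have := le u hu h1; have := le v hv h2; lia.
Qed.

Lemma mono_add fa fb : mono_on T fa -> mono_on T fb -> mono_on T (fun u => fa u + fb u).
Proof. by move=> ha hb u v hu huv; rewrite lerD ?ha ?hb. Qed.

(** Both functions move in the same direction, so a change of one is never compensated by the
    other. *)
Lemma mono_add_eq fa fb x z : mono_on T fa -> mono_on T fb -> dom x -> dom z ->
  fa z + fb z = fa x + fb x -> fa z = fa x /\ fb z = fb x.
Proof.
move=> ha hb hx hz; have := ha x z; have := ha z x; have := hb x z; have := hb z x.
by case: (leqP x z) => h; lia.
Qed.

Lemma high_right_lower fb x h : (0 < h)%N -> h <> x ->
  high_right T (lower fb x.+1) h = high_right T fb h.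
Proof.
move=> h0 hx; rewrite /high_right /lower; congr orb.
by case: ifP => h1; case: ifP => h2; lia.
Qed.

Lemma high_left_lower fa x l : l <> x.+1 ->
  high_left (lower fa x.+1) l = high_left fa l.
Proof.
move=> hx; rewrite /high_left /lower; case: eqP => //= l1.
by case: ifP => h1; case: ifP => h2; lia.
Qed.

Hypothesis hK : (T <= tower K 1)%N.

(** Here t_B is [x.+1]. [fa1] is what DA holds, lowered already while [fa] still describes DD; the
    test only looks at the border, where they agree. If [fa] increases there, the class ending in
    [x] ceases to be a local minimum. Otherwise two classes merge, and the right one was no local
    minimum because [fa] does not increase on entering it; so the left entry is kept, provided that
    [fb] increases at the right end. *)
Lemma wp_update_left s fa fa1 fb delta x rtA rtB rt n (Q : state -> nat -> Prop) :
  is_ds s DA fa1 rtA -> is_ds s DB (lower fb x.+1) rtB ->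
  is_DD s (fun u => fa u + fb u) (minima fa fb delta) rt ->
  mono_on T fa -> mono_on T fb -> dom x -> dom x.+1 -> fb x.+1 = fb x + 1 ->
  fa1 x = fa x -> fa1 x.+1 = fa x.+1 ->
  (forall z, dom z -> fa z = fa x -> lower fb x.+1 z = fb x -> fa x = fa x.+1 ->
     delta z = delta x) ->
  vars s vtB = x.+1%:Z -> vars s vT = T%:Z ->
  (forall s' rt',
     eqv [:: vcur; vnxt; vrx; vry; vroot; vf; vc; ve; vg; vv]
         [:: rank DD; lo; hi; dif] s s' ->
     is_DD s' (fun u => fa u + lower fb x.+1 u) (minima fa (lower fb x.+1) delta) rt' ->
     Q s' n) ->
  wp update_left s (21 + n) Q.
Proof.
move=> hA hB hD ha hb hx hy eb ea ea' hdel xB xT hq.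
have hb1 : mono_on T (lower fb x.+1) by apply: lower_mono => //; lia.
have hf := mono_add ha hb; have hg := mono_add ha hb1.
have lox : lower fb x.+1 x = fb x by rewrite /lower ltnn.
have loy : lower fb x.+1 x.+1 = fb x by rewrite /lower leqnn eb; lia.
have ltf : fa x + fb x < fa x.+1 + fb x.+1 by have := ha x x.+1; lia.
apply: wp_seq; apply: (wp_differ P hK hA hx hy) => //=; first by rewrite xB; lia.
  by move=> s' E; rewrite (eqv_var E).
move=> s1 E1 r1; have hD1 := is_DD_eqv E1 isT isT isT isT hD.
have v1 v : v \notin [:: vcur; vnxt; vrx; vry; vf] -> vars s1 v = vars s v.
  exact: (eqv_var E1).
have [lx [hx' [x1 x2 x3 x4 x5]]] := (proj2 hD1) x hx.
have ehx : hx' = x.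
  apply: last_uniq hf hx x4 _; split; [lia|by []|right].
  by rewrite lt_eqF.
have ec : (vars s1 vf == 0) = (fa x == fa x.+1) by rewrite r1 ea ea'; case: (fa x == fa x.+1).
apply: wp_if => //=; rewrite ec => /eqP eaxy; last first.
  apply: (@wp_leq _ _ _ _ _ _ n.+2); first lia.
  apply: wp_seq; apply: (wp_find P hK (proj1 hD1) hx) => //=; first by rewrite v1 // xB; lia.
  move=> s2 E2 r2; have hD2 := is_DD_eqv E2 isT isT isT isT hD1.
  apply: (wp_put_dif (v := - 1) P K hD2 hx) => // s3 E3 hD3; apply: (hq _ rt).
    by apply: (eqv_weak (eqv_trans E1 (eqv_trans E2 E3))).
  apply: is_DD_ext hD3; first exact: (same_lower ha hb hx hy eaxy eb).
  move=> z l h c hz hl hh; rewrite /minima; case: eqP => ez.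
    have -> : h = x.
      apply: (last_uniq hf hz hh _); apply: (last_class hf hx hz ez _).
      by rewrite -{2}ehx.
    move=> ->; rewrite /high_right lox loy eqxx orbF.
    have -> : (x == T) = false by lia.
    by rewrite andbF.
  move=> ->; rewrite high_right_lower //; first by case: hh => hh _ _; lia.
  by move=> e; case: hh => _; rewrite e => h' _; rewrite h' in ez.
have [ly [hy' [y1 y2 y3 y4 y5]]] := (proj2 hD1) x.+1 hy.
have dhy : dom hy' by case: y4; lia.
apply: wp_seq; apply: (wp_find P hK (proj1 hD1) hy) => //=; first by rewrite v1.
move=> s2 E2 r2; have hD2 := is_DD_eqv E2 isT isT isT isT hD1.
apply: wp_seq; apply: wp_assign => // s3 E3; rewrite /= r2 (eqv_cell E2) // y2 => r3.
have hB3 := eqv_ds E3 isT (eqv_ds E2 isT (eqv_ds E1 isT hB)).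
apply: wp_seq; apply: (wp_right_high P hK hB3 dhy r3) => //.
  by rewrite (eqv_var E3) // (eqv_var E2) // v1.
move=> s4 E4 r4; have E14 := eqv_trans E2 (eqv_trans E3 E4).
have hD4 := is_DD_eqv E14 isT isT isT isT hD1.
apply: wp_seq; apply: (wp_find P hK (proj1 hD4) hx) => //=.
  by rewrite (eqv_var E14) // v1 // xB; lia.
move=> s5 E5 r5.
apply: wp_seq; apply: wp_if_assign => // s6 E6 /=.
rewrite r5 (eqv_cell E5) // (eqv_cell E14) // (eqv_var E5) // r4 => r6.
have E := eqv_trans E14 (eqv_trans E5 E6).
have hD6 := is_DD_eqv E isT isT isT isT hD1.
have B6 : vars s6 vtB = x.+1%:Z by rewrite (eqv_var E) // v1.
have := merges_lower ha hb hx hy eaxy eb => hm.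
apply: wp_seq; apply: (wp_union_D P hK hD6 hf hx hy ltf hm) => //=.
- by rewrite B6; lia.
- by move=> s' E'; rewrite (eqv_var E').
move=> s7 rt' E7 r7 hD7; apply: (@wp_leq _ _ _ _ _ _ n.+1); first lia.
apply: (wp_put_dif P K hD7 hx) => //= s8 E8 hD8; apply: (hq _ rt').
  by apply: (eqv_weak (eqv_trans E1 (eqv_trans E (eqv_trans E7 E8)))).
apply: is_DD_ext hD8 => // z l h c hz hl hh; rewrite /minima; case: eqP => ez.
  have [ez1 ez2] := mono_add_eq ha hb1 hx hz ez.
  have mz : fa z + fb z = fa x + fb x \/ fa z + fb z = fa x.+1 + fb x.+1.
    have := hm x z hx hz; rewrite ez eqxx => /esym/orP[/eqP ->|/andP[_ /orP[]/eqP ->]]; auto.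
  have -> : l = lx.
    by apply: (first_uniq hg hz hl _); apply: (first_merge hm hf hx hy ltf).
  have -> : h = hy'.
    by apply: (last_uniq hg hz hh _); apply: (last_merge hm hf hx hy ltf).
  have -> : delta z = delta x by apply: hdel => //; rewrite ez2.
  move=> ->; rewrite (eqv_var E7) // r6 x5 /minima ehx.
  have -> : high_right T fb x by rewrite /high_right eb; lia.
  by rewrite andbT; case: high_right; case: high_left.
move=> ->; rewrite high_right_lower //; first by case: hh => hh _ _; lia.
by move=> e; case: hh => _; rewrite e => h' _; rewrite h' in ez.
Qed.

(** The mirror image at the border between t_A = [x] and [x.+1]. On a merge the left class was no
    local minimum, because [fb] does not increase on leaving it, so the right entry is kept. *)
Lemma wp_update_right s fa fb delta x rtA rtB rt n (Q : state -> nat -> Prop) :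
  is_ds s DA (lower fa x.+1) rtA -> is_ds s DB fb rtB ->
  is_DD s (fun u => fa u + fb u) (minima fa fb delta) rt ->
  mono_on T fa -> mono_on T fb -> dom x -> dom x.+1 -> fa x.+1 = fa x + 1 ->
  (forall z, dom z -> lower fa x.+1 z = fa x -> fb z = fb x -> fb x = fb x.+1 ->
     delta z = delta x.+1) ->
  vars s vtA = x%:Z -> vars s vT = T%:Z ->
  (forall s' rt',
     eqv [:: vcur; vnxt; vrx; vry; vroot; vf; vc; ve; vg; vv]
         [:: rank DD; lo; hi; dif] s s' ->
     is_DD s' (fun u => lower fa x.+1 u + fb u) (minima (lower fa x.+1) fb delta) rt' ->
     Q s' n) ->
  wp update_right s (21 + n) Q.
Proof.
move=> hA hB hD ha hb hx hy ea hdel xA xT hq.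
have ha1 : mono_on T (lower fa x.+1) by apply: lower_mono => //; lia.
have hf := mono_add ha hb; have hg := mono_add ha1 hb.
have lox : lower fa x.+1 x = fa x by rewrite /lower ltnn.
have loy : lower fa x.+1 x.+1 = fa x by rewrite /lower leqnn ea; lia.
have ltf : fa x + fb x < fa x.+1 + fb x.+1 by have := hb x x.+1; lia.
apply: wp_seq; apply: (wp_differ P hK hB hx hy) => //=.
  by move=> s' E; rewrite (eqv_var E) // xA; lia.
move=> s1 E1 r1; have hD1 := is_DD_eqv E1 isT isT isT isT hD.
have v1 v : v \notin [:: vcur; vnxt; vrx; vry; vf] -> vars s1 v = vars s v.
  exact: (eqv_var E1).
have [ly [hy' [y1 y2 y3 y4 y5]]] := (proj2 hD1) x.+1 hy.
have ely : ly = x.+1.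
  apply: (first_uniq hf hy y3 _); split; [lia|by []|right].
  by rewrite lt_eqF.
have ec : (vars s1 vf == 0) = (fb x == fb x.+1) by rewrite r1; case: (fb x == fb x.+1).
apply: wp_if => //=; rewrite ec => /eqP ebxy; last first.
  apply: (@wp_leq _ _ _ _ _ _ n.+2); first lia.
  apply: wp_seq; apply: (wp_find P hK (proj1 hD1) hy) => //=; first by rewrite v1 // xA; lia.
  move=> s2 E2 r2; have hD2 := is_DD_eqv E2 isT isT isT isT hD1.
  apply: (wp_put_dif (v := - 1) P K hD2 hy) => // s3 E3 hD3; apply: (hq _ rt).
    by apply: (eqv_weak (eqv_trans E1 (eqv_trans E2 E3))).
  apply: is_DD_ext hD3.
    by move=> u v hu hv; rewrite ![lower _ _ _ + _]addrC ![fa _ + _]addrC; apply: same_lower.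
  move=> z l h c hz hl hh; rewrite /minima; case: eqP => ez.
    have -> : l = x.+1.
      apply: (first_uniq hf hz hl _); apply: (first_class hf hy hz ez _).
      by rewrite -{2}ely.
    move=> ->; rewrite /high_left /= lox loy eqxx.
    have -> : (x.+1 == 1%N) = false by lia.
    by [].
  move=> ->; rewrite high_left_lower //.
  by move=> e; case: hl => _; rewrite e => h' _; rewrite h' in ez.
have [lx [hx' [x1 x2 x3 x4 x5]]] := (proj2 hD1) x hx.
have dlx : dom lx by case: x3; lia.
apply: wp_seq; apply: (wp_find P hK (proj1 hD1) hx) => //=; first by rewrite v1.
move=> s2 E2 r2; have hD2 := is_DD_eqv E2 isT isT isT isT hD1.
apply: wp_seq; apply: wp_assign => // s3 E3; rewrite /= r2 (eqv_cell E2) // x1 => r3.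
have hA3 := eqv_ds E3 isT (eqv_ds E2 isT (eqv_ds E1 isT hA)).
apply: wp_seq; apply: (wp_left_high P hK hA3 dlx r3) => //.
move=> s4 E4 r4; have E14 := eqv_trans E2 (eqv_trans E3 E4).
have hD4 := is_DD_eqv E14 isT isT isT isT hD1.
apply: wp_seq; apply: (wp_find P hK (proj1 hD4) hy) => //=.
  by rewrite (eqv_var E14) // v1 // xA; lia.
move=> s5 E5 r5.
apply: wp_seq; apply: wp_if_assign => // s6 E6 /=.
rewrite r5 (eqv_cell E5) // (eqv_cell E14) // (eqv_var E5) // r4 => r6.
have E := eqv_trans E14 (eqv_trans E5 E6).
have hD6 := is_DD_eqv E isT isT isT isT hD1.
have A6 : vars s6 vtA = x%:Z by rewrite (eqv_var E) // v1.
have hm : merges T (fun u => fa u + fb u) (fun u => lower fa x.+1 u + fb u) x x.+1.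
  move=> u v hu hv; rewrite ![lower _ _ _ + _]addrC ![fa _ + _]addrC.
  exact: (merges_lower hb ha).
apply: wp_seq; apply: (wp_union_D P hK hD6 hf hx hy ltf hm) => //=.
  by move=> s' E'; rewrite (eqv_var E') // A6; lia.
move=> s7 rt' E7 r7 hD7; apply: (@wp_leq _ _ _ _ _ _ n.+1); first lia.
apply: (wp_put_dif P K hD7 hx) => //= s8 E8 hD8; apply: (hq _ rt').
  by apply: (eqv_weak (eqv_trans E1 (eqv_trans E (eqv_trans E7 E8)))).
apply: is_DD_ext hD8 => // z l h c hz hl hh; rewrite /minima; case: eqP => ez.
  have [ez1 ez2] := mono_add_eq ha1 hb hx hz ez.
  have mz : fa z + fb z = fa x + fb x \/ fa z + fb z = fa x.+1 + fb x.+1.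
    have := hm x z hx hz; rewrite ez eqxx => /esym/orP[/eqP ->|/andP[_ /orP[]/eqP ->]]; auto.
  have -> : l = lx.
    by apply: (first_uniq hg hz hl _); apply: (first_merge hm hf hx hy ltf).
  have -> : h = hy'.
    by apply: (last_uniq hg hz hh _); apply: (last_merge hm hf hx hy ltf).
  have -> : delta z = delta x.+1 by apply: hdel => //; rewrite ez1.
  move=> ->; rewrite (eqv_var E7) // r6 y5 /minima ely.
  have -> : high_left fa x.+1 by rewrite /high_left /= ea; lia.
  by case: high_right; case: high_left.
move=> ->; rewrite high_left_lower //.
by move=> e; case: hl => _; rewrite e loy -ebxy => h' _; apply: ez; rewrite -h' lox.
Qed.
End Update.

(** * Effect of lowering a bound on t_A and on the classes *)

Section LowerBounds.
Variable T : nat.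
Notation dom x := (1 <= x <= T)%N.
Implicit Types (A B f : nat -> int).

Definition shift A : nat -> int := fun u => A u.-1.

Lemma bound_seq_mono_on B : bound_seq T B -> mono_on T B.
Proof. by move=> hB u v _ huv; apply: (bound_seq_mono hB). Qed.

Lemma shift_mono_on A : bound_seq T A -> mono_on T (shift A).
Proof. by move=> hA u v hu huv; apply: (bound_seq_mono hA); lia. Qed.

(** An index shift: lowering [A] from t_A on changes A_{t-1} only from t_A + 1 on, which is the
    border that disappears in DA. *)
Lemma shift_lower A v u : (0 < u)%N -> shift (lower A v) u = lower (shift A) v.+1 u.
Proof. by rewrite /shift /lower => hu; have -> : (v <= u.-1)%N = (v < u)%N by lia. Qed.

Lemma lower_merges f x a b : mono_on T f -> dom x -> dom x.+1 -> f x.+1 = f x + 1 ->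
  f a = f x -> f b = f x.+1 -> merges T f (lower f x.+1) a b.
Proof.
move=> hf hx hy e ea eb u v hu hv; rewrite /lower ea eb e.
have le w : dom w -> (w <= x)%N -> f w <= f x by move=> hw wx; apply: hf; lia.
have ge w : dom w -> (x < w)%N -> f x.+1 <= f w by move=> hw wx; apply: hf; lia.
case: ltnP => h1; case: ltnP => h2.
- by have := ge u hu h1; have := ge v hv h2; lia.
- by have := ge u hu h1; have := le v hv h2; lia.
- by have := le u hu h1; have := ge v hv h2; lia.
- by have := le u hu h1; have := le v hv h2; lia.
Qed.

Lemma idx_A_lower A t v z c : bound_seq T A -> dom t -> dom z -> (v <= T)%N ->
  is_idx_A T A t v -> A z.-1 <> A t.-1 -> A z.-1 <> A v ->
  is_idx_A T A z c -> is_idx_A T (lower A v) z c.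
Proof.
move=> hA ht hz hv [v1 v2 v3] n1 n2 [c1 c2 c3].
have m u w := @bound_seq_mono T A u w hA.
rewrite /is_idx_A /lower; split=> //.
- by have := m v z.-1; have := m c.-1 v; have := m v c.-1; have := m z.-1 v; case: ifP; case: ifP; lia.
move=> hc; have h := c3 hc; have := m v c; have := m c v; have := v3 hv.
have [e|ne] := eqVneq c v; first by rewrite e in c2; lia.
by case: ifP; case: ifP; lia.
Qed.

(** The class of [t] is joined with the next one, which begins at [v.+1]; the later class determines
    the new t_A. *)
Lemma idx_A_lower_merge A t v z c : bound_seq T A -> dom t -> dom z -> (v < T)%N ->
  is_idx_A T A t v -> A z.-1 = A t.-1 \/ A z.-1 = A v ->
  is_idx_A T A v.+1 c -> is_idx_A T (lower A v) z c.
Proof.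
move=> hA ht hz hv [v1 v2 v3] e [c1 c2 c3]; rewrite /= in c2.
have m u w := @bound_seq_mono T A u w hA.
have [_ hA'] := hA; have hv1 := v3 (ltnW hv); have := hA' v.
rewrite /is_idx_A /lower => ev; split.
- by case: e => e; have := m c z.-1; have := m c.-1 c; have := m v z.-1; lia.
- have -> : (v <= c.-1)%N by lia.
  by rewrite c2; case: e => e; case: leqP => h; have := m v z.-1; have := m z.-1 v.-1; lia.
move=> hc; have := c3 hc; have -> : (v <= c)%N by lia.
have -> : (v <= c.-1)%N by lia.
lia.
Qed.

(** If t_A = T, lowering [A T] makes the bound constant from [t.-1] to [T], so t_A becomes T + 1. *)
Lemma idx_A_lower_last A t z : bound_seq T A -> dom t -> dom z ->
  is_idx_A T A t T -> A z.-1 = A t.-1 -> is_idx_A T (lower A T) z T.+1.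
Proof.
move=> hA ht hz [v1 v2 v3] e; rewrite /is_idx_A /lower /= leqnn; split; [lia| |lia].
have [_ hA'] := hA; have := hA' T; have := v3 (leqnn T).
have -> : (T <= z.-1)%N = false by lia.
by rewrite leqnn; lia.
Qed.

Lemma idx_A_eq A A' z c : (forall u, (u <= T)%N -> A' u = A u) -> dom z ->
  is_idx_A T A z c -> is_idx_A T A' z c.
Proof.
move=> e hz [c1 c2 c3]; split=> //; first by rewrite !e; lia.
by move=> hc; rewrite !e ?c3 //; lia.
Qed.

Lemma first_step B t l : bound_seq T B -> dom t -> is_first B t l -> (1 < l)%N ->
  B l = B l.-1 + 1.
Proof.
move=> [_ hB] ht [l1 l2 l3] l4; have := hB l; case: l3 => [|/eqP]; lia.
Qed.

Lemma idx_A_step A t v : bound_seq T A -> is_idx_A T A t v -> dom t -> (v <= T)%N ->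
  A v = A v.-1 + 1.
Proof. by move=> [_ hA] [v1 v2 v3] ht hv; have := hA v; have := v3 hv; lia. Qed.

End LowerBounds.

(** * Lowering the bounds in the three structures *)

Section Step.
Variables (R : realDomainType) (P : nat -> R) (T K : nat).
Notation dom x := (1 <= x <= T)%N.
Notation wp := (wp P T K).
Notation eqv := (eqv T).
Notation is_ds := (is_ds T).
Notation is_DD := (is_DD T).
Notation minima := (minima T).
Implicit Types (s : state) (f g A B : nat -> int) (rt : nat -> nat).

Definition is_DA s A : Prop := exists rt, is_ds s DA (shift A) rt /\
  forall z, dom z -> exists v : nat, cells s valA (rt z)%:Z = v%:Z /\ is_idx_A T A z v.

Definition is_DB s B : Prop := exists rt, is_ds s DB B rt /\
  forall z, dom z -> exists l : nat, cells s valB (rt z)%:Z = l%:Z /\ is_first B z l.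

Lemma is_DA_eqv vs cs s s' A : eqv vs cs s s' -> rank DA \notin cs ->
  valA \notin cs -> is_DA s A -> is_DA s' A.
Proof.
move=> E c1 c2 [rt [h1 h2]]; exists rt; split; first exact: (eqv_ds E).
by move=> z /h2; rewrite (eqv_cell E).
Qed.

Lemma is_DB_eqv vs cs s s' B : eqv vs cs s s' -> rank DB \notin cs ->
  valB \notin cs -> is_DB s B -> is_DB s' B.
Proof.
move=> E c1 c2 [rt [h1 h2]]; exists rt; split; first exact: (eqv_ds E).
by move=> z /h2; rewrite (eqv_cell E).
Qed.

Lemma is_ds_eq s d f g rt : (forall x, dom x -> g x = f x) ->
  is_ds s d f rt -> is_ds s d g rt.
Proof. by move=> e [a b c]; split=> // x y hx hy; rewrite !e // c. Qed.

Lemma is_DA_eq s A A' : (forall u, (u <= T)%N -> A' u = A u) ->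
  is_DA s A -> is_DA s A'.
Proof.
move=> e [rt [h1 h2]]; exists rt; split.
  by apply: is_ds_eq h1 => x hx; rewrite /shift e //; lia.
by move=> z hz; have [v [v1 v2]] := h2 z hz; exists v; split=> //; apply: idx_A_eq v2.
Qed.

Hypothesis hK : (T <= tower K 1)%N.

Lemma wp_step_B s B t l n (Q : state -> nat -> Prop) :
  bound_seq T B -> is_DB s B -> dom t -> is_first B t l ->
  vars s vtB = l%:Z -> vars s vt = t%:Z ->
  (forall s', eqv [:: vcur; vnxt; vrx; vry; vroot] [:: rank DB; valB] s s' ->
     is_DB s' (lower B l) -> Q s' n) ->
  wp (If (LtT (Lit 1) (Var vtB)) (union_B (Minus (Var vtB) (Lit 1)) (Var vt)) Skip)
    s (5 + n) Q.
Proof.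
move=> hB [rt [h1 h2]] ht hl sl st hq; have hBm := bound_seq_mono_on hB.
have [l1 l2 l3] := hl; apply: wp_if => //=; rewrite sl => hh; last first.
  (* With t_B = 1 the whole of [B] on 1..T drops by 1, and its level sets stay the same. *)
  have el : l = 1%N by lia.
  apply: (@wp_leq _ _ _ _ _ _ n.+1); first lia.
  apply: wp_skip; apply: hq; first by apply: (eqv_weak (eqv_refl _ _)).
  have e x : dom x -> lower B l x = B x - 1 by move=> hx; rewrite /lower el; case: ifP; lia.
  exists rt; split.
    by case: h1 => a b c; split=> // x y hx hy; rewrite c // !e //; lia.
  move=> z hz; have [w [w1 [w2 w3 w4]]] := h2 z hz; exists w; split=> //.
  split=> //; first by rewrite !e; lia.
  have [->|w5] := eqVneq w 1%N; [by left|right].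
  by rewrite !e; [case: w4|lia|lia]; lia.
have hx : dom l.-1 by lia.
have el : l = l.-1.+1 by lia.
have eB : B l.-1.+1 = B l.-1 + 1 by rewrite -el; apply: (first_step hB ht).
have hm : merges T B (lower B l) l.-1 t.
  by rewrite {1}el; apply: lower_merges => //; rewrite -?el //; lia.
pose V (f : nat -> int) z c := exists w : nat, c = w%:Z /\ is_first f z w.
have lt : B l.-1 < B t by rewrite -l2 {2}el eB; lia.
apply: (@wp_union_data R P T K hK DB valB vrx _ _ l.-1 t l.-1 B (lower B l) rt (V B) (V (lower B l))) => //=.
- by rewrite lt_eqF.
- by left.
- by rewrite sl; lia.
- by move=> s' E; rewrite (eqv_var E).
- move=> z c hz e [w [-> hw]]; exists w; split=> //.
  by apply: (first_merge hm).
- move=> z c hz e1 e2 [w [-> hw]]; exists w; split=> //.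
  by apply: (first_other hm).
Qed.

Lemma wp_step_A s A t v n (Q : state -> nat -> Prop) :
  bound_seq T A -> is_DA s A -> dom t -> is_idx_A T A t v ->
  vars s vtA = v%:Z -> vars s vt = t%:Z -> vars s vT = T%:Z ->
  (forall s', eqv [:: vcur; vnxt; vrx; vry; vroot; va] [:: rank DA; valA] s s' ->
     is_DA s' (lower A v) -> Q s' n) ->
  wp (If (LtT (Var vtA) (Var vT)) (union_A (Var vt) (Plus (Var vtA) (Lit 1)))
    (If (EqT (Var vtA) (Var vT))
        (Seq (find_ds DA (Var vt) va) (Put valA (Var va) (Plus (Var vT) (Lit 1)))) Skip))
    s (5 + n) Q.
Proof.
move=> hA hDA ht hv sv st sT hq; have hAm := shift_mono_on hA.
have [rt [h1 h2]] := hDA; have [v1 v2 v3] := hv.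
apply: wp_if => //=; rewrite sv sT => hh.
  have hx : dom v by lia.
  have hy : dom v.+1 by lia.
  have eA : shift A v.+1 = shift A v + 1 by apply: (idx_A_step hA hv ht); lia.
  have hm : merges T (shift A) (lower (shift A) v.+1) t v.+1.
    by apply: lower_merges => //; rewrite /shift.
  pose V (f : nat -> int) z c := exists w : nat, c = w%:Z /\ is_idx_A T f z w.
  apply: (@wp_union_data R P T K hK DA valA vry _ _ t v.+1 v.+1 (shift A)
    (lower (shift A) v.+1) rt (V A) (V (lower A v))) => //=.
  - by rewrite eA /shift v2; lia.
  - by right.
  - by move=> s' E; rewrite (eqv_var E) // sv; lia.
  - move=> z c hz e [w [-> hw]]; exists w; split=> //.
    by apply: idx_A_lower_merge hv e hw => //; lia.
  - move=> z c hz e1 e2 [w [-> hw]]; exists w; split=> //.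
    by apply: idx_A_lower hv e1 e2 hw => //; lia.
  move=> s' E [rt' [k1 k2]]; apply: hq; first by apply: (eqv_weak E).
  exists rt'; split=> //.
  by apply: is_ds_eq k1 => u hu; apply: shift_lower; lia.
apply: wp_if => //=; rewrite sv sT => hh2; last first.
  (* Here t_A = T + 1, and nothing is lowered at the indices 0..T. *)
  apply: (@wp_leq _ _ _ _ _ _ n.+1); first lia.
  apply: wp_skip; apply: hq; first by apply: (eqv_weak (eqv_refl _ _)).
  apply: is_DA_eq hDA => u hu; rewrite /lower ifN //.
  by move/eqP: hh2; lia.
(* The class of [t] contains [T], so there is no class to join it with; only its value t_A
   changes. *)
have evT : v = T by move/eqP: hh2; lia.
apply: (@wp_leq _ _ _ _ _ _ n.+2); first lia.
apply: wp_seq; apply: (wp_find P hK h1 ht) => // s1 E1 r1.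
apply: (@wp_put R P T K valA _ _ (rt t) T.+1%:Z) => //=.
  by rewrite (eqv_var E1) // sT; lia.
move=> s2 E2 c2; apply: hq.
  by apply: (eqv_weak (eqv_trans E1 E2)).
exists rt; split.
  apply: (eqv_ds E2) => //; apply: (eqv_ds E1) => //; apply: is_ds_eq h1 => u hu.
  by rewrite shift_lower ?/lower ?ifN //; lia.
move=> z hz; rewrite c2 (ds_class h1) // (eqv_cell E1) //.
rewrite evT in hv v1 v2 v3 *; case: eqP => e.
  by exists T.+1; split=> //; apply: idx_A_lower_last hv e.
have [w [w1 w2]] := h2 z hz; exists w; split=> //.
have [_ hA'] := hA.
apply: idx_A_lower hv e _ w2 => // e'.
have := bound_seq_mono (u := z.-1) (v := T.-1) hA; have := v3 (leqnn T).
by have := hA' T; rewrite -e'; lia.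
Qed.

(** A class that is not a local minimum carries the mark -1 whatever its difference, so [delta'] has
    to be the decreased [delta] at local minima only. Differences are nonnegative, hence an entry -1
    is always the mark. *)
Lemma wp_decrease s f fa fb t delta delta' rt n (Q : state -> nat -> Prop) :
  mono_on T f -> is_DD s f (minima fa fb delta) rt -> dom t -> vars s vc = (rt t)%:Z ->
  (forall z, dom z -> 0 <= delta z) ->
  (forall z l h, dom z -> is_first f z l -> is_last T f z h ->
     high_left fa l -> high_right T fb h ->
     delta' z = delta z - (f z == f t)%:Z) ->
  (forall z, dom z -> f z = f t -> delta z = delta t) ->
  (forall s' , eqv [::] [:: dif] s s' -> is_DD s' f (minima fa fb delta') rt -> Q s' n) ->
  wp (If (Not (EqT (Get dif (Var vc)) (Lit (- 1))))
       (Put dif (Var vc) (Minus (Get dif (Var vc)) (Lit 1))) Skip) s (2 + n) Q.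
Proof.
move=> hf hD ht sc d0 hd hc hq; have [l [h [t1 t2 t3 t4 t5]]] := (proj2 hD) t ht.
have dt := d0 t ht.
have lh z l' h' : dom z -> f z = f t -> is_first f z l' -> is_last T f z h' ->
    l' = l /\ h' = h.
  move=> hz e hl hh; split.
    exact: (first_uniq hf ht (first_class hf hz ht (esym e) hl) t3).
  exact: (last_uniq hf ht (last_class hf hz ht (esym e) hh) t4).
have ec : (cells s dif (rt t) == - 1) = ~~ (high_left fa l && high_right T fb h).
  by rewrite t5 /minima; case: (_ && _); rewrite ?eqxx //; lia.
apply: wp_if => //=; rewrite sc ec negbK => hh.
  apply: (wp_put_dif (v := delta t - 1) P K hD ht) => //=; first by rewrite sc t5 /minima hh.
  move=> s1 E1 hD1; apply: hq => //; apply: is_DD_ext hD1 => // z l' h' c hz hl' hh'.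
  case: eqP => e ->; rewrite /minima.
    have [e1 e2] := lh z l' h' hz e hl' hh'; rewrite e1 e2 hh.
    have /andP[k1 k2] := hh; rewrite (hd z l' h' hz hl' hh') ?e1 ?e2 //.
    by rewrite e eqxx hc.
  by case: ifP => // /andP[k1 k2]; rewrite (hd z l' h') //; move/eqP/negbTE: e => ->; rewrite subr0.
apply: (@wp_leq _ _ _ _ _ _ n.+1); first lia.
apply: wp_skip; apply: hq; first by apply: (eqv_weak (eqv_refl _ _)).
apply: is_DD_ext hD => // z l' h' c hz hl' hh' ->; rewrite /minima.
case: ifP => // /andP[k1 k2]; rewrite (hd z l' h') //.
case: eqP => e; last by rewrite subr0.
by have [e1 e2] := lh z l' h' hz e hl' hh'; rewrite -e1 -e2 k1 k2 in hh.
Qed.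
End Step.

(** * One complete update *)

Section MainLoop.
Variables (R : realDomainType) (P : nat -> R) (T K : nat).
Notation dom x := (1 <= x <= T)%N.
Notation wp := (wp P T K).
Notation eqv := (eqv T).
Notation is_ds := (is_ds T).
Notation is_DD := (is_DD T).
Notation is_DA := (is_DA T).
Notation is_DB := (is_DB T).
Notation minima := (minima T).
Implicit Types (s : state) (f g A B : nat -> int) (rt : nat -> nat).

Lemma is_DD_minima_eq s fa fa' fb fb' delta rt :
  (forall u, dom u -> fa' u = fa u) -> (forall u, dom u -> fb' u = fb u) ->
  is_DD s (fun u => fa u + fb u) (minima fa fb delta) rt ->
  is_DD s (fun u => fa' u + fb' u) (minima fa' fb' delta) rt.
Proof.
move=> ea eb; apply: is_DD_ext => [u v hu hv|x l h c hx hl hh].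
  by rewrite !ea // !eb.
have dl : dom l by case: hl; lia.
have dh : dom h by case: hh; lia.
rewrite /minima /high_left /high_right => ->; congr (if _ && _ then _ else _).
  by case: (l =P 1%N) => //= l1; rewrite !ea //; lia.
by case: (h =P T) => //= h1; rewrite !eb //; lia.
Qed.

(* Of the classes between t_B and t_A only the one of t can be a local minimum. *)
Lemma decrease_minima A B t v l z lz hz :
  bounds T A B -> dom t -> is_idx_A T A t v -> is_first B t l -> dom z ->
  is_first (fun u => shift A u + B u) z lz ->
  is_last T (fun u => shift A u + B u) z hz ->
  high_left (shift A) lz -> high_right T B hz ->
  lower B l z - shift (lower A v) z =
  B z - shift A z - (shift A z + B z == shift A t + B t)%:Z.
Proof.
move=> [hA hB hAB] ht [v1 v2 v3] [l1 l2 l3] hz0 [z1 z2 z3] [z4 z5 z6] hl hr.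
have mA u w := @bound_seq_mono T A u w hA; have mB u w := @bound_seq_mono T B u w hB.
have := mono_add_eq (shift_mono_on hA) (bound_seq_mono_on hB) ht hz0.
rewrite /shift /lower; case: eqP => e.
  move=> /(_ e) [e1 e2]; have -> : (l <= z)%N.
    by have := mB z l.-1; have := mB l.-1 l; case: l3 => [|/eqP]; lia.
  have -> : (v <= z.-1)%N = false.
    by have := mA v z.-1; have := mA v.-1 v; lia.
  by lia.
move=> _; have [h1|h1] := leqP l z; have [h2|h2] := leqP v z.-1; try lia.
(* Now [z] lies between t_B and t_A, outside the class of [t]. If [z <= t], its class ends before
   [t], where [B] is constant, so [B] does not increase on leaving it. If [z > t], its class begins
   after [t], and [A] does not increase on entering it. *)
exfalso; have [h3|h3] := leqP z t.
  have h4 : (hz < t)%N.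
    rewrite ltnNge; apply/negP => h4; have := mA z.-1 t.-1; have := mB z t.
    by have := mA t.-1 hz.-1; have := mB t hz; move: z5; rewrite /shift; lia.
  have := mB l hz; have := mB hz hz.+1; have := mB hz.+1 t.
  by move: hr; rewrite /high_right; case: eqP => /=; lia.
have h4 : (t < lz)%N.
  rewrite ltnNge; apply/negP => h4; have := mA t.-1 z.-1; have := mB t z.
  by have := mA lz.-1 t.-1; have := mB lz t; move: z2; rewrite /shift; lia.
have a1 : A t.-1 <= A lz.-2 by apply: mA; lia.
have a2 : A lz.-2 <= A lz.-1 by apply: mA; lia.
have a3 : A lz.-1 <= A v.-1 by apply: mA; lia.
move: hl; rewrite /high_left /shift; case: eqP => [|_] /=; first lia.
by move/eqP => []; apply/eqP; rewrite eq_le; lia.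
Qed.

Record loop_inv s A B (X : nat -> bool) : Prop := LoopInv {
  inv_DA : is_DA s A;
  inv_DB : is_DB s B;
  inv_DD : exists rt, is_DD s (fun u => shift A u + B u)
             (minima (shift A) B (fun u => B u - shift A u)) rt;
  inv_X : forall u, dom u -> cells s outX u%:Z = (X u)%:Z }.

Hypothesis hK : (T <= tower K 1)%N.

Lemma wp_step_left s A B t v l delta rt n (Q : state -> nat -> Prop) :
  bounds T A B -> dom t -> is_idx_A T A t v -> is_first B t l ->
  is_DA s (lower A v) -> is_DB s (lower B l) ->
  is_DD s (fun u => shift A u + B u) (minima (shift A) B delta) rt ->
  (forall u, dom u -> delta u = lower B l u - shift (lower A v) u) ->
  vars s vtB = l%:Z -> vars s vT = T%:Z ->
  (forall s' rt',
     eqv [:: vcur; vnxt; vrx; vry; vroot; vf; vc; ve; vg; vv]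
         [:: rank DD; lo; hi; dif] s s' ->
     is_DD s' (fun u => shift A u + lower B l u) (minima (shift A) (lower B l) delta) rt' ->
     Q s' n) ->
  wp (If (LtT (Lit 1) (Var vtB)) update_left Skip) s (22 + n) Q.
Proof.
move=> [hA hB hAB] ht [v1 v2 v3] hl [rtA [hA1 _]] [rtB [hB1 _]] hD hdel sl sT hq.
have [l1 l2 l3] := hl; apply: wp_if => //=; rewrite sl => hh; last first.
  have el : l = 1%N by lia.
  apply: (@wp_leq _ _ _ _ _ _ n.+1); first lia.
  apply: wp_skip; apply: hq; first by apply: (eqv_weak (eqv_refl _ _)).
  have e x : dom x -> lower B l x = B x - 1 by move=> hx; rewrite /lower el; case: ifP; lia.
  apply: is_DD_ext hD => [x y hx hy|x lx hx c dx hlx hhx]; first by rewrite !e //; lia.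
  rewrite /minima => ->; congr (if _ && _ then _ else _).
  rewrite /high_right; case: eqP => //= hxT.
  have dhx : dom hx by case: hhx; lia.
  by rewrite !e //; lia.
have el : l = l.-1.+1 by lia.
have hx : dom l.-1 by lia.
have hy : dom l.-1.+1 by lia.
move: sl hq hB1 hdel; rewrite el => sl hq hB1 hdel.
have eB := first_step hB ht hl.
apply: (wp_update_left P hK hA1 hB1 hD) => //.
- exact: shift_mono_on.
- exact: bound_seq_mono_on.
- by rewrite -el eB //; lia.
- by rewrite shift_lower /lower ?ifN //; lia.
- by rewrite shift_lower /lower ?ifN //; lia.
(* On the merged class A_{z-1} is at most [A t.-1], so it lies left of the part where [A] is
   lowered, and the final difference is constant on it. *)
move=> z hz e1 e2 e3; rewrite !hdel // e2 /lower ltnn.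
congr (_ - _); rewrite !shift_lower /lower; [|lia|lia].
rewrite [in RHS]ifN; last lia; rewrite ifN ?e1 //.
have mA u w := @bound_seq_mono T A u w hA; rewrite /shift in e1 e3.
apply/negP => h; have := mA v z.-1; have := mA v.-1 v; have := mA l.-1 t.-1.
by move: e1 e3; rewrite /=; lia.
Qed.

Lemma wp_step_right s A B t v delta rt n (Q : state -> nat -> Prop) :
  bound_seq T A -> mono_on T B -> dom t -> is_idx_A T A t v ->
  is_DA s (lower A v) -> is_DB s B ->
  is_DD s (fun u => shift A u + B u) (minima (shift A) B delta) rt ->
  (forall u, dom u -> delta u = B u - shift (lower A v) u) ->
  vars s vtA = v%:Z -> vars s vT = T%:Z ->
  (forall s' rt',
     eqv [:: vcur; vnxt; vrx; vry; vroot; vf; vc; ve; vg; vv]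
         [:: rank DD; lo; hi; dif] s s' ->
     is_DD s' (fun u => shift (lower A v) u + B u) (minima (shift (lower A v)) B delta) rt' ->
     Q s' n) ->
  wp (If (LtT (Var vtA) (Var vT)) update_right Skip) s (22 + n) Q.
Proof.
move=> hA hB ht hv [rtA [hA1 _]] [rtB [hB1 _]] hD hdel sv sT hq.
have [v1 v2 v3] := hv; apply: wp_if => //=; rewrite sv sT => hh; last first.
  apply: (@wp_leq _ _ _ _ _ _ n.+1); first lia.
  apply: wp_skip; apply: (hq _ rt); first by apply: (eqv_weak (eqv_refl _ _)).
  apply: is_DD_minima_eq hD => // u hu.
  by rewrite shift_lower /lower ?ifN //; lia.
have hx : dom v by lia.
have hy : dom v.+1 by lia.
have hA1' : is_ds s DA (lower (shift A) v.+1) rtA.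
  by apply: is_ds_eq hA1 => u hu; rewrite shift_lower //; lia.
apply: (wp_update_right P hK hA1' hB1 hD) => //.
- exact: shift_mono_on.
- by apply: (idx_A_step hA hv ht); lia.
- move=> z hz e1 e2 e3; rewrite !hdel // !shift_lower; [|lia|lia].
  rewrite e1 e2 e3; congr (_ - _); rewrite /lower leqnn.
  have := idx_A_step hA hv ht; rewrite /shift /=; lia.
move=> s' rt' E hD'; apply: (hq _ rt' E).
by apply: is_DD_minima_eq hD' => // u hu; rewrite shift_lower //; lia.
Qed.

(** The entries of [dif] receive the final differences [delta] while DD still has the old classes;
    after that the borders at t_B and at t_A can be treated one at a time. The units are 1 + 1 + 1 +
    2 + 5 + 5 + 22 + 22 = 59, in the order of the statements. *)
Lemma wp_update s A B (X : nat -> bool) t v l rt n (Q : state -> nat -> Prop) :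
  bounds T A B -> dom t -> A t.-1 < B t -> is_idx_A T A t v -> is_first B t l ->
  is_DA s A -> is_DB s B ->
  is_DD s (fun u => shift A u + B u)
    (minima (shift A) B (fun u => B u - shift A u)) rt ->
  (forall u, dom u -> cells s outX u%:Z = (X u)%:Z) ->
  bounds T (lower A v) (lower B l) ->
  vars s vt = t%:Z -> vars s vtA = v%:Z -> vars s vT = T%:Z -> vars s vc = (rt t)%:Z ->
  (forall s',
     eqv [:: vcur; vnxt; vrx; vry; vroot; va; vtB; vf; vc; ve; vg; vv]
         [:: rank DA; rank DB; rank DD; valA; valB; lo; hi; dif; outX] s s' ->
     loop_inv s' (lower A v) (lower B l) (fun u => if u == t then true else X u) -> Q s' n) ->
  wp update s (59 + n) Q.
Proof.
move=> hb ht lt hv hl hA hB hD hX [hA1 hB1 hAB1] st sv sT sc hq; have [bA bB bAB] := hb.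
apply: wp_seq; apply: (@wp_put R P T K outX _ _ t 1) => //= s1 E1 c1.
have [rtB [b1 b2]] := is_DB_eqv E1 isT isT hB.
apply: wp_seq; apply: (wp_find P hK b1 ht) => //=; first by rewrite (eqv_var E1).
move=> s2 E2 r2.
apply: wp_seq; apply: wp_assign => // s3 E3 /=; rewrite r2 (eqv_cell E2) //.
have [l' [-> hl']] := b2 t ht.
have <- : l = l' by apply: (first_uniq (bound_seq_mono_on bB) ht hl hl').
move=> r3; have E := eqv_trans E1 (eqv_trans E2 E3).
have hD3 := is_DD_eqv E isT isT isT isT hD.
pose delta u := lower B l u - shift (lower A v) u.
have mA := shift_mono_on bA; have mB := bound_seq_mono_on bB.
apply: wp_seq; apply: (wp_decrease P hK (delta' := delta) (n := 54 + n) (mono_add mA mB) hD3 ht).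
- by rewrite (eqv_var E).
- move=> z hz; rewrite /shift; have := bound_seq_mono (u := z.-1) (v := z) bA.
  by have := bAB z; lia.
- by move=> z lz hz0 hz hlz hhz h1 h2; apply: (decrease_minima hb ht hv hl hz hlz hhz h1 h2).
- by move=> z hz e; have [-> ->] := mono_add_eq mA mB ht hz e.
move=> s4 E4 hD4; have {}E := eqv_trans E E4.
have hB4 := is_DB_eqv E isT isT hB.
apply: wp_seq; apply: (wp_step_B P hK bB hB4 ht hl).
- by rewrite (eqv_var E4).
- by rewrite (eqv_var E).
move=> s5 E5 hB5; have {}E := eqv_trans E E5.
have hA5 := is_DA_eqv E isT isT hA; have hD5 := is_DD_eqv E5 isT isT isT isT hD4.
apply: wp_seq; apply: (wp_step_A P hK bA hA5 ht hv).
- by rewrite (eqv_var E).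
- by rewrite (eqv_var E).
- by rewrite (eqv_var E).
move=> s6 E6 hA6; have {}E := eqv_trans E E6.
have hB6 := is_DB_eqv E6 isT isT hB5; have hD6 := is_DD_eqv E6 isT isT isT isT hD5.
apply: wp_seq; apply: (wp_step_left hb ht hv hl hA6 hB6 hD6) => //.
- by rewrite (eqv_var E6) // (eqv_var E5) // (eqv_var E4).
- by rewrite (eqv_var E).
move=> s7 rt7 E7 hD7; have {}E := eqv_trans E E7.
have hA7 := is_DA_eqv E7 isT isT hA6; have hB7 := is_DB_eqv E7 isT isT hB6.
apply: (wp_step_right bA (bound_seq_mono_on hB1) ht hv hA7 hB7 hD7) => //.
- by rewrite (eqv_var E).
- by rewrite (eqv_var E).
move=> s8 rt8 E8 hD8; have E' := eqv_trans E E8; apply: hq.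
  by apply: (eqv_weak E').
split.
- exact: is_DA_eqv E8 isT isT hA7.
- exact: is_DB_eqv E8 isT isT hB7.
- by exists rt8.
have Er := eqv_trans E2 (eqv_trans E3 (eqv_trans E4 (eqv_trans E5 (eqv_trans E6 (eqv_trans E7 E8))))).
move=> u hu; rewrite (eqv_cell Er) // c1; case: eqP => // _; exact: hX.
Qed.
End MainLoop.

(** * The main loop simulates the greedy algorithm *)

Section Main.
Variables (R : realDomainType) (P : nat -> R) (T K : nat).
Notation dom x := (1 <= x <= T)%N.
Notation wp := (wp P T K).
Notation eqv := (eqv T).
Notation is_DD := (is_DD T).
Notation minima := (minima T).
Notation loop_inv := (loop_inv T).
Implicit Types (s : state) (f g A B : nat -> int) (rt : nat -> nat).

(** The mark -1 must not hide a difference 0. If A_{t-1} does not increase on entering the class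
    [l, ..., h], then [B] does, and [A l.-1 <= B l.-1 < B l]. If [B] does not increase on leaving
    it, then A_{t-1} does, and [A h.-1 < A h <= B h]. *)
Lemma dif_test s A B rt t : bounds T A B -> dom t ->
  is_DD s (fun u => shift A u + B u)
    (minima (shift A) B (fun u => B u - shift A u)) rt ->
  (cells s dif (rt t)%:Z == 0) = ~~ (A t.-1 < B t).
Proof.
move=> [hA hB hAB] ht [_ hD]; have [l [h [_ _ [l1 l2 l3] [h1 h2 h3] ->]]] := hD t ht.
have mA := shift_mono_on hA; have mB := bound_seq_mono_on hB.
have le : A t.-1 <= B t.
  by apply: le_trans (hAB t _); [apply: (bound_seq_mono hA)|]; lia.
case: ifP => [_|/negbT]; first by rewrite /shift; lia.
have dl : dom l by lia.
have dh : dom h by lia.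
have [el1 el2] := mono_add_eq mA mB ht dl l2.
have [eh1 eh2] := mono_add_eq mA mB ht dh h2.
rewrite negb_and; case/orP.
  rewrite /high_left negb_or negbK => /andP[l4 /eqP l5].
  case: l3 => [e|ne]; first by rewrite e in l4.
  have b1 := mB l.-1 l; have b2 := hAB l.-1; rewrite /shift in el1 l5 ne.
  lia.
rewrite /high_right negb_or negbK => /andP[h4 /eqP h5].
case: h3 => [e|ne]; first by rewrite e eqxx in h4.
have a1 := mA h h.+1; have b2 := hAB h; rewrite /shift /= in a1 eh1 ne.
lia.
Qed.

Lemma idx_A_test A t v : bound_seq T A -> dom t -> is_idx_A T A t v ->
  (v <= T)%N = (A t.-1 < A T).
Proof.
move=> hA ht [v1 v2 v3]; case: leqP => hv.
  have := bound_seq_mono (u := v) (v := T) hA; have := v3 hv.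
  by have := bound_seq_mono (u := v.-1) (v := v) hA; lia.
have e : v.-1 = T by lia.
by rewrite -v2 e ltxx.
Qed.

Hypothesis hK : (T <= tower K 1)%N.

Lemma wp_main s A B (ord : seq nat) n (Q : state -> nat -> Prop) :
  bounds T A B -> size ord = T -> (forall t, t \in ord -> dom t) ->
  vars s vT = T%:Z -> loop_inv s A B (fun=> false) ->
  (forall i, (i < T)%N -> cells s inOrd i%:Z = (nth 0%N ord i)%:Z) ->
  (forall s', (forall u, dom u -> cells s' outX u%:Z = (greedy T P A B ord u)%:Z) ->
     Q s' n) ->
  wp main_loop s (1 + (T * 66 + 1 + n)) Q.
Proof.
move=> hb so ho sT hi sO hq; apply: wp_seq; apply: wp_assign => // s1 E1 r1.
pose st i := foldl (greedy_step T P) (GreedyState (fun=> false) A B) (take i ord).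
pose I i s := [/\ vars s vi = i%:Z, vars s vT = T%:Z,
   forall j, (j < T)%N -> cells s inOrd j%:Z = (nth 0%N ord j)%:Z,
   loop_inv s (gA (st i)) (gB (st i)) (gx (st i)) & bounds T (gA (st i)) (gB (st i))].
have I0 : I 0%N s1.
  rewrite /I /st take0 /=; split=> //.
  - by rewrite (eqv_var E1).
  - by move=> j hj; rewrite (eqv_cell E1) // sO.
  case: hi => h1 h2 [rt h3] h4; split.
  - exact: is_DA_eqv E1 isT isT h1.
  - exact: is_DB_eqv E1 isT isT h2.
  - by exists rt; apply: is_DD_eqv E1 isT isT isT isT h3.
  - by move=> u hu; rewrite (eqv_cell E1) // h4.
(* An iteration takes 65 units: 5 up to and including the test, 59 for [update], 1 for the
   increment. The loop test takes one more. *)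
rewrite (_ : (T * 66 + 1 + n = (T - 0) * 65.+1 + 1 + n)%N); last lia.
apply: (@wp_mono _ _ _ _ _ _ _ (fun s' m' => I T s' /\ m' = n)); last first.
  move=> s' m' [[_ _ _ [_ _ _ h4] _] ->]; apply: hq => u hu; rewrite h4 //.
  by rewrite /st take_oversize // so.
apply: wp_for => //; last by move=> s2 [h1 h2 _ _ _]; rewrite /= h1 h2; lia.
move=> i {sT sO hi E1 r1 I0 s1}s hi' [h1 h2 h3 [hA hB [rt hD] hX] hbi].
split; first by rewrite /= h1 h2; lia.
have hiT : (i < T)%N by lia.
set t := nth 0%N ord i.
have ht : dom t by apply: ho; apply: mem_nth; rewrite so; lia.
have est : st i.+1 = greedy_step T P (st i) t.
  by rewrite /st (take_nth 0%N) ?so // -cats1 foldl_cat.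
move: est; case: (st i) hA hB hD hX hbi => x A1 B1 /= hA hB hD hX hbi est.
apply: wp_seq; apply: wp_assign => // s1 E1; rewrite /= h1 (h3 i hiT) -/t => r1.
have hD1 := is_DD_eqv E1 isT isT isT isT hD.
apply: wp_seq; apply: (wp_find P hK (proj1 hD1) ht) => // s2 E2 r2.
have [rtA [a1 a2]] := is_DA_eqv (eqv_trans E1 E2) isT isT hA.
apply: wp_seq; apply: (wp_find P hK a1 ht) => //; first by rewrite /= (eqv_var E2).
move=> s3 E3 r3; have [v [v1 v2]] := a2 t ht.
apply: wp_seq; apply: wp_assign => // s4 E4; rewrite /= r3 (eqv_cell E3) // v1 => r4.
have E := eqv_trans E1 (eqv_trans E2 (eqv_trans E3 E4)).
have hA4 := is_DA_eqv E isT isT hA; have hB4 := is_DB_eqv E isT isT hB.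
have hD4 := is_DD_eqv E isT isT isT isT hD.
have X4 u : dom u -> cells s4 outX u%:Z = (x u)%:Z by move=> hu; rewrite (eqv_cell E) // hX.
have t4 : vars s4 vt = t%:Z by rewrite (eqv_var E4) // (eqv_var E3) // (eqv_var E2).
have c4 : vars s4 vc = (rt t)%:Z by rewrite (eqv_var E4) // (eqv_var E3).
have T4 : vars s4 vT = T%:Z by rewrite (eqv_var E).
have i4 : vars s4 vi = i%:Z by rewrite (eqv_var E).
have O4 j : (j < T)%N -> cells s4 inOrd j%:Z = (nth 0%N ord j)%:Z.
  by move=> hj; rewrite (eqv_cell E) // h3.
have [bA bB bAB] := hbi.
have fin s5 m : vars s5 vi = i%:Z -> vars s5 vT = T%:Z ->
   (forall j, (j < T)%N -> cells s5 inOrd j%:Z = (nth 0%N ord j)%:Z) ->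
   loop_inv s5 (gA (st i.+1)) (gB (st i.+1)) (gx (st i.+1)) ->
   bounds T (gA (st i.+1)) (gB (st i.+1)) ->
   wp (Assign vi (Plus (Var vi) (Lit 1))) s5 m.+1 (fun s' _ => I i.+1 s').
  move=> k1 k2 k3 [k4 k5 [rt' k6] k7] k8; apply: wp_assign => // s6 E6 r6; split=> //.
  - by rewrite r6 /= k1; lia.
  - by rewrite (eqv_var E6).
  - by move=> j hj; rewrite (eqv_cell E6) // k3.
  split.
  - exact: is_DA_eqv E6 isT isT k4.
  - exact: is_DB_eqv E6 isT isT k5.
  - by exists rt'; apply: is_DD_eqv E6 isT isT isT isT k6.
  - by move=> u hu; rewrite (eqv_cell E6) // k7.
have ec : holds P s4 (And (Not (EqT (Get dif (Var vc)) (Lit 0)))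
     (Or (Not (LtT (Var vT) (Var vtA))) (PriceNeg (Var vt)))) =
   (A1 t.-1 < B1 t) && ((A1 t.-1 < A1 T) || (P t < 0)).
  rewrite /= c4 (dif_test hbi ht hD4) negbK r4 T4 t4 -(idx_A_test bA ht v2).
  by rewrite -leNgt.
apply: wp_seq; apply: wp_if => //; rewrite ec => hc; last first.
  apply: (@wp_leq _ _ _ _ _ _ 2); first lia.
  apply: wp_skip; apply: fin; rewrite ?est /= ?(negbTE hc) //.
  by split=> //; exists rt.
have /andP[lt _] := hc.
have ev := idx_A_uniq bA v2 (idx_AP bA ht).
have hl := idx_BP bB ht; have hb' := bounds_step hbi ht lt; rewrite -ev in hb'.
apply: (wp_update P hK (n := 1) hbi ht lt v2 hl hA4 hB4 hD4 X4 hb' t4 r4 T4 c4).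
move=> s5 E5 h5; apply: fin.
- by rewrite (eqv_var E5).
- by rewrite (eqv_var E5).
- by move=> j hj; rewrite (eqv_cell E5) // O4.
- by rewrite est hc /= -ev.
- by rewrite est hc /= -ev.
Qed.
End Main.

(** * Initialisation *)

Section Singletons.
Variables (R : realDomainType) (P : nat -> R) (T K : nat).
Notation dom x := (1 <= x <= T)%N.
Implicit Types (s : state).

Definition is_input (a : arr) : bool :=
  match a with inA | inB | inOrd => true | _ => false end.

Definition init_val (a : arr) (x : int) : int :=
  match a with rank _ | outX => 0 | dif => - 1 | _ => x end.

Definition init_body : cmd :=
  (Put (par DA) vi vi ;; Put (rank DA) vi 0 ;; Put valA vi vi ;;
   Put (par DB) vi vi ;; Put (rank DB) vi 0 ;; Put valB vi vi ;;
   Put (par DD) vi vi ;; Put (rank DD) vi 0 ;;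
   Put lo vi vi ;; Put hi vi vi ;; Put dif vi (-1) ;;
   Put outX vi 0 ;;
   vi ::= vi + 1)%imp.

Lemma exec_put_val a e s i z : vars s vi = i -> eval s e = z -> eval_cost e = 1%N ->
  exists s', [/\ exec P (Put a (Var vi) e) s s' 3, vars s' vi = i,
    vars s' = vars s & forall b j, cells s' b j =
      if (b == a) && (j == i) then z else cells s b j].
Proof.
move=> hi hz hc; exists (set_cell s a i z); split=> //.
have -> : 3%N = (eval_cost (Var vi) + eval_cost e).+1 by rewrite hc.
by rewrite -hi -hz; apply: exec_put.
Qed.

Lemma exec_init_body s : exists s',
  [/\ exec P init_body s s' 40, vars s' vi = vars s vi + 1,
      forall v, v != vi -> vars s' v = vars s v &
      forall a j, cells s' a j = if is_input a then cells s a j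
        else if j == vars s vi then init_val a j else cells s a j].
Proof.
have [i0 ei] : exists i, vars s vi = i by exists (vars s vi).
move: (ei) => v0.
have [s1 [e1 v1 w1 c1]] := @exec_put_val (par DA) (Var vi) s i0 i0 v0 v0 erefl.
have [s2 [e2 v2 w2 c2]] := @exec_put_val (rank DA) (Lit 0) s1 i0 0 v1 erefl erefl.
have [s3 [e3 v3 w3 c3]] := @exec_put_val valA (Var vi) s2 i0 i0 v2 v2 erefl.
have [s4 [e4 v4 w4 c4]] := @exec_put_val (par DB) (Var vi) s3 i0 i0 v3 v3 erefl.
have [s5 [e5 v5 w5 c5]] := @exec_put_val (rank DB) (Lit 0) s4 i0 0 v4 erefl erefl.
have [s6 [e6 v6 w6 c6]] := @exec_put_val valB (Var vi) s5 i0 i0 v5 v5 erefl.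
have [s7 [e7 v7 w7 c7]] := @exec_put_val (par DD) (Var vi) s6 i0 i0 v6 v6 erefl.
have [s8 [e8 v8 w8 c8]] := @exec_put_val (rank DD) (Lit 0) s7 i0 0 v7 erefl erefl.
have [s9 [e9 v9 w9 c9]] := @exec_put_val lo (Var vi) s8 i0 i0 v8 v8 erefl.
have [s10 [e10 v10 w10 c10]] := @exec_put_val hi (Var vi) s9 i0 i0 v9 v9 erefl.
have [s11 [e11 v11 w11 c11]] := @exec_put_val dif (Lit (- 1)) s10 i0 (- 1) v10 erefl erefl.
have [s12 [e12 v12 w12 c12]] := @exec_put_val outX (Lit 0) s11 i0 0 v11 erefl erefl.
exists (set_var s12 vi (vars s12 vi + 1)); split.
- have e13 := exec_set P s12 vi (Plus (Var vi) (Lit 1)).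
  exact: (exec_seq e1 (exec_seq e2 (exec_seq e3 (exec_seq e4 (exec_seq e5 (exec_seq e6
    (exec_seq e7 (exec_seq e8 (exec_seq e9 (exec_seq e10 (exec_seq e11
    (exec_seq e12 e13)))))))))))).
- by rewrite /= v12 ei.
- move=> v /negbTE hv; rewrite /= hv.
  by rewrite w12 w11 w10 w9 w8 w7 w6 w5 w4 w3 w2 w1.
move=> a j; rewrite ei /= c12 c11 c10 c9 c8 c7 c6 c5 c4 c3 c2 c1.
by case: a {c1 c2 c3 c4 c5 c6 c7 c8 c9 c10 c11 c12} => [| | | |[]|[]| | | | |];
  case: (j =P i0) => [->|].
Qed.

(** The initial contents of the cells are arbitrary, so there is neither a forest nor a bounded
    potential before this phase. Its steps are therefore counted directly instead of with [wp]. *)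
Lemma exec_init_singletons s : vars s vT = T%:Z -> exists s' k,
  [/\ exec P init_singletons s s' k, (k <= 45 * T + 7)%N,
      forall v, v != vi -> vars s' v = vars s v &
      forall a (j : nat), cells s' a j%:Z =
        if is_input a || ~~ dom j then cells s a j%:Z else init_val a j%:Z].
Proof.
move=> sT; set b := Not (LtT (Var vT) (Var vi)).
suff loop m i s1 : (T.+1 - i = m)%N -> (1 <= i <= T.+1)%N -> vars s1 vi = i%:Z -> vars s1 vT = T%:Z ->
  exists s' k, [/\ exec P (While b init_body) s1 s' k, (k <= 45 * m + 5)%N,
      forall v, v != vi -> vars s' v = vars s1 v &
      forall a (j : nat), cells s' a j%:Z =
        if is_input a || ~~ (i <= j <= T)%N then cells s1 a j%:Z else init_val a j%:Z].
  have [||||s' [k [h1 h2 h3 h4]]] := @loop T 1%N (set_var s vi 1); rewrite ?subSS ?subn0 //.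
  exists s', (2 + k)%N; split=> //; [exact: exec_seq (exec_set P s vi (Lit 1)) h1|lia|].
  by move=> v hv; rewrite h3 //= (negbTE hv).
elim: m i s1 => [|m IH] i s1 hm hi si sT1.
  exists s1, 5%N; split=> //.
    by apply: (@exec_while_false _ P b); rewrite /= sT1 si; lia.
  by move=> a j; case: ifP => //; lia.
have [s2 [e2 v2 w2 c2]] := exec_init_body s1.
have [||||s' [k [h1 h2 h3 h4]]] := IH i.+1 s2.
- by lia.
- by lia.
- by rewrite v2 si; lia.
- by rewrite w2.
exists s', (4 + 40 + k).+1; split.
- by apply: (@exec_while_true _ P b _ _ _ _ _ _ _ e2 h1); rewrite /= sT1 si; lia.
- by lia.
- by move=> v hv; rewrite h3 // w2.
move=> a j; rewrite h4 c2 si; case: (is_input a) => //=.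
have [->|ne] := eqVneq j i; first by rewrite eqxx ltnn /=; case: ifP => //; lia.
have -> : (j%:Z == i%:Z) = false by move/eqP: ne; lia.
by have -> : (i < j <= T)%N = (i <= j <= T)%N by move/eqP: ne; lia.
Qed.

Lemma singletons_is_ds s d f :
  (forall a (j : nat), ~~ is_input a -> dom j -> cells s a j%:Z = init_val a j%:Z) ->
  (forall x y, dom x -> dom y -> f x = f y -> x = y) -> is_ds T s d f id.
Proof.
move=> hc hf; have hp x : dom x -> ptr s d x = x by move=> hx; rewrite /ptr hc.
have hr x : dom x -> rnk s d x = 0%N by move=> hx; rewrite /rnk hc.
split.
- by move=> x hx; rewrite !hc.
- split=> x hx; rewrite ?hp ?hr ?eqxx //.
  rewrite add0n /roots; apply: (@leq_trans (\sum_(1 <= i < T.+1) 1)).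
    by apply: leq_sum => i _; apply: leq_b1.
  by rewrite sum_nat_const_nat; lia.
move=> x y hx hy; apply/eqP/eqP => [-> //|]; exact: hf.
Qed.

(** All ranks are 0, so the amortised analysis starts from potential 0 and its budget bounds the
    true time. *)
Lemma singletons_tpot s :
  (forall a (j : nat), ~~ is_input a -> dom j -> cells s a j%:Z = init_val a j%:Z) ->
  tpot T K s = 0%N.
Proof.
move=> hc; have h d : pot T K s d = 0%N.
  rewrite /pot /potential big_nat_cond big1 // => x /andP[hx _].
  have hx' : dom x by lia.
  by rewrite /pot1 /ptr /rnk !hc //= eqxx muln0.
by rewrite /tpot !h.
Qed.
End Singletons.

(** * Partitions built up to a given index *)

Section Classes.
Variables (R : realDomainType) (P : nat -> R) (T K : nat).
Notation dom x := (1 <= x <= T)%N.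
Notation wp := (wp P T K).
Notation eqv := (eqv T).
Notation is_ds := (is_ds T).
Notation is_DD := (is_DD T).
Notation minima := (minima T).
Implicit Types (s : state) (f g A B : nat -> int) (rt : nat -> nat).

(* The level sets of f, with all elements from i on in classes of their own. *)
Definition trunc f (i : nat) : nat -> int :=
  fun u => if (u < i)%N then f u else f i.-1 + (u - i.-1)%N%:Z.

Lemma trunc_mono f i : (1 < i)%N -> mono_on T f -> mono_on T (trunc f i).
Proof.
move=> hi hf u v hu huv; rewrite /trunc; case: ltnP => h1; case: ltnP => h2 //.
- exact: hf.
- by have := hf u i.-1; lia.
- by lia.
by lia.
Qed.

Lemma trunc2_inj f x y : dom x -> dom y -> trunc f 2 x = trunc f 2 y -> x = y.
Proof.
move=> hx hy; have e z : dom z -> trunc f 2 z = f 1%N + (z - 1)%N%:Z.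
  move=> hz; rewrite /trunc; case: ltnP => h //.
  have -> : z = 1%N by lia.
  by rewrite subnn addr0.
by rewrite !e //; lia.
Qed.

Lemma trunc_last f x : dom x -> trunc f T.+1 x = f x.
Proof. by move=> hx; rewrite /trunc ifT //; lia. Qed.

(** Going from [i] to [i.+1] shifts all values from [i] on by the same amount, so only the border
    between [i - 1] and [i] can vanish. *)
Lemma trunc_merges f i : mono_on T f -> (1 < i <= T)%N -> f i.-1 = f i ->
  merges T (trunc f i) (trunc f i.+1) i.-1 i.
Proof.
move=> hf hi e u v hu hv.
have a1 : trunc f i i.-1 = f i by rewrite /trunc ifT ?e //; lia.
have a2 : trunc f i i = f i + 1 by rewrite /trunc ltnn e; lia.
have c w : dom w -> (w < i)%N /\ trunc f i w = f w /\ trunc f i.+1 w = f w /\ f w <= f i \/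
   w = i /\ trunc f i w = f i + 1 /\ trunc f i.+1 w = f i \/
   (i < w)%N /\ trunc f i w = f i + (w - i)%N%:Z + 1 /\ trunc f i.+1 w = f i + (w - i)%N%:Z.
  move=> hw; rewrite /trunc /= ltnS; case: (ltngtP w i) => h.
  - by left; have := hf w i; lia.
  - by right; right; rewrite e; lia.
  - by right; left; rewrite h e; lia.
have := c u hu; have := c v hv; rewrite a1 a2; lia.
Qed.

Lemma trunc_same f i : mono_on T f -> (1 < i <= T)%N -> f i.-1 <> f i ->
  forall u v, dom u -> dom v ->
  (trunc f i.+1 u == trunc f i.+1 v) = (trunc f i u == trunc f i v).
Proof.
move=> hf hi e u v hu hv; have := hf i.-1 i.
have c w : dom w -> (w < i)%N /\ trunc f i w = f w /\ trunc f i.+1 w = f w /\ f w <= f i.-1 \/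
   (i <= w)%N /\ trunc f i w = f i.-1 + (w - i)%N%:Z + 1 /\ trunc f i.+1 w = f i + (w - i)%N%:Z.
  move=> hw; rewrite /trunc /= ltnS; case: (ltngtP w i) => h.
  - by left; have := hf w i.-1; lia.
  - by right; lia.
  - by right; rewrite h; lia.
have := c u hu; have := c v hv; lia.
Qed.
End Classes.

Section Initialisation.
Variables (R : realDomainType) (P : nat -> R) (T K : nat).
Notation dom x := (1 <= x <= T)%N.
Notation wp := (wp P T K).
Notation eqv := (eqv T).
Notation is_ds := (is_ds T).
Notation is_DD := (is_DD T).
Notation is_DA := (is_DA T).
Notation is_DB := (is_DB T).
Notation minima := (minima T).
Implicit Types (s : state) (f g A B : nat -> int) (rt : nat -> nat).
Hypothesis hK : (T <= tower K 1)%N.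

Definition has_data s d a f (V : (nat -> int) -> nat -> nat -> Prop) : Prop :=
  exists rt, is_ds s d f rt /\
    forall z, dom z -> exists h : nat, cells s a (rt z)%:Z = h%:Z /\ V f z h.

Lemma has_data_eqv vs cs s s' d a f V : eqv vs cs s s' -> ~~ is_par a ->
  rank d \notin cs -> a \notin cs -> has_data s d a f V -> has_data s' d a f V.
Proof.
move=> E pa c1 c2 [rt [h1 h2]]; exists rt; split; first exact: (eqv_ds E).
by move=> z /h2; rewrite (eqv_cell E).
Qed.

Lemma trunc_lt f i : mono_on T f -> (1 < i <= T)%N ->
  trunc f i i.-1 < trunc f i i.
Proof. by move=> hf hi; rewrite /trunc ltnn ifT; lia. Qed.

Lemma wp_class d a w b f i s n V (Q : state -> nat -> Prop) :
  ~~ is_par a -> ~~ is_rank a -> mono_on T f -> (1 < i <= T)%N ->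
  vars s vi = i%:Z -> holds P s b = (f i.-1 == f i) -> (holds_cost b < 60)%N ->
  w = vrx /\ V = is_first \/ w = vry /\ V = is_last T ->
  has_data s d a (trunc f i) V ->
  (forall s', eqv [:: vcur; vnxt; vrx; vry; vroot] [:: rank d; a] s s' ->
     has_data s' d a (trunc f i.+1) V -> Q s' n) ->
  wp (If b (Seq (union_ds d (Minus (Var vi) (Lit 1)) (Var vi))
               (Put a (Var vroot) (Get a (Var w)))) Skip) s (5 + n) Q.
Proof.
move=> pa ra hf hi si hb cb hw [rt [h1 h2]] hq.
have lt := trunc_lt hf hi; have hx : dom i.-1 by lia.
have hy : dom i by lia.
have i1 : (1 < i)%N by lia.
have htf := trunc_mono i1 hf.
apply: wp_if; rewrite ?hb // => /eqP e; last first.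
  apply: (@wp_leq _ _ _ _ _ _ n.+1); first lia.
  apply: wp_skip; apply: hq; first by apply: (eqv_weak (eqv_refl _ _)).
  have sm := trunc_same hf hi e; exists rt; split.
    by case: h1 => c1 c2 c3; split=> // x y dx dy; rewrite c3 // sm.
  move=> z hz; have [h [z1 z2]] := h2 z hz; exists h; split=> //.
  by case: hw z2 => -[_ ->] z2; [exact: (first_ext sm hz z2)|exact: (last_ext sm hz z2)].
have hm := trunc_merges hf hi e.
pose W (g : nat -> int) z c := exists h : nat, c = h%:Z /\ V g z h.
apply: (@wp_union_data R P T K hK d a w _ _ i.-1 i (if w == vrx then i.-1 else i)
  (trunc f i) (trunc f i.+1) rt (W (trunc f i)) (W (trunc f i.+1))) => //=.
- by rewrite lt_eqF.
- by case: hw => -[-> _]; [left|right].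
- by rewrite si; lia.
- by move=> s' E; rewrite (eqv_var E).
- move=> z c hz ez [h [-> hV]]; exists h; split=> //; case: hw hV => -[-> ->] /= hV.
    exact: (first_merge hm htf hx hy lt).
  exact: (last_merge hm htf hx hy lt).
move=> z c hz e1 e2 [h [-> hV]]; exists h; split=> //; case: hw hV => -[_ ->] hV.
  exact: (first_other hm).
exact: (last_other hm).
Qed.

Lemma wp_class_D b f i s n rt (Q : state -> nat -> Prop) :
  mono_on T f -> (1 < i <= T)%N ->
  vars s vi = i%:Z -> holds P s b = (f i.-1 == f i) -> (holds_cost b < 60)%N ->
  is_DD s (trunc f i) (fun _ _ _ c => c = - 1) rt ->
  (forall s' rt', eqv [:: vcur; vnxt; vrx; vry; vroot] [:: rank DD; lo; hi] s s' ->
     is_DD s' (trunc f i.+1) (fun _ _ _ c => c = - 1) rt' -> Q s' n) ->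
  wp (If b (union_D (Minus (Var vi) (Lit 1)) (Var vi)) Skip) s (6 + n) Q.
Proof.
move=> hf hi si hb cb hD hq; have lt := trunc_lt hf hi.
have ei : i = i.-1.+1 by lia.
have hx : dom i.-1 by lia.
have hy : dom i.-1.+1 by lia.
have i1 : (1 < i)%N by lia.
have htf := trunc_mono i1 hf.
apply: wp_if; rewrite ?hb // => /eqP e; last first.
  apply: (@wp_leq _ _ _ _ _ _ n.+1); first lia.
  apply: wp_skip; apply: (hq _ rt); first by apply: (eqv_weak (eqv_refl _ _)).
  by apply: is_DD_ext hD => //; apply: trunc_same.
have hm : merges T (trunc f i) (trunc f i.+1) i.-1 i.-1.+1.
  by rewrite -ei; apply: trunc_merges.
have {}lt : trunc f i i.-1 < trunc f i i.-1.+1 by rewrite -ei.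
apply: (wp_union_D P hK hD htf hx hy lt hm) => //=.
- by rewrite si; lia.
- by move=> s' E; rewrite (eqv_var E) // si -ei.
move=> s' rt' E _ hD'; apply: (hq _ rt' E); apply: is_DD_ext hD' => // x l h c _ _ _.
by case: ifP => // _ [? [? [? ->]]].
Qed.

(** While the classes are built, valA holds the last element of a class. This is already t_A, except
    for the class of [T] when [A] does not increase at [T]; there T + 1 is written afterwards. *)
Lemma is_last_idx A z h : bound_seq T A -> dom z -> is_last T (shift A) z h ->
  (h < T)%N \/ A T.-1 <> A T -> is_idx_A T A z h.
Proof.
move=> hA hz [h1 h2 h3] hT; split=> //; first lia.
move=> hh; case: h3 => [e|]; last by rewrite eq_sym.
by rewrite e in hT *; case: hT; [lia|move=> ?; apply/eqP => ?; auto].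
Qed.

Lemma wp_last_class s A n (Q : state -> nat -> Prop) : (0 < T)%N ->
  bound_seq T A -> has_data s DA valA (shift A) (is_last T) ->
  vars s vT = T%:Z -> (forall u, (u <= T)%N -> cells s inA u%:Z = A u) ->
  (forall s', eqv [:: vcur; vnxt; va] [:: valA] s s' -> is_DA s' A -> Q s' n) ->
  wp (If (EqT (Get inA (Minus (Var vT) (Lit 1))) (Get inA (Var vT)))
    (Seq (find_ds DA (Var vT) va) (Put valA (Var va) (Plus (Var vT) (Lit 1)))) Skip)
    s (3 + n) Q.
Proof.
move=> T0 hA [rt [h1 h2]] sT cA hq; have hT : dom T by lia.
have e1 : T%:Z - 1 = T.-1%:Z by lia.
have ec : (cells s inA (vars s vT - 1) == cells s inA (vars s vT)) = (A T.-1 == A T).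
  by rewrite sT e1 !cA //; lia.
apply: wp_if => //=; rewrite ec => /eqP e; last first.
  apply: (@wp_leq _ _ _ _ _ _ n.+1); first lia.
  apply: wp_skip; apply: hq; first by apply: (eqv_weak (eqv_refl _ _)).
  exists rt; split=> // z hz; have [h [z1 z2]] := h2 z hz; exists h; split=> //.
  by apply: (is_last_idx hA hz z2); right.
apply: wp_seq; apply: (wp_find P hK h1 hT) => // s1 E1 r1.
apply: (@wp_put R P T K valA _ _ (rt T) T.+1%:Z) => //=.
  by rewrite (eqv_var E1) // sT; lia.
move=> s2 E2 c2; apply: hq; first by apply: (eqv_weak (eqv_trans E1 E2)).
exists rt; split; first by apply: (eqv_ds E2) => //; apply: (eqv_ds E1).
move=> z hz; rewrite c2 (ds_class h1) // (eqv_cell E1) //; case: eqP => ez.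
  by exists T.+1; split=> //; split=> //=; [lia|rewrite -e; exact: (esym ez)|lia].
have [h [z1 z2]] := h2 z hz; exists h; split=> //.
apply: (is_last_idx hA hz z2); left; case: z2 => z3 z4 _.
have [eh|ne] := eqVneq h T; last by move/eqP: ne; lia.
by case: ez; rewrite -z4 eh.
Qed.

Lemma wp_init_classes s A B n (Q : state -> nat -> Prop) : (0 < T)%N ->
  bound_seq T A -> bound_seq T B -> vars s vT = T%:Z ->
  (forall u, (u <= T)%N -> cells s inA u%:Z = A u) ->
  (forall u, (u <= T)%N -> cells s inB u%:Z = B u) ->
  (forall a (j : nat), ~~ is_input a -> dom j -> cells s a j%:Z = init_val a j%:Z) ->
  (forall s' rt, eqv [:: vi; vcur; vnxt; vrx; vry; vroot; va]
       [:: rank DA; rank DB; rank DD; valA; valB; lo; hi] s s' ->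
     is_DA s' A -> is_DB s' B ->
     is_DD s' (fun u => shift A u + B u) (fun _ _ _ c => c = - 1) rt -> Q s' n) ->
  wp init_classes s (1 + ((T.+1 - 2) * 18 + 1 + (3 + n))) Q.
Proof.
move=> T0 hA hB sT cA cB hs hq; have mA := shift_mono_on hA; have mB := bound_seq_mono_on hB.
have mD := mono_add mA mB.
apply: wp_seq; apply: wp_assign => // s1 E1 r1.
pose vs := [:: vi; vcur; vnxt; vrx; vry; vroot].
pose cs := [:: rank DA; rank DB; rank DD; valA; valB; lo; hi].
pose I i s' := [/\ eqv vs cs s s', vars s' vi = i%:Z,
  has_data s' DA valA (trunc (shift A) i) (is_last T),
  has_data s' DB valB (trunc B i) is_first &
  exists rt, is_DD s' (trunc (fun u => shift A u + B u) i) (fun _ _ _ c => c = - 1) rt].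
have inj f : forall x y, dom x -> dom y -> trunc f 2 x = trunc f 2 y -> x = y := @trunc2_inj T f.
have dsd d f : is_ds s d (trunc f 2) id.
  by apply: singletons_is_ds; [exact: hs|exact: inj].
have fst f z : dom z -> is_first (trunc f 2) z z.
  move=> hz; split=> //; first lia.
  have [->|z1] := eqVneq z 1%N; [by left|right].
  by apply/eqP => /inj; lia.
have lst f z : dom z -> is_last T (trunc f 2) z z.
  move=> hz; split=> //; first lia.
  have [->|z1] := eqVneq z T; [by left|right].
  by apply/eqP => /inj; lia.
have I0 : I 2%N s1.
  split=> //; first by apply: (eqv_weak E1).
  - exists id; split; first exact: (eqv_ds E1 isT (dsd _ _)).
    by move=> z hz; exists z; split; [rewrite (eqv_cell E1) // hs //|apply: lst].
  - exists id; split; first exact: (eqv_ds E1 isT (dsd _ _)).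
    by move=> z hz; exists z; split; [rewrite (eqv_cell E1) // hs //|apply: fst].
  exists id; split; first exact: (eqv_ds E1 isT (dsd _ _)).
  move=> z hz; exists z, z; rewrite !(eqv_cell E1) // !hs //.
  by split=> //; [apply: fst|apply: lst].
apply: wp_seq; apply: (@wp_mono _ _ _ _ _ _ _ (fun s' m' => I T.+1 s' /\ m' = 3 + n)%N).
  apply: wp_for => //; last first.
    by move=> s2 [E2 h2 _ _ _]; rewrite /= (eqv_var E2) // sT h2; lia.
  move=> i s2 hi [E2 i2 A2 B2 [rt D2]].
  split; first by rewrite /= (eqv_var E2) // sT i2; lia.
  have hi' : (1 < i <= T)%N by lia.
  have n1 : i%:Z - 1 = i.-1%:Z by lia.
  have n2 : i%:Z - 2 = i.-2%:Z by lia.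
  have tA s' : vars s' vi = i%:Z -> cells s' inA = cells s2 inA ->
      (cells s' inA (vars s' vi - 2) == cells s' inA (vars s' vi - 1)) =
      (shift A i.-1 == shift A i).
    by move=> -> ->; rewrite n1 n2 (eqv_cell E2) // !cA //; lia.
  have tB s' : vars s' vi = i%:Z -> cells s' inB = cells s2 inB ->
      (cells s' inB (vars s' vi - 1) == cells s' inB (vars s' vi)) = (B i.-1 == B i).
    by move=> -> ->; rewrite n1 (eqv_cell E2) // !cB //; lia.
  apply: wp_seq; apply: (@wp_class DA valA vry _ (shift A) i s2 12%N (is_last T)) => //.
  - exact: tA.
  - by right.
  move=> s3 E3 A3; have B3 := (has_data_eqv (d := DB) (a := valB) E3 isT isT isT B2).
  have D3 := is_DD_eqv E3 isT isT isT isT D2.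
  have i3 : vars s3 vi = i%:Z by rewrite (eqv_var E3).
  apply: wp_seq; apply: (@wp_class DB valB vrx _ B i s3 7%N is_first) => //.
  - by apply: tB => //; rewrite (eqv_cell E3).
  - by left.
  move=> s4 E4 B4; have A4 := (has_data_eqv (d := DA) (a := valA) E4 isT isT isT A3).
  have D4 := is_DD_eqv E4 isT isT isT isT D3.
  have i4 : vars s4 vi = i%:Z by rewrite (eqv_var E4).
  apply: wp_seq; apply: (wp_class_D (n := 1) mD hi' i4 _ _ D4) => //.
    rewrite /= tA ?tB ?(eqv_cell E4) ?(eqv_cell E3) //.
    by have := mA i.-1 i; have := mB i.-1 i; lia.
  move=> s5 rt5 E5 D5; have A5 := (has_data_eqv (d := DA) (a := valA) E5 isT isT isT A4).
  have B5 := (has_data_eqv (d := DB) (a := valB) E5 isT isT isT B4).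
  apply: wp_assign => // s6 E6 r6; split.
  - by apply: (eqv_weak (eqv_trans E2 (eqv_trans E3 (eqv_trans E4 (eqv_trans E5 E6))))).
  - by rewrite r6 /= (eqv_var E5) // i4; lia.
  - exact: (has_data_eqv (d := DA) (a := valA) E6 isT isT isT A5).
  - exact: (has_data_eqv (d := DB) (a := valB) E6 isT isT isT B5).
  by exists rt5; apply: is_DD_eqv E6 isT isT isT isT D5.
move=> s2 m [[E2 i2 A2 B2 [rt D2]] ->].
have tl f u v : dom u -> dom v -> (f u == f v) = (trunc f T.+1 u == trunc f T.+1 v).
  by move=> hu hv; rewrite !(@trunc_last T).
have lA : has_data s2 DA valA (shift A) (is_last T).
  have [rtA [a1 a2]] := A2; exists rtA; split.
    by apply: is_ds_eq a1 => x hx; rewrite (@trunc_last T).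
  move=> z /[dup] hz /a2 [h [z1 z2]]; exists h; split=> //.
  by apply: last_ext z2 => // u v hu hv; apply: tl.
have lB : is_DB s2 B.
  have [rtB [b1 b2]] := B2; exists rtB; split.
    by apply: is_ds_eq b1 => x hx; rewrite (@trunc_last T).
  move=> z /[dup] hz /b2 [h [z1 z2]]; exists h; split=> //.
  by apply: (@first_ext T _ _ _ _ _ hz z2) => // u v hu hv; apply: tl.
apply: (wp_last_class T0 hA lA) => //; first by rewrite (eqv_var E2).
  by move=> u hu; rewrite (eqv_cell E2) // cA.
move=> s3 E3 A3; apply: (hq s3 rt) => //.
- by apply: (eqv_weak (eqv_trans E2 E3)).
- exact: is_DB_eqv E3 isT isT lB.
apply: (is_DD_eqv E3) => //; apply: is_DD_ext D2 => // u v hu hv.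
exact: (tl (fun u => shift A u + B u)).
Qed.

Lemma wp_init_minima s A B n rt (Q : state -> nat -> Prop) :
  bounds T A B -> vars s vT = T%:Z ->
  (forall u, (u <= T)%N -> cells s inA u%:Z = A u) ->
  (forall u, (u <= T)%N -> cells s inB u%:Z = B u) ->
  is_DA s A -> is_DB s B ->
  is_DD s (fun u => shift A u + B u) (fun _ _ _ c => c = - 1) rt ->
  (forall s', eqv [:: vi; vcur; vnxt; vrx; vry; vc; ve; vf; vg] [:: dif] s s' ->
     is_DA s' A -> is_DB s' B ->
     is_DD s' (fun u => shift A u + B u)
       (minima (shift A) B (fun u => B u - shift A u)) rt -> Q s' n) ->
  wp init_minima s (1 + ((T.+1 - 1) * 17 + 1 + n)) Q.
Proof.
move=> [hA hB hAB] sT cA cB DA0 DB0 D0 hq.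
have mA := shift_mono_on hA; have mB := bound_seq_mono_on hB; have mD := mono_add mA mB.
pose fD u := shift A u + B u.
apply: wp_seq; apply: wp_assign => // s1 E1 r1.
pose vs := [:: vi; vcur; vnxt; vrx; vry; vc; ve; vf; vg].
pose delta u := B u - shift A u.
(* The loop runs over elements, so a class may be visited several times, always with the same
   result. Its entry is right for all its elements after the first visit; before that it is -1. *)
pose D i x l h (c : int) := minima (shift A) B delta x l h c \/ (i <= x)%N /\ c = - 1.
pose I i s' := [/\ eqv vs [:: dif] s s', vars s' vi = i%:Z, is_DA s' A, is_DB s' B &
  is_DD s' fD (D i) rt].
apply: (@wp_mono _ _ _ _ _ _ _ (fun s' m' => I T.+1 s' /\ m' = n)); last first.
  move=> s2 m [[E2 _ A2 B2 D2] ->]; apply: hq => //.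
  apply: is_DD_ext D2 => // x l h c hx _ _ [//|]; lia.
apply: wp_for => //.
- split=> //.
  + by apply: (eqv_weak E1).
  + exact: is_DA_eqv E1 isT isT DA0.
  + exact: is_DB_eqv E1 isT isT DB0.
  apply: (is_DD_eqv E1) => //; apply: is_DD_ext D0 => // x l h c hx _ _ ->.
  by right; split=> //; lia.
- move=> i s2 hi [E2 i2 A2 B2 D2].
  split; first by rewrite /= (eqv_var E2) // sT i2; lia.
  have hx : dom i by lia.
  have [l [h [l1 h1 l2 h2 c2]]] := (proj2 D2) i hx.
  have dl : dom l by case: l2; lia.
  have dh : dom h by case: h2; lia.
  apply: wp_seq; apply: (wp_find P hK (proj1 D2) hx) => // s3 E3 r3.
  apply: wp_seq; apply: wp_assign => // s4 E4; rewrite /= r3 (eqv_cell E3) // l1 => r4.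
  have [rtA [a4 _]] := is_DA_eqv (eqv_trans E3 E4) isT isT A2.
  apply: wp_seq; apply: (wp_left_high P hK a4 dl r4) => // s5 E5 r5.
  have E25 := eqv_trans E3 (eqv_trans E4 E5).
  have c5 : vars s5 vc = (rt i)%:Z by rewrite (eqv_var E5) // (eqv_var E4).
  apply: wp_seq; apply: wp_assign => // s6 E6; rewrite /= c5 (eqv_cell E25) // h1 => r6.
  have E26 := eqv_trans E25 E6.
  have [rtB [b6 _]] := is_DB_eqv E26 isT isT B2.
  apply: wp_seq; apply: (wp_right_high P hK b6 dh r6) => //.
    by rewrite (eqv_var E26) // (eqv_var E2).
  move=> s7 E7 r7; have E27 := eqv_trans E26 E7.
  have c7 : vars s7 vc = (rt i)%:Z by rewrite (eqv_var E7) // (eqv_var E6).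
  have f7 : vars s7 vf = (high_left (shift A) l)%:Z by rewrite (eqv_var E7) // (eqv_var E6).
  have D7 := is_DD_eqv E27 isT isT isT isT D2.
  have i7 : vars s7 vi = i%:Z by rewrite (eqv_var E27).
  have fin s8 m : eqv [::] [:: dif] s7 s8 -> is_DD s8 fD (D i.+1) rt ->
    wp (Assign vi (Plus (Var vi) (Lit 1))) s8 m.+1 (fun s' _ => I i.+1 s').
    move=> E8 D8; apply: wp_assign => // s9 E9 r9.
    have E29 := eqv_trans E27 (eqv_trans E8 E9); split.
    - by apply: (eqv_weak (eqv_trans E2 E29)).
    - by rewrite r9 /= (eqv_var E8) // i7; lia.
    - exact: is_DA_eqv E29 isT isT A2.
    - exact: is_DB_eqv E29 isT isT B2.
    exact: is_DD_eqv E9 isT isT isT isT D8.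
  have lh z l' h' : dom z -> fD z = fD i -> is_first fD z l' -> is_last T fD z h' ->
      l' = l /\ h' = h.
    move=> hz e hl' hh'; split.
      exact: (first_uniq mD hx (first_class mD hz hx (esym e) hl') l2).
    exact: (last_uniq mD hx (last_class mD hz hx (esym e) hh') h2).
  have ec : holds P s7 (And (EqT (Var vf) (Lit 1)) (EqT (Var vg) (Lit 1))) =
      high_left (shift A) l && high_right T B h.
    by rewrite /= f7 r7; case: high_left; case: high_right.
  apply: wp_seq; apply: wp_if => //; rewrite ec => hh.
    have cv : eval s7 (Minus (Get inB (Var vi)) (Get inA (Minus (Var vi) (Lit 1)))) = delta i.
      rewrite /= i7 !(eqv_cell E27) // !(eqv_cell E2) // cB; last lia.
      by have -> : i%:Z - 1 = i.-1%:Z; [lia|rewrite cA //; lia].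
    apply: (wp_put_dif P K D7 hx _ cv) => // s8 E8 D8; apply: fin => //.
    apply: is_DD_ext D8 => // z l' h' c hz hl' hh'; case: eqP => ez.
      move=> ->; left; have [-> ->] := lh z l' h' hz ez hl' hh'; rewrite /minima hh /delta.
      by have [-> ->] := mono_add_eq mA mB hx hz ez.
    case=> [m|[iz c1]]; [by left|right; split=> //].
    by rewrite ltn_neqAle iz andbT; apply/eqP => e; apply: ez; rewrite e.
  apply: wp_skip; apply: fin.
    by apply: (eqv_weak (eqv_refl _ _)).
  apply: is_DD_ext D7 => // z l' h' c hz hl' hh' [m|[iz c1]]; first by left.
  have [ez|ez] := eqVneq z i; last by right; lia.
  left; have [-> ->] := lh z l' h' hz (congr1 fD ez) hl' hh'.
  by rewrite /minima (negbTE hh).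
by move=> s2 [E2 h2 _ _ _]; rewrite /= (eqv_var E2) // sT h2; lia.
Qed.
End Initialisation.

(** * The total running time *)

Lemma heating_prog_run (R : realDomainType) (T : nat) (P : nat -> R)
    (A B : nat -> int) (ord : seq nat) (s : state) :
  (0 < T)%N -> bounds T A B -> price_order T P ord -> initial_state T A B ord s ->
  exists (s' : state) (n : nat),
    [/\ exec P heating_prog s s' n,
        forall t : nat, (1 <= t <= T)%N ->
          cells s' outX t%:Z = (greedy T P A B ord t)%:Z
      & (n <= 112 * 256 * (T * alpha T))%N].
Proof.
move=> T0 hb [hp _] [sT cA cB cO]; have [hA hB _] := hb.
have so : size ord = T by rewrite (perm_size hp) size_iota.
have ho t : t \in ord -> (1 <= t <= T)%N by rewrite (perm_mem hp) mem_iota; lia.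
pose K := (alpha T).+2; have hK : (T <= tower K 1)%N := tower_alpha T.
have [s1 [k1 [e1 b1 v1 c1]]] := exec_init_singletons P sT.
have hs a (j : nat) : ~~ is_input a -> (1 <= j <= T)%N -> cells s1 a j%:Z = init_val a j%:Z.
  by move=> ha hj; rewrite c1 (negbTE ha) hj.
have sT1 : vars s1 vT = T%:Z by rewrite v1.
have cA1 u : (u <= T)%N -> cells s1 inA u%:Z = A u by move=> hu; rewrite c1 cA.
have cB1 u : (u <= T)%N -> cells s1 inB u%:Z = B u by move=> hu; rewrite c1 cB.
pose N := (1 + ((T.+1 - 2) * 18 + 1 + (3 + (1 + ((T.+1 - 1) * 17 + 1 +
  (1 + (T * 66 + 1 + 0)))))))%N.
have [s' [k2 [m [e2 b2 hQ]]]] : wp P T K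
    (Seq init_classes (Seq init_minima main_loop)) s1 N (fun s' _ =>
    forall t : nat, (1 <= t <= T)%N -> cells s' outX t%:Z = (greedy T P A B ord t)%:Z).
  apply: wp_seq; apply: (wp_init_classes P hK T0 hA hB sT1 cA1 cB1 hs).
  move=> s2 rt E2 A2 B2 D2; have sT2 : vars s2 vT = T%:Z by rewrite (eqv_var E2).
  have cA2 u : (u <= T)%N -> cells s2 inA u%:Z = A u.
    by move=> hu; rewrite (eqv_cell E2) // cA1.
  have cB2 u : (u <= T)%N -> cells s2 inB u%:Z = B u.
    by move=> hu; rewrite (eqv_cell E2) // cB1.
  apply: wp_seq; apply: (wp_init_minima P hK hb sT2 cA2 cB2 A2 B2 D2).
  move=> s3 E3 A3 B3 D3; apply: (@wp_main R P T K hK _ A B ord 0%N _ hb so ho) => //.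
  - by rewrite (eqv_var E3).
  - split=> //; first by exists rt.
    by move=> u hu; rewrite (eqv_cell E3) // (eqv_cell E2) // hs.
  by move=> i hi; rewrite (eqv_cell E3) // (eqv_cell E2) // c1 cO.
exists s', (k1 + k2)%N; split=> //; first exact: exec_seq e1 e2.
have t0 : tpot T K s1 = 0%N by apply: singletons_tpot.
have a0 := alpha_gt0 T; rewrite t0 muln0 addn0 /unit_cost /K in b2.
(* The three loops take [18 (T - 1)], [17 T] and [66 T] units; with the fixed ones this is
   [101 T - 9], so 111 is generous. *)
have hN : (N <= 111 * T)%N by rewrite /N; lia.
(* Since [alpha T >= 1], the summand 3 is absorbed. The creation of the singletons, [45 T + 7]
   steps, fits into the one multiple of [256 T alpha T] by which 112 exceeds 111. *)
have hU : (64 * (alpha T).+3 <= 256 * alpha T)%N by lia.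
have h := leq_mul hN hU.
have h' : (T <= T * alpha T)%N by rewrite leq_pmulr.
have e : (111 * T * (256 * alpha T) = 111 * 256 * (T * alpha T))%N.
  by rewrite -!mulnA; congr (_ * _)%N; rewrite mulnCA.
move: (T * alpha T)%N e h' h => X e h' h; lia.
Qed.

Theorem theorem2 (R : realDomainType) :
  exists C : nat,
    forall (T : nat) (P : nat -> R) (A B : nat -> int) (ord : seq nat)
           (s : state),
      (0 < T)%N ->
      bound_seq T A -> bound_seq T B ->
      (forall t : nat, (1 <= t <= T)%N -> A t <= B t) ->
      price_order T P ord ->
      initial_state T A B ord s ->
      optimal T P A B (greedy T P A B ord) /\
      exists (s' : state) (n : nat),
        [/\ exec P heating_prog s s' n,
            forall t : nat, (1 <= t <= T)%N ->
              cells s' outX t%:Z = (greedy T P A B ord t)%:Z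
          & (n <= C * (T * alpha T))%N].
Proof.
exists (112 * 256)%N => T P A B ord s T0 hA hB hAB ho hs.
have hb : bounds T A B.
  split=> // -[|t] ht; last exact: hAB.
  by have [-> _] := hA; have [-> _] := hB.
by split; [apply: greedy_optimal|apply: heating_prog_run].
Qed.
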